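(* Let $\alpha>0$, $H=\frac12(p^2-\alpha^2x^2)$, $t\in(0,\frac{\pi}{2\alpha})$, $\tau=it$, and let $\theta\in(0,\pi/2)$ with $\tan\theta=\alpha$. Let $U_\tau=\exp(t\rho(H))\circ\exp(-t\hat H)$ be the KSH transform, defined on the span $V$ of the Gaussian coherent states $\psi_Y$, $Y=(P,Q)\in\mathbb R^2$. Then: (a) $U_\tau$ intertwines the Heisenberg group representations: for all $P_0,Q_0\in\mathbb R$, $U_\tau\circ V^{(0)}_{P_0}=V^{(\tau)}_{P_0}\circ U_\tau$ and $U_\tau\circ W^{(0)}_{Q_0}=W^{(\tau)}_{Q_0}\circ U_\tau$ on $V$; (b) $U_\tau$ (extended from $V$ by continuity) is a unitary isomorphism $L^2(\mathbb R,dx)\otimes\sqrt{dx}\to\mathcal H_{\mathcal P_\tau}$; (c) for $Y=(P,Q)\in\mathbb R^2$, $$(U_\tau\psi_Y)(p,x)=\pi^{-1/2}\left|\frac{\sin\theta}{\sin(\theta+\alpha t)}\right|^{1/2}e^{-\int_0^t\left(L_H(p_{is},x_{is})-L_H(P_{is},Q_{is})\right)ds}\,e^{-iP_\tau(w_\tau-Q_\tau)-\frac{b_\tau}{2}(w_\tau-Q_\tau)^2}\otimes\sqrt{dw_\tau}$$ $$=\pi^{-1/2}\left|\frac{\sin\theta}{\sin(\theta+\alpha t)}\right|^{1/2}e^{-iP(x-Q)}\exp\!\left(\frac{-\cos\theta\sin(\alpha t)(p-P)^2-\sin\theta\cos(\alpha t)(x-Q)^2-2i\cos\theta\sin(\alpha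 t)(x-Q)(p-P)}{2\sin(\alpha t+\theta)}\right)\otimes\sqrt{dw_\tau},$$ where $b_\tau=\alpha\cot(\theta+\alpha t)$.
   Context: Work on $\mathbb R^2$ with coordinates $(x,p)$, $\omega=dx\wedge dp$, Hamiltonian vector fields $X_f=\frac{\partial f}{\partial p}\partial_x-\frac{\partial f}{\partial x}\partial_p$, trivial prequantum line bundle with connection $\nabla_X\psi=X(\psi)+i\,p\,dx(X)\psi$. The half-form corrected prequantum operator of $f$ is $\rho(f)=(i\nabla_{X_f}+f)\otimes1+i\otimes\mathcal L_{X_f}=\left(iX_f-(p\frac{\partial f}{\partial p}-f)\right)\otimes1+i\otimes\mathcal L_{X_f}$, acting on $\psi\otimes\sqrt{\mu}$ ($\mu$ a complex 1-form, $\mathcal L_X$ the Lie derivative on half-forms). Put $L_H=p\frac{\partial H}{\partial p}-H=\frac12(p^2+\alpha^2x^2)$ and $\hat H=\frac12\left(-\frac{d^2}{dx^2}-\alpha^2x^2\right)$. Complexified flow: for $s\in\mathbb R$, $p_{is}=\cos(\alpha s)p+i\alpha\sin(\alpha s)x$, $x_{is}=\frac{i}{\alpha}\sin(\alpha s)p+\cos(\alpha s)x$; likewise $P_{is},Q_{is}$ with $(p,x)$ replaced by $(P,Q)$; $P_\tau=P_{it},Q_\tau=Q_{it}$, and $w_\tau=x_{it}=\cos(\alpha t)x+\frac{i}{\alpha}\sin(\alpha t)p$. Schrödinger space: $\mathcal H_{Sch}=L^2(\mathbb R,dx)\otimes\sqrt{dx}$ with $\langle\psi_1,\psi_2\rangle=\sqrt\pi\int_{\mathbb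 R}\overline{\psi_1}\psi_2\,dx$. Gaussian coherent states: $\psi_Y(x)=\pi^{-1/2}e^{-iP(x-Q)-\frac12(x-Q)^2}\otimes\sqrt{dx}$, $Y=(P,Q)$; $V$ is their finite linear span. $\mathcal H_{\mathcal P_\tau}$ (for $t\in(0,\frac\pi{2\alpha})$) is the completion of the space of $\psi\otimes\sqrt{dw_\tau}$, $\psi\in C^\infty(\mathbb R^2)$, with $\nabla_{X_{w_\tau}}\psi=0$ and finite norm, for the inner product $\langle\psi_1\otimes\sqrt{dw_\tau},\psi_2\otimes\sqrt{dw_\tau}\rangle=\int_{\mathbb R^2}\overline{\psi_1}\psi_2\sqrt{\frac{dw_\tau\wedge d\bar w_\tau}{(-2i)dx\wedge dp}}\,dx\,dp$. Definition of $U_\tau$ on $V$: $\exp(-t\hat H)\psi_Y$ is the solution at time $t$ of $\partial_s\phi_s=-\hat H\phi_s$, $\phi_0=\psi_Y$ (a Gaussian); and for $\phi$ entire in $x$, $\exp(t\rho(H))(\phi\otimes\sqrt{dx})=e^{-\int_0^tL_H(p_{is},x_{is})ds}\,\phi(w_\tau)\otimes\sqrt{dw_\tau}$ (analytic continuation to imaginary time of the real-time prequantum flow); extend linearly. Heisenberg operators: on $\mathcal H_{Sch}$, $(V^{(0)}_{P_0}\phi)(x)=e^{-iP_0x}\phi(x)$, $(W^{(0)}_{Q_0}\phi)(x)=\phi(x-Q_0)$; on $\mathcal H_{\mathcal P_\tau}$, $V^{(\tau)}_{P_0}=e^{-iP_0\rho(x)}$, i.e. $(V^{(\tau)}_{P_0}\psi)(x,p)=e^{-iP_0x}\psi(x,p-P_0)$,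 and $W^{(\tau)}_{Q_0}=e^{iQ_0\rho(p)}$, i.e. $(W^{(\tau)}_{Q_0}\psi)(x,p)=\psi(x-Q_0,p)$ (acting on the function factor). *)

(* Defs.v *)
From HB Require Import structures.
From mathcomp Require Import all_boot all_order all_algebra.
From mathcomp Require Import all_classical all_reals all_analysis.
From mathcomp Require Import complex.
From Stdlib Require Import ClassicalEpsilon.
Set Implicit Arguments.
Unset Strict Implicit.
Unset Printing Implicit Defensive.
Import Order.TTheory GRing.Theory Num.Theory.
Import numFieldNormedType.Exports.
Local Open Scope ring_scope.
Local Open Scope classical_set_scope.
Local Open Scope complex_scope.

Section KSH.
Context {R : realType}.

(* ---------- complex numbers ---------- *)
Definition reC (z : R[i]) : R := complex.Re z.
Definition imC (z : R[i]) : R := complex.Im z.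
Definition cexp (z : R[i]) : R[i] :=
  (expR (reC z))%:C * Complex (cos (imC z)) (sin (imC z)).
Definition cabs2 (z : R[i]) : R := reC z ^+ 2 + imC z ^+ 2.

(* Lebesgue measure on R and on R^2 = R x R (coordinates (x,p)) *)
Definition leb := (@lebesgue_measure R).
Definition leb2 := (leb \x leb)%E.

(* integrals of complex-valued functions (real and imaginary parts) *)
Definition cint_seg (a b : R) (f : R -> R[i]) : R[i] :=
  Complex (Rintegral leb `[a, b] (reC \o f)) (Rintegral leb `[a, b] (imC \o f)).
Definition cint_line (f : R -> R[i]) : R[i] :=
  Complex (Rintegral leb setT (reC \o f)) (Rintegral leb setT (imC \o f)).
Definition cint_plane (f : R * R -> R[i]) : R[i] :=
  Complex (Rintegral leb2 setT (reC \o f)) (Rintegral leb2 setT (imC \o f)).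

(* derivative of a complex-valued function of a real variable *)
Definition derivC (g : R -> R[i]) (s : R) : Prop :=
  derivable (reC \o g) s 1 /\ derivable (imC \o g) s 1.
Definition dC (g : R -> R[i]) (s : R) : R[i] :=
  Complex (derive1 (reC \o g) s) (derive1 (imC \o g) s).

(* ---------- complexified classical flow ---------- *)
(* p_{is} and x_{is} evaluated at the point (p, x) *)
Definition pflow (alpha s p x : R) : R[i] :=
  (cos (alpha * s) * p)%:C + 'i * (alpha * sin (alpha * s) * x)%:C.
Definition xflow (alpha s p x : R) : R[i] :=
  'i * (sin (alpha * s) / alpha * p)%:C + (cos (alpha * s) * x)%:C.
(* L_H = p dH/dp - H = (p^2 + alpha^2 x^2)/2 *)
Definition LH (alpha : R) (p x : R[i]) : R[i] :=
  (p ^+ 2 + (alpha ^+ 2)%:C * x ^+ 2) / 2%:R.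
(* w_tau = wcx * x + wcp * p *)
Definition wcx (alpha t : R) : R[i] := (cos (alpha * t))%:C.
Definition wcp (alpha t : R) : R[i] := 'i * (sin (alpha * t) / alpha)%:C.
Definition wtau (alpha t x p : R) : R[i] := wcx alpha t * x%:C + wcp alpha t * p%:C.

(* ---------- Schroedinger side ---------- *)
(* Gaussian coherent state psi_Y, Y = (P,Q) (function factor of psi_Y (x) sqrt dx) *)
Definition coh (P Q x : R) : R[i] :=
  ((Num.sqrt pi)^-1)%:C * cexp (- ('i * (P * (x - Q))%:C) - ((x - Q) ^+ 2 / 2%:R)%:C).
(* an element of V = finite linear span: list of (coefficient, (P,Q)) *)
Definition Vlist := seq (R[i] * (R * R)).
Definition Vsum (u : Vlist) (x : R) : R[i] :=
  \sum_(k <- u) k.1 * coh k.2.1 k.2.2 x.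
(* <f,g> = sqrt(pi) int conj(f) g dx *)
Definition sch_inner (f g : R -> R[i]) : R[i] :=
  (Num.sqrt pi)%:C * cint_line (fun x => (f x)^* * g x).
Definition sch_dist2 (f g : R -> R[i]) : \bar R :=
  ((Num.sqrt pi)%:E * \int[leb]_x (cabs2 (f x - g x))%:E)%E.
Definition L2line (f : R -> R[i]) : Prop :=
  measurable_fun setT (reC \o f) /\ measurable_fun setT (imC \o f) /\
  (\int[leb]_x (cabs2 (f x))%:E < +oo)%E.

(* ---------- exp(-t H^) psi_Y : Gaussian solution of d_s phi = - H^ phi ----------
   H^ = (1/2)(- d^2/dx^2 - alpha^2 x^2); gaussF a b c z = exp(a z^2 + b z + c) *)
Definition gaussF (a b c : R[i]) (z : R[i]) : R[i] := cexp (a * z ^+ 2 + b * z + c).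
Definition heat_gauss (alpha t P Q : R) (abc : R[i] * R[i] * R[i]) : Prop :=
  exists (delta : R) (A B C : R -> R[i]),
    0 < delta /\
    (forall x, gaussF (A 0) (B 0) (C 0) x%:C = coh P Q x) /\
    (forall s x, - delta < s -> s < t + delta ->
       let phi := fun s' x' => gaussF (A s') (B s') (C s') x'%:C in
       derivC (fun s' => phi s' x) s /\ derivC (phi s) x /\
       derivC (dC (phi s)) x /\
       dC (fun s' => phi s' x) s =
         (2%:R)^-1 * dC (dC (phi s)) x + ((alpha ^+ 2 * x ^+ 2) / 2%:R)%:C * phi s x) /\
    abc = (A t, B t, C t).
Definition heat_coef (alpha t P Q : R) : R[i] * R[i] * R[i] :=
  epsilon (inhabits (0, 0, 0)) (heat_gauss alpha t P Q).

(* ---------- exp(t rho(H)) on an (entire) Gaussian ---------- *)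
Definition rhoflow (alpha t : R) (abc : R[i] * R[i] * R[i]) (x p : R) : R[i] :=
  cexp (- cint_seg 0 t (fun s => LH alpha (pflow alpha s p x) (xflow alpha s p x)))
  * gaussF abc.1.1 abc.1.2 abc.2 (wtau alpha t x p).

(* KSH transform U_tau = exp(t rho(H)) o exp(-t H^), on psi_Y and on V;
   values are the function factor psi(x,p) of psi (x) sqrt(dw_tau) *)
Definition KSH_coh (alpha t P Q : R) : R -> R -> R[i] :=
  rhoflow alpha t (heat_coef alpha t P Q).
Definition KSH (alpha t : R) (u : Vlist) (x p : R) : R[i] :=
  \sum_(k <- u) k.1 * KSH_coh alpha t k.2.1 k.2.2 x p.

(* ---------- the space H_{P_tau} ---------- *)
Definition pdx (psi : R -> R -> R[i]) (x p : R) : R[i] := dC (fun x' => psi x' p) x.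
Definition pdp (psi : R -> R -> R[i]) (x p : R) : R[i] := dC (psi x) p.
(* C^k (k = n) regularity on R^2 *)
Fixpoint smoothn (n : nat) (psi : R -> R -> R[i]) : Prop :=
  match n with
  | O => continuous (fun xp : R * R => reC (psi xp.1 xp.2)) /\
         continuous (fun xp : R * R => imC (psi xp.1 xp.2))
  | S n' => (forall x p, derivC (fun x' => psi x' p) x /\ derivC (psi x) p) /\
            smoothn n' psi /\ smoothn n' (pdx psi) /\ smoothn n' (pdp psi)
  end.
Definition smooth2 (psi : R -> R -> R[i]) : Prop := forall n, smoothn n psi.
(* nabla_{X_{w_tau}} psi, with X_f = f_p d_x - f_x d_p and
   nabla_X psi = X(psi) + i p dx(X) psi *)
Definition nabla_Xw (alpha t : R) (psi : R -> R -> R[i]) (x p : R) : R[i] :=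
  wcp alpha t * pdx psi x p - wcx alpha t * pdp psi x p
  + 'i * p%:C * wcp alpha t * psi x p.
(* sqrt( dw /\ dbar w / ((-2i) dx /\ dp) ), with dw /\ dbar w = (a conj b - b conj a) dx /\ dp *)
Definition hf_weight (alpha t : R) : R :=
  Num.sqrt (reC ((wcx alpha t * (wcp alpha t)^* - wcp alpha t * (wcx alpha t)^*)
                 / (- (2%:R * 'i)))).
Definition HP_inner (alpha t : R) (psi1 psi2 : R -> R -> R[i]) : R[i] :=
  cint_plane (fun xp => (psi1 xp.1 xp.2)^* * psi2 xp.1 xp.2 * (hf_weight alpha t)%:C).
Definition HP_dist2 (alpha t : R) (psi1 psi2 : R -> R -> R[i]) : \bar R :=
  (\int[leb2]_xp (cabs2 (psi1 xp.1 xp.2 - psi2 xp.1 xp.2) * hf_weight alpha t)%:E)%E.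
Definition in_HP (alpha t : R) (psi : R -> R -> R[i]) : Prop :=
  smooth2 psi /\ (forall x p, nabla_Xw alpha t psi x p = 0) /\
  (\int[leb2]_xp (cabs2 (psi xp.1 xp.2) * hf_weight alpha t)%:E < +oo)%E.

(* ---------- Heisenberg operators ---------- *)
Definition V0 (P0 : R) (f : R -> R[i]) (x : R) : R[i] := cexp (- ('i * (P0 * x)%:C)) * f x.
Definition W0 (Q0 : R) (f : R -> R[i]) (x : R) : R[i] := f (x - Q0).
Definition Vtau (P0 : R) (psi : R -> R -> R[i]) (x p : R) : R[i] :=
  cexp (- ('i * (P0 * x)%:C)) * psi x (p - P0).
Definition Wtau (Q0 : R) (psi : R -> R -> R[i]) (x p : R) : R[i] := psi (x - Q0) p.

(* ---------- the two explicit formulas of part (c) ---------- *)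
Definition prefactor (alpha t theta : R) : R :=
  (Num.sqrt pi)^-1 * Num.sqrt `|sin theta / sin (theta + alpha * t)|.
Definition formula1 (alpha t theta P Q x p : R) : R[i] :=
  let Pt := pflow alpha t P Q in
  let Qt := xflow alpha t P Q in
  let bt := alpha * (cos (theta + alpha * t) / sin (theta + alpha * t)) in
  let w := wtau alpha t x p in
  (prefactor alpha t theta)%:C *
  cexp (- cint_seg 0 t (fun s => LH alpha (pflow alpha s p x) (xflow alpha s p x)
                                 - LH alpha (pflow alpha s P Q) (xflow alpha s P Q))) *
  cexp (- ('i * Pt * (w - Qt)) - (bt / 2%:R)%:C * (w - Qt) ^+ 2).
Definition formula2 (alpha t theta P Q x p : R) : R[i] :=
  (prefactor alpha t theta)%:C * cexp (- ('i * (P * (x - Q))%:C)) *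
  cexp ((( - (cos theta * sin (alpha * t) * (p - P) ^+ 2)
           - sin theta * cos (alpha * t) * (x - Q) ^+ 2)%:C
         - 'i * (2%:R * cos theta * sin (alpha * t) * (x - Q) * (p - P))%:C)
        / (2%:R * sin (alpha * t + theta))%:C).

End KSH.

(* Main.v *)
(* Solving the heat equation with Gaussian data reduces to Riccati-type equations for the
   coefficients of the exponent; the coefficients of any Gaussian solution are differentiable
   (recovered from the solution by averaging out phases), so linear ODE uniqueness pins down
   [heat_coef] and gives the explicit formulas. With [c = cos (alpha t)] and
   [d = sin (alpha t) / alpha], the image of a coherent state is a Gaussian in [c x + i d p];
   overlaps of such images factor into one-dimensional Gaussian integrals and agree with the
   overlaps of the coherent states, hence the isometry. A polarized [psi] times a suitable
   exponential is holomorphic in [c x + i d p], and its Gaussian mean value property is a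
   reproducing formula: [psi] is a multiple of the integral of [psi Y] times the image of the
   coherent state at [Y]. This shows that null vectors vanish, so that the transform is well
   defined on the span, and truncating the integral (Schur test) and replacing it by Riemann
   sums gives density of the image. On the line, trigonometric polynomials times a Gaussian
   are combinations of coherent states; their closure contains the indicators of intervals,
   then of Borel sets, hence all of [L^2]. *)
Require Import Defs.
From HB Require Import structures.
From mathcomp Require Import all_boot all_order all_algebra.
From mathcomp Require Import all_classical all_reals all_analysis.
From mathcomp Require Import complex.
From mathcomp Require Import measurable_realfun ring lra.
Set Implicit Arguments.
Unset Strict Implicit.
Unset Printing Implicit Defensive.
Import Order.TTheory GRing.Theory Num.Theory.
Import numFieldNormedType.Exports.
Local Open Scope ring_scope.
Local Open Scope classical_set_scope.
Local Open Scope complex_scope.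
Import Defs.

(** The hypothesis [tan theta = alpha] says that [alpha * cot theta = 1]. The quadratic coefficient
    of the evolving Gaussian is [alpha * cot (theta + alpha * s)] up to a constant, and [theta] is
    the phase at which it starts from the coefficient of a coherent state. The same hypothesis gives
    [sin (theta + alpha * t) = sin theta * (c + d)], after which [theta] leaves the formulas and
    [c > 0], [d > 0] are what matters. Two obstacles shape the uniqueness part: [heat_gauss] makes
    the Gaussian differentiable but not its coefficients, and the constant coefficient is fixed only
    modulo [2 pi i]. Hence [cexp (C s)] is followed in place of [C s], and values of Gaussians are
    identified, not triples. Holomorphy appears only as a pair of real functions linked by the
    Cauchy-Riemann equations. The mean value property is derived from them for compactly supported
    profiles, by dilating about the centre, then for Gaussians by a limit. It serves twice: for the
    Fourier integral of a Gaussian and for the reproducing formula. *)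

Section ComplexBasics.
Context {R : realType}.
Implicit Types (z w : R[i]) (x y : R).

Lemma ceqP z w : reC z = reC w -> imC z = imC w -> z = w.
Proof. by case: z; case: w => a b c d /= -> ->. Qed.

Lemma reCD z w : reC (z + w) = reC z + reC w. Proof. by case: z; case: w. Qed.
Lemma imCD z w : imC (z + w) = imC z + imC w. Proof. by case: z; case: w. Qed.
Lemma reCN z : reC (- z) = - reC z. Proof. by case: z. Qed.
Lemma imCN z : imC (- z) = - imC z. Proof. by case: z. Qed.
Lemma reCM z w : reC (z * w) = reC z * reC w - imC z * imC w.
Proof. by case: z; case: w. Qed.
Lemma imCM z w : imC (z * w) = reC z * imC w + imC z * reC w.
Proof. by case: z; case: w. Qed.
Lemma reCr x : reC x%:C = x. Proof. by []. Qed.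
Lemma imCr x : imC x%:C = 0. Proof. by []. Qed.
Lemma reCi : reC ('i : R[i]) = 0. Proof. by []. Qed.
Lemma imCi : imC ('i : R[i]) = 1. Proof. by []. Qed.
Lemma reCJ z : reC z^* = reC z. Proof. by case: z. Qed.
Lemma imCJ z : imC z^* = - imC z. Proof. by case: z. Qed.
Lemma reC0 : reC (0 : R[i]) = 0. Proof. by []. Qed.
Lemma imC0 : imC (0 : R[i]) = 0. Proof. by []. Qed.
Lemma reC1 : reC (1 : R[i]) = 1. Proof. by []. Qed.
Lemma imC1 : imC (1 : R[i]) = 0. Proof. by []. Qed.
Lemma natC n : (n%:R : R[i]) = (n%:R : R)%:C.
Proof. by rewrite rmorph_nat. Qed.
Lemma invC x : (x%:C)^-1 = (x^-1)%:C :> R[i].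
Proof. by rewrite fmorphV. Qed.
Lemma reCX2 z : reC (z ^+ 2) = reC z ^+ 2 - imC z ^+ 2.
Proof. by rewrite !expr2 reCM. Qed.
Lemma imCX2 z : imC (z ^+ 2) = 2 * reC z * imC z.
Proof. by rewrite !expr2 imCM; ring. Qed.

Lemma reC_cexp z : reC (cexp z) = expR (reC z) * cos (imC z).
Proof. by rewrite /cexp reCM !reCr imCr /=; ring. Qed.
Lemma imC_cexp z : imC (cexp z) = expR (reC z) * sin (imC z).
Proof. by rewrite /cexp imCM !reCr imCr /=; ring. Qed.

Definition reimE := (reC_cexp, imC_cexp, natC, invC, reCD, imCD, reCN, imCN, reCX2, imCX2, reCM, imCM, reCr, imCr,
  reCi, imCi, reCJ, imCJ, reC0, imC0, reC1, imC1).

Lemma cexpD z w : cexp (z + w) = cexp z * cexp w.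
Proof.
by apply: ceqP; rewrite !reimE expRD ?cosD ?sinD; ring.
Qed.
Lemma cexp0 : cexp (0 : R[i]) = 1.
Proof. by apply: ceqP; rewrite !reimE expR0 ?cos0 ?sin0; ring. Qed.
Lemma cexpr x : cexp x%:C = (expR x)%:C.
Proof. by apply: ceqP; rewrite !reimE ?cos0 ?sin0; ring. Qed.
Lemma cexpVK z : cexp (- z) * cexp z = 1.
Proof. by rewrite -cexpD addNr cexp0. Qed.
Lemma cexp_neq0 z : cexp z != 0.
Proof.
apply/eqP => z0; have := cexpVK z; rewrite z0 mulr0 => /eqP.
by rewrite eq_sym oner_eq0.
Qed.
Lemma cexpN z : cexp (- z) = (cexp z)^-1.
Proof. by rewrite -[LHS](mulfK (cexp_neq0 z)) cexpVK mul1r. Qed.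

Lemma cabs2_ge0 z : 0 <= cabs2 z.
Proof. by rewrite /cabs2 addr_ge0 ?sqr_ge0. Qed.
Lemma cabs2_eq0 z : cabs2 z = 0 -> z = 0.
Proof.
move/eqP; rewrite /cabs2 paddr_eq0 ?sqr_ge0// !sqrf_eq0 => /andP[/eqP a /eqP b].
exact: ceqP.
Qed.
Lemma cabs2M z w : cabs2 (z * w) = cabs2 z * cabs2 w.
Proof. by rewrite /cabs2 !reimE; ring. Qed.
Lemma cabs2_cexp z : cabs2 (cexp z) = expR (reC z) ^+ 2.
Proof.
rewrite /cabs2 reC_cexp imC_cexp !exprMn -mulrDr cos2Dsin2 ?mulr1//.
Qed.
Lemma cabs2_real x : cabs2 (x%:C) = x ^+ 2.
Proof. by rewrite /cabs2 !reimE expr0n/= addr0. Qed.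
Lemma cabs2E z : z^* * z = (cabs2 z)%:C.
Proof. by apply: ceqP; rewrite !reimE /cabs2; ring. Qed.
Lemma cabs2D_le z w : cabs2 (z + w) <= 2 * cabs2 z + 2 * cabs2 w.
Proof.
rewrite /cabs2 !reimE.
have := sqr_ge0 (reC z - reC w); have := sqr_ge0 (imC z - imC w); lra.
Qed.
Lemma normr_reC_le z : `|reC z| ^+ 2 <= cabs2 z.
Proof. by rewrite real_normK ?num_real// lerDl sqr_ge0. Qed.
Lemma normr_imC_le z : `|imC z| ^+ 2 <= cabs2 z.
Proof. by rewrite real_normK ?num_real// lerDr sqr_ge0. Qed.

End ComplexBasics.

(** * Differentiation rules for real and complex functions of a real variable *)

Section RealDerivative.
Context {R : realType}.
Implicit Types (f g : R -> R) (s a b : R).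

Lemma isd_eq f s a b : is_derive s 1 f a -> a = b -> is_derive s 1 f b.
Proof. by move=> ? <-. Qed.
Lemma isd_cst a s : is_derive s 1 (fun=> a) 0.
Proof. exact: is_derive_cst. Qed.
Lemma isd_id s : is_derive s 1 (fun s : R => s) 1.
Proof. exact: is_derive_id. Qed.
Lemma isdD f g s a b : is_derive s 1 f a -> is_derive s 1 g b ->
  is_derive s 1 (fun s => f s + g s) (a + b).
Proof. exact: is_deriveD. Qed.
Lemma isdN f s a : is_derive s 1 f a -> is_derive s 1 (fun s => - f s) (- a).
Proof. exact: is_deriveN. Qed.
Lemma isdB f g s a b : is_derive s 1 f a -> is_derive s 1 g b ->
  is_derive s 1 (fun s => f s - g s) (a - b).
Proof. exact: is_deriveB. Qed.
Lemma isdM f g s a b : is_derive s 1 f a -> is_derive s 1 g b ->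
  is_derive s 1 (fun s => f s * g s) (a * g s + f s * b).
Proof.
by move=> fa gb; apply: isd_eq (is_deriveM fa gb) _; rewrite /GRing.scale/=; ring.
Qed.
Lemma isdMl k g s b : is_derive s 1 g b -> is_derive s 1 (fun s => k * g s) (k * b).
Proof. by move=> gb; apply: isd_eq (isdM (isd_cst k s) gb) _; ring. Qed.
Lemma isd_comp f g s a b : is_derive (g s) 1 f a -> is_derive s 1 g b ->
  is_derive s 1 (fun s => f (g s)) (a * b).
Proof. exact: is_derive1_comp. Qed.
Lemma isdX2 f s a : is_derive s 1 f a ->
  is_derive s 1 (fun s => f s ^+ 2) (2 * f s * a).
Proof.
move=> fa; under eq_fun do rewrite expr2.
by apply: isd_eq (isdM fa fa) _; ring.
Qed.
Lemma isd_continuous f s a : is_derive s 1 f a -> {for s, continuous f}.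
Proof.
by move=> fa; apply: differentiable_continuous; exact/derivable1_diffP/ex_derive.
Qed.
Lemma isd_derivable f s a : is_derive s 1 f a -> derivable f s 1.
Proof. by move=> fa; exact: ex_derive. Qed.
Lemma isd_derive1 f s a : is_derive s 1 f a -> f^`() s = a.
Proof. by move=> fa; rewrite derive1E derive_val. Qed.

End RealDerivative.

Section ComplexDerivative.
Context {R : realType}.
Implicit Types (f g : R -> R[i]) (s x : R) (d e k : R[i]).

(** Joins the existence ([derivC]) and the value ([dC]) of a derivative, so that the rules compose
    like those of [is_derive]. *)
Definition isdC f s d :=
  is_derive s 1 (reC \o f) (reC d) /\ is_derive s 1 (imC \o f) (imC d).

Lemma isdC_derivC f s d : isdC f s d -> derivC f s.
Proof. by case=> a b; split; apply: ex_derive. Qed.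

Lemma isdC_dC f s d : isdC f s d -> dC f s = d.
Proof. by case=> a b; rewrite /dC !derive1E !derive_val; apply: ceqP. Qed.

Lemma derivC_isdC f s : derivC f s -> isdC f s (dC f s).
Proof. by case=> a b; split; rewrite /= derive1E; exact: derivableP. Qed.

Lemma isdC_eq f s d e : isdC f s d -> d = e -> isdC f s e.
Proof. by move=> ? <-. Qed.

Lemma isdC_cst k s : isdC (fun=> k) s 0.
Proof. by split; exact: is_derive_cst. Qed.

Lemma isdC_real (f : R -> R) s (d : R) : is_derive s 1 f d -> isdC (fun s => (f s)%:C) s d%:C.
Proof. by move=> fd; split; [exact: fd|exact: is_derive_cst]. Qed.

Lemma isdCD f g s d e : isdC f s d -> isdC g s e ->
  isdC (fun s => f s + g s) s (d + e).
Proof.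
move=> [fr fi] [gr gi]; split.
- have -> : reC \o (fun s => f s + g s) = (reC \o f) + (reC \o g).
    by apply/funext => u /=; rewrite reimE.
  by rewrite reCD; exact: is_deriveD.
- have -> : imC \o (fun s => f s + g s) = (imC \o f) + (imC \o g).
    by apply/funext => u /=; rewrite reimE.
  by rewrite imCD; exact: is_deriveD.
Qed.

Lemma isdCM f g s d e : isdC f s d -> isdC g s e ->
  isdC (fun s => f s * g s) s (d * g s + f s * e).
Proof.
move=> [fr fi] [gr gi]; split.
- have -> : reC \o (fun s => f s * g s) =
     (reC \o f) * (reC \o g) - (imC \o f) * (imC \o g).
    by apply/funext => u /=; rewrite !reimE.
  by apply: isd_eq (isdB (isdM fr gr) (isdM fi gi)) _; rewrite !reimE/=; ring.
- have -> : imC \o (fun s => f s * g s) =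
     (reC \o f) * (imC \o g) + (imC \o f) * (reC \o g).
    by apply/funext => u /=; rewrite !reimE.
  by apply: isd_eq (isdD (isdM fr gi) (isdM fi gr)) _; rewrite !reimE/=; ring.
Qed.

Lemma isdCMl k g s e : isdC g s e -> isdC (fun s => k * g s) s (k * e).
Proof. by move=> ge; apply: isdC_eq (isdCM (isdC_cst k s) ge) _; ring. Qed.

Lemma isdCN f s d : isdC f s d -> isdC (fun s => - f s) s (- d).
Proof.
move=> fd; have := isdCMl (-1) fd; rewrite mulN1r.
by congr (isdC _ _ _); apply/funext => u; rewrite mulN1r.
Qed.

Lemma isdCB f g s d e : isdC f s d -> isdC g s e ->
  isdC (fun s => f s - g s) s (d - e).
Proof. by move=> fd ge; apply: isdCD => //; exact: isdCN. Qed.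

Lemma isdC_cexp f s d : isdC f s d -> isdC (fun s => cexp (f s)) s (d * cexp (f s)).
Proof.
move=> [fr fi]; split.
- have -> : reC \o (fun s => cexp (f s)) =
     (expR \o (reC \o f)) * (cos \o (imC \o f)).
    by apply/funext => u; exact: reC_cexp.
  apply: isd_eq (isdM (isd_comp (is_derive_expR _) fr) (isd_comp (is_derive_cos _) fi)) _.
  by rewrite !reimE/=; ring.
- have -> : imC \o (fun s => cexp (f s)) =
     (expR \o (reC \o f)) * (sin \o (imC \o f)).
    by apply/funext => u; exact: imC_cexp.
  apply: isd_eq (isdM (isd_comp (is_derive_expR _) fr) (isd_comp (is_derive_sin _) fi)) _.
  by rewrite !reimE/=; ring.
Qed.

Lemma isdC_id s : isdC (fun x => x%:C) s 1.
Proof. exact: (isdC_real (is_derive_id s 1)). Qed.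

End ComplexDerivative.

(** * Recovering an exponent from its exponential; uniqueness for linear equations *)

Section DerivabilityOfPhase.
Context {R : realType}.

(** Writing [z^-1 = z^* / |z|^2] reduces the rule to a real inverse and to conjugation. *)
Lemma derivC_inv (f : R -> R[i]) (s : R) (d : R[i]) : f s != 0 -> isdC f s d ->
  isdC (fun s => (f s)^-1) s (- d / f s ^+ 2).
Proof.
move=> fs0 [fr fi].
have cne : cabs2 (f s) != 0 by apply: contraNneq fs0 => /cabs2_eq0 ->.
have invE z : z^-1 = ((cabs2 z)^-1)%:C * z^* :> R[i].
  have [->|z0] := eqVneq z 0; first by rewrite invr0; apply: ceqP; rewrite !reimE; ring.
  have c0 : cabs2 z != 0 by apply: contraNneq z0 => /cabs2_eq0 ->.
  apply: (mulfI z0); rewrite divff// mulrCA [z * _]mulrC cabs2E -rmorphM/=.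
  by rewrite mulVf.
have cd : is_derive s 1 (fun s => cabs2 (f s))
    (2 * reC (f s) * reC d + 2 * imC (f s) * imC d).
  have -> : (fun s => cabs2 (f s)) = (reC \o f) * (reC \o f) + (imC \o f) * (imC \o f).
    by apply/funext => u; rewrite /cabs2 !expr2.
  by apply: isd_eq (isdD (isdM fr fr) (isdM fi fi)) _ => /=; ring.
have conjd : isdC (fun s => (f s)^*) s d^*.
  split.
    have -> : reC \o (fun s => (f s)^*) = reC \o f.
      by apply/funext => u; rewrite /= reCJ.
    by rewrite reCJ.
  have -> : imC \o (fun s => (f s)^*) = - (imC \o f).
    by apply/funext => u; rewrite /= imCJ.
  by rewrite imCJ; exact: is_deriveN.
have := isdCM (isdC_real (@is_deriveV _ (fun s => cabs2 (f s)) s _ 1 cne cd)) conjd.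
have -> : (fun s => ((cabs2 (f s))^-1)%:C * (f s)^*) = (fun s => (f s)^-1).
  by apply/funext => u; rewrite invE.
move=> /isdC_eq; apply.
apply: (@mulfI _ (f s ^+ 2)); first by rewrite expf_neq0.
rewrite [RHS]mulrCA mulfV ?expf_neq0// mulr1.
apply: ceqP; rewrite !reimE /GRing.scale/= /cabs2 ?reimE;
  (field; move: cne; rewrite /cabs2 //).
Qed.

Lemma abs_sin_le1 (x : R) : `|sin x| <= 1.
Proof. by rewrite ler_norml sin_geN1 sin_le1. Qed.

(* Averaging over y turns the phases cos (a s * y) into sin (a s) / a s, which
   controls a s itself, not only its class modulo 2 pi. *)
Lemma phase_derivable (a : R -> R) (u v s0 : R) : u < s0 -> s0 < v ->
  (forall y s : R, 0 <= y -> u < s -> s < v ->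
     derivable (fun s => cos (a s * y)) s 1 /\ derivable (fun s => sin (a s * y)) s 1) ->
  derivable a s0 1.
Proof.
move=> us0 s0v ad.
(* Recentred at [s0], the average of [cos (e s * y)] over [0 <= y <= 1] equals 1 there; its
   continuity is what keeps [e] from jumping by a multiple of [2 pi]. *)
pose e s := a s - a s0.
have ed (y s : R) : 0 <= y -> u < s -> s < v ->
     derivable (fun s => cos (e s * y)) s 1 /\ derivable (fun s => sin (e s * y)) s 1.
  move=> y0 us sv; have [/derivableP c /derivableP d] := ad y s y0 us sv.
  have -> : (fun s => cos (e s * y)) =
     (fun s => cos (a s * y) * cos (a s0 * y) + sin (a s * y) * sin (a s0 * y)).
    by apply/funext => r; rewrite /e mulrBl cosB.
  have -> : (fun s => sin (e s * y)) =
     (fun s => sin (a s * y) * cos (a s0 * y) - cos (a s * y) * sin (a s0 * y)).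
    by apply/funext => r; rewrite /e mulrBl sinB.
  have kd k := isd_cst k s.
  split; first exact: (isd_derivable (isdD (isdM c (kd _)) (isdM d (kd _)))).
  exact: (isd_derivable (isdB (isdM d (kd _)) (isdM c (kd _)))).
pose mu := (@lebesgue_measure R).
pose F s := \int[mu]_(y in `[0, 1]) cos (e s * y).
have ccos k : continuous (fun y : R => cos (k * y)).
  move=> y; apply: continuous_comp; last exact: continuous_cos.
  exact: mulrl_continuous.
have icos k : mu.-integrable `[0, 1] (EFin \o (fun y : R => cos (k * y))).
  apply: continuous_compact_integrable; first exact: segment_compact.
  exact: continuous_subspaceT.
have Fcont : {for s0, continuous F}.
  apply: (@continuity_under_integral R _ _ mu (fun s y => cos (e s * y)) `[0, 1]
     (measurable_itv _) u v _ _ (cst 1)).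
  - by move=> s _; exact: icos.
  - apply: aeW => y; rewrite /= in_itv/= => /andP[y0 _] s.
    rewrite inE /= in_itv/= => /andP[us sv].
    have [c _] := ed y s y0 us sv.
    by apply: differentiable_continuous; exact/derivable1_diffP.
  - apply: continuous_compact_integrable; first exact: segment_compact.
    by apply: continuous_subspaceT => ?; exact: cvg_cst.
  - move=> s _; apply: aeW => y _ /=.
    by rewrite ler_norml cos_geN1 cos_le1.
  - by rewrite inE/= in_itv/= us0.
have FE (s : R) : e s != 0 -> F s = sin (e s) / e s.
  move=> es0; rewrite /F /Rintegral.
  have dF (y : R) : is_derive y 1 (fun y => sin (e s * y) / e s) (cos (e s * y)).
    have -> : (fun y => sin (e s * y) / e s) = (e s)^-1 \*: (sin \o ( *%R (e s))).
      by apply/funext => r /=; rewrite mulrC.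
    by apply: is_derive_eq; rewrite /GRing.scale/=; field.
  have cF : continuous (fun y => sin (e s * y) / e s).
    by move=> y; apply: differentiable_continuous; exact/derivable1_diffP/ex_derive.
  rewrite (@continuous_FTC2 _ _ (fun y => sin (e s * y) / e s)) ?ltr01//=.
  - by rewrite mulr1 mulr0 sin0 mul0r subr0.
  - exact: continuous_subspaceT.
  - split.
    + by move=> y _; exact: ex_derive.
    + by apply: cvg_at_right_filter; exact: cF.
    + by apply: cvg_at_left_filter; exact: cF.
  - by move=> y _; rewrite derive1E derive_val.
have F0 : F s0 = 1.
  rewrite /F /e subrr; under eq_Rintegral do rewrite mul0r cos0.
  by rewrite Rintegral_cst//= lebesgue_measure_itv/= lte_fin ltr01 sube0 mulr1.
(* Near [s0] the average exceeds 1/2, and [|sin (e s)| <= 1] then forces [|e s| < 2]. *)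
have ebnd : \forall s \near s0, `|e s| < 2.
  have : \forall s \near s0, 2^-1 < F s.
    by apply: (cvgr_gt _ Fcont); rewrite F0; lra.
  apply: filterS => s Fs.
  have [->|es0] := eqVneq (e s) 0; first by rewrite normr0; lra.
  move: Fs; rewrite FE// => Fs.
  have : 2^-1 < `|e s|^-1.
    apply: (lt_le_trans Fs); apply: (le_trans (ler_norm _)).
    rewrite normrM normfV ler_piMl// ?invr_ge0//; exact: abs_sin_le1.
  by rewrite ltf_pV2// posrE// normr_gt0.
(* Half of [e s] lies strictly between -1 and 1, inside the range where the arcsine inverts the
   sine; hence the factor 2. *)
have eE : \forall s \near s0, 2 * asin (sin (e s * 2^-1)) + a s0 = a s.
  apply: filterS ebnd => s; rewrite ltr_norml => /andP[e1 e2].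
  rewrite sinK; first by rewrite /e; field.
  by rewrite in_itv/=; have := @pi_ge2 R; lra.
apply: (near_eq_derivable eE).
have [_ /derivableP sd] := ed 2^-1 s0 ltac:(lra) us0 s0v.
have asd : is_derive (sin (e s0 * 2^-1)) 1 asin (Num.sqrt (1 - sin (e s0 * 2^-1) ^+ 2))^-1.
  by apply: is_derive1_asin; rewrite /e subrr mul0r sin0; lra.
have -> : (fun s => 2 * asin (sin (e s * 2^-1)) + a s0) =
   2 \*: (asin \o (fun s => sin (e s * 2^-1))) + cst (a s0) by [].
exact: ex_derive.
Qed.

(** The modulus gives [reC a] through a logarithm. Dividing the modulus out leaves the pure phases
    of [imC a], to which [phase_derivable] applies. *)
Lemma exponent_derivable (a : R -> R[i]) (u v s0 : R) : u < s0 -> s0 < v ->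
  (forall y s : R, 0 <= y -> u < s -> s < v -> derivC (fun s => cexp (a s * y%:C)) s) ->
  derivC a s0.
Proof.
move=> us0 s0v ad.
have red (y s : R) : 0 <= y -> u < s -> s < v -> derivable (fun s => expR (reC (a s) * y)) s 1.
  move=> y0 us sv.
  (* At [y / 2] the squared modulus of the exponential is [expR (reC (a s) * y)]. *)
  have [/derivableP c /derivableP d] := ad (y * 2^-1) s ltac:(lra) us sv.
  have -> : (fun s => expR (reC (a s) * y)) =
    (reC \o (fun s => cexp (a s * (y * 2^-1)%:C))) *
    (reC \o (fun s => cexp (a s * (y * 2^-1)%:C))) +
    (imC \o (fun s => cexp (a s * (y * 2^-1)%:C))) *
    (imC \o (fun s => cexp (a s * (y * 2^-1)%:C))).
    apply/funext => r; rewrite -[RHS]/(reC _ * reC _ + imC _ * imC _).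
    by rewrite -!expr2 -/(cabs2 _) cabs2_cexp !reimE expr2 -expRD; congr expR; field.
  exact: (isd_derivable (isdD (isdM c c) (isdM d d))).
have rea (s : R) : u < s -> s < v -> derivable (reC \o a) s 1.
  move=> us sv; have /derivableP c := red 1 s ltac:(lra) us sv.
  have -> : reC \o a = @ln R \o (fun s => expR (reC (a s) * 1)).
    by apply/funext => r /=; rewrite expRK mulr1.
  have lnd : is_derive (expR (reC (a s) * 1)) 1 (@ln R) (expR (reC (a s) * 1))^-1.
    by apply: is_derive1_ln; exact: expR_gt0.
  exact: ex_derive.
split; first exact: rea.
apply: (phase_derivable us0 s0v) => y s y0 us sv.
have [/derivableP c /derivableP d] := ad y s y0 us sv.
have /derivableP r := rea s us sv.
have rd : is_derive s 1 (fun s => expR (- (reC (a s) * y)))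
     (- (y * 'D_1 (reC \o a) s) * expR (- (reC (a s) * y))).
  have -> : (fun s => expR (- (reC (a s) * y))) = expR \o (- (y \*: (reC \o a))).
    by apply/funext => w /=; congr expR; rewrite mulrC.
  apply: is_derive_eq.
  rewrite -[(- (y \*: _)) s]/(- (y * reC (a s))) /GRing.scale/=.
  by rewrite [reC _ * y]mulrC; ring.
split.
- have -> : (fun s => cos (imC (a s) * y)) =
    (fun s => expR (- (reC (a s) * y))) * (reC \o (fun s => cexp (a s * y%:C))).
    apply/funext => w; rewrite -[RHS]/(_ * reC _) !reimE !(mulr0, subr0, add0r).
    by rewrite mulrA -expRD addNr expR0 mul1r.
  exact: ex_derive.
- have -> : (fun s => sin (imC (a s) * y)) =
    (fun s => expR (- (reC (a s) * y))) * (imC \o (fun s => cexp (a s * y%:C))).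
    apply/funext => w; rewrite -[RHS]/(_ * imC _) !reimE !(mulr0, subr0, add0r).
    by rewrite mulrA -expRD addNr expR0 mul1r.
  exact: ex_derive.
Qed.

(** Gronwall: with [K] the maximum of the real part of [g], the function [exp (- 2 K s) |D s|^2] is
    nonincreasing, nonnegative and starts from 0. *)
Lemma linear_ode_zero (D g : R -> R[i]) (t : R) : 0 <= t ->
  (forall s, 0 <= s -> s <= t -> isdC D s (g s * D s)) ->
  {within `[0, t], continuous (reC \o g)} -> D 0 = 0 -> D t = 0.
Proof.
move=> t0 Dd gc D0.
have [c _ gK] := EVT_max t0 gc.
set K := (reC \o g) c in gK.
pose M s := expR (- (2 * K) * s) * cabs2 (D s).
have Md (s : R) : 0 <= s -> s <= t ->
    is_derive s 1 M (expR (- (2 * K) * s) * (2 * (reC (g s) - K) * cabs2 (D s))).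
  move=> s0 st; have [dr di] := Dd s s0 st.
  have -> : M = (expR \o ( *%R (- (2 * K)))) *
     ((reC \o D) * (reC \o D) + (imC \o D) * (imC \o D)).
    by apply/funext => u; rewrite /M /cabs2 !expr2.
  have ed := isd_comp (is_derive_expR (- (2 * K) * s)) (isdMl (- (2 * K)) (isd_id s)).
  apply: isd_eq (isdM ed (isdD (isdM dr dr) (isdM di di))) _.
  by rewrite !reimE /cabs2 /=; ring.
have Mt : M t <= M 0.
  apply: (@ler0_derive1_le_cc _ M 0 t).
  - by move=> s; rewrite in_itv/= => /andP[s0 st]; exact: (isd_derivable (Md s (ltW s0) (ltW st))).
  - move=> s; rewrite in_itv/= => /andP[s0 st]; rewrite (isd_derive1 (Md s (ltW s0) (ltW st))).
    rewrite mulr_ge0_le0 ?expR_ge0// mulr_le0_ge0 ?cabs2_ge0//.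
    rewrite mulr_ge0_le0// subr_le0; apply: gK.
    by rewrite in_itv/= !ltW.
  - apply: derivable_within_continuous => s; rewrite in_itv/= => /andP[s0 st].
    exact: (isd_derivable (Md s s0 st)).
  - by rewrite in_itv/= t0 lexx.
  - by rewrite in_itv/= t0 lexx.
  - exact: t0.
apply: cabs2_eq0; apply/eqP; rewrite eq_le cabs2_ge0 andbT.
rewrite -(pmulr_rle0 _ (expR_gt0 (- (2 * K) * t))).
by move: Mt; rewrite {2}/M D0 /cabs2 !reimE expr0n/= addr0 mulr0.
Qed.

(** At [y = 1] the modulus shows that [a] is purely imaginary; if [a] were nonzero, the exponential
    would be [-1] at [y = pi / |Im a|]. *)
Lemma cexp_scale1_eq0 (a : R[i]) : (forall y, 0 <= y -> cexp (a * y%:C) = 1) -> a = 0.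
Proof.
move=> a1.
have r0 : reC a = 0.
  have /(congr1 cabs2) := a1 1 ler01.
  rewrite cabs2_cexp /cabs2 !reimE expr1n expr0n/= addr0 mulr1 mulr0 subr0.
  move=> /eqP; rewrite sqrf_eq1 => /orP[|] /eqP.
    by move/(congr1 (@ln R)); rewrite expRK ln1.
  by have := expR_gt0 (reC a) => /[swap] ->; rewrite oppr_gt0 ltr10.
apply: ceqP => //; rewrite imC0; apply: contrapT => /eqP i0.
have := a1 (pi / `|imC a|) ltac:(by rewrite divr_ge0 ?pi_ge0).
move/(congr1 reC); rewrite !reimE r0 ?(mul0r, mulr0, add0r, subr0) ?oppr0 expR0 mul1r.
have [p|n|/eqP] := ltrgtP (imC a) 0; last by rewrite (negbTE i0).
- have -> : imC a * (pi / `|imC a|) = - pi by rewrite ltr0_norm//; field.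
  by rewrite cosN cospi; lra.
- have -> : imC a * (pi / `|imC a|) = pi by rewrite gtr0_norm//; field.
  by rewrite cospi; lra.
Qed.
End DerivabilityOfPhase.

(** * Gaussian solutions of the heat-type equation *)

Section HeatUniqueness.
Context {R : realType}.
Implicit Types (A B C : R -> R[i]) (a b c z : R[i]) (s x : R).

Lemma isdC_gaussF_time A B C s (a' b' c' : R[i]) z :
  isdC A s a' -> isdC B s b' -> isdC C s c' ->
  isdC (fun s => gaussF (A s) (B s) (C s) z) s
    ((a' * z ^+ 2 + b' * z + c') * gaussF (A s) (B s) (C s) z).
Proof.
move=> Ad Bd Cd; apply: isdC_cexp.
apply: isdCD => //; apply: isdCD.
- by apply: isdC_eq (isdCM Ad (isdC_cst (z ^+ 2) s)) _; ring.
- by apply: isdC_eq (isdCM Bd (isdC_cst z s)) _; ring.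
Qed.

Lemma isdC_gaussF a b c x :
  isdC (fun x => gaussF a b c x%:C) x ((2%:R * a * x%:C + b) * gaussF a b c x%:C).
Proof.
apply: isdC_cexp.
have idd := isdC_id x.
apply: isdC_eq (isdCD (isdCD (isdCMl a (isdCM idd idd)) (isdCMl b idd)) (isdC_cst c x)) _.
ring.
Qed.

Lemma isdC_gaussF2 a b c x :
  isdC (dC (fun x => gaussF a b c x%:C)) x
    ((2%:R * a + (2%:R * a * x%:C + b) ^+ 2) * gaussF a b c x%:C).
Proof.
have -> : dC (fun x => gaussF a b c x%:C) =
    (fun x => (2%:R * a * x%:C + b) * gaussF a b c x%:C).
  by apply/funext => u; rewrite (isdC_dC (isdC_gaussF a b c u)).
have idd := isdC_id x.
apply: isdC_eq (isdCM (isdCD (isdCMl (2%:R * a) idd) (isdC_cst b x))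
                      (isdC_gaussF a b c x)) _; ring.
Qed.

Lemma cexp_cancel (u v c c' : R[i]) : cexp u = cexp v -> cexp c = cexp c' ->
  cexp (u - v - c + c') = 1.
Proof.
move=> uv cc; rewrite cexpD [cexp (_ - c)]cexpD [cexp (u - v)]cexpD !cexpN uv cc.
by field; rewrite !cexp_neq0.
Qed.

(** Multiplying the values at [r] and [- r] removes the linear term and isolates [a]; then [b]
    follows. The last coefficient is visible only through its exponential. *)
Lemma gaussF_inj a b c (a' b' c' : R[i]) :
  (forall x, gaussF a b c x%:C = gaussF a' b' c' x%:C) ->
  [/\ a = a', b = b' & cexp c = cexp c'].
Proof.
move=> E.
have E0 : cexp c = cexp c' by have := E 0; rewrite /gaussF expr0n/= !mulr0 !add0r.
have Ea : a = a'.
  apply/eqP; rewrite -subr_eq0; apply/eqP; apply: cexp_scale1_eq0 => y y0.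
  have yE : y = 2 * (Num.sqrt (y / 2)) ^+ 2 by rewrite sqr_sqrtr ?divr_ge0//; field.
  set r := Num.sqrt _ in yE; rewrite yE.
  have -> : (a - a') * (2 * r ^+ 2)%:C = (a * r%:C ^+ 2 + b * r%:C + c)
     + (a * (- r)%:C ^+ 2 + b * (- r)%:C + c)
     - ((a' * r%:C ^+ 2 + b' * r%:C + c') + (a' * (- r)%:C ^+ 2 + b' * (- r)%:C + c'))
     - (c + c) + (c' + c').
    by apply: ceqP; rewrite !reimE; ring.
  apply: cexp_cancel; last by rewrite !cexpD E0.
  by rewrite cexpD [RHS]cexpD; congr (_ * _); exact: E.
split=> //.
apply/eqP; rewrite -subr_eq0; apply/eqP; apply: cexp_scale1_eq0 => y y0.
have -> : (b - b') * y%:C = (a * y%:C ^+ 2 + b * y%:C + c)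
   - (a' * y%:C ^+ 2 + b' * y%:C + c') - c + c' by rewrite Ea; ring.
by apply: cexp_cancel => //; exact: E.
Qed.

Variables (alpha t P Q : R) (A0 B0 C0 : R -> R[i]) (delta0 : R).
Hypothesis t0 : 0 < t.
Hypothesis delta0_gt0 : 0 < delta0.
Hypothesis dA0 : forall s, - delta0 < s -> s < t + delta0 ->
  isdC A0 s (2%:R * A0 s ^+ 2 + (alpha ^+ 2 / 2)%:C).
Hypothesis dB0 : forall s, - delta0 < s -> s < t + delta0 ->
  isdC B0 s (2%:R * A0 s * B0 s).
Hypothesis dC0 : forall s, - delta0 < s -> s < t + delta0 ->
  isdC C0 s (A0 s + B0 s ^+ 2 / 2%:R).
Hypothesis init0 : forall x, gaussF (A0 0) (B0 0) (C0 0) x%:C = coh P Q x.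

(** The equations assumed on [A0], [B0], [C0] are the coefficients of [x^2], [x] and [1] in [d_s phi
    = phi'' / 2 + alpha^2 x^2 phi / 2], divided by [phi]. *)
Lemma heat_gauss_exists : heat_gauss alpha t P Q (A0 t, B0 t, C0 t).
Proof.
exists delta0, A0, B0, C0; split=> //; split=> //; split=> // s x s1 s2 phi.
have p1 := isdC_gaussF_time x%:C (dA0 s1 s2) (dB0 s1 s2) (dC0 s1 s2).
have p2 := isdC_gaussF (A0 s) (B0 s) (C0 s) x.
have p3 := isdC_gaussF2 (A0 s) (B0 s) (C0 s) x.
split; first exact: isdC_derivC p1.
split; first exact: isdC_derivC p2.
split; first exact: isdC_derivC p3.
rewrite (isdC_dC p1) (isdC_dC p3) /phi.
have -> : ((alpha ^+ 2 * x ^+ 2) / 2%:R)%:C = (alpha ^+ 2 / 2)%:C * x%:C ^+ 2 :> R[i].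
  by apply: ceqP; rewrite !reimE; ring.
by field.
Qed.

(** Another solution may differ from the reference one by multiples of [2 pi i] in its last
    coefficient, so [C] is followed only through [E s = cexp (C s)]. *)
Lemma heat_gauss_unique abc : heat_gauss alpha t P Q abc ->
  forall z, gaussF abc.1.1 abc.1.2 abc.2 z = gaussF (A0 t) (B0 t) (C0 t) z.
Proof.
move=> [delta [A [B [C [delta_gt0 [init [heat ->]]]]]]] z /=.
pose phi s x := gaussF (A s) (B s) (C s) x%:C.
have phi_neq0 s x : phi s x != 0 by exact: cexp_neq0.
have phid s x : - delta < s -> s < t + delta -> derivC (fun s => phi s x) s.
  by move=> s1 s2; have [] := heat s x s1 s2.
have derivCM f g s : derivC f s -> derivC g s -> derivC (fun s => f s * g s) s.
  by move=> /derivC_isdC fd /derivC_isdC gd; exact: isdC_derivC (isdCM fd gd).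
have derivCV f s : derivC f s -> f s != 0 -> derivC (fun s => (f s)^-1) s.
  by move=> /derivC_isdC fd f0; exact: isdC_derivC (derivC_inv f0 fd).
(* The quotient [phi q * phi (- q) / phi 0 ^ 2] equals [exp (2 q^2 A)] and is differentiable in [s];
   [y = 2 q^2] covers all nonnegative numbers. *)
have Ad s : - delta < s -> s < t + delta -> derivC A s.
  move=> s1 s2; apply: (exponent_derivable s1 s2) => y r y0 r1 r2.
  have yE : y = 2 * (Num.sqrt (y / 2)) ^+ 2 by rewrite sqr_sqrtr ?divr_ge0//; field.
  set q := Num.sqrt _ in yE.
  have -> : (fun s => cexp (A s * y%:C)) =
      (fun s => (phi s q * phi s (- q)) * (phi s 0 * phi s 0)^-1).
    apply/funext => w.
    have -> : A w * y%:C = (A w * q%:C ^+ 2 + B w * q%:C + C w) +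
       (A w * (- q)%:C ^+ 2 + B w * (- q)%:C + C w) -
       ((A w * (0 : R)%:C ^+ 2 + B w * (0 : R)%:C + C w) +
        (A w * (0 : R)%:C ^+ 2 + B w * (0 : R)%:C + C w)).
      by rewrite yE; apply: ceqP; rewrite !reimE; ring.
    rewrite cexpD cexpN; congr (_ * _^-1); exact: cexpD.
  apply: (derivCM); first by apply: (derivCM); exact: phid.
  by apply: derivCV; [apply: derivCM; exact: phid|rewrite mulf_neq0].
have Bd s : - delta < s -> s < t + delta -> derivC B s.
  move=> s1 s2; apply: (exponent_derivable s1 s2) => y r y0 r1 r2.
  have -> : (fun s => cexp (B s * y%:C)) =
      (fun s => phi s y * (phi s 0)^-1 * cexp (A s * - (y%:C ^+ 2))).
    apply/funext => w.
    have -> : B w * y%:C = (A w * y%:C ^+ 2 + B w * y%:C + C w) -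
       (A w * (0 : R)%:C ^+ 2 + B w * (0 : R)%:C + C w) + (A w * - y%:C ^+ 2).
      by apply: ceqP; rewrite !reimE; ring.
    by rewrite cexpD [cexp (_ - _)]cexpD cexpN.
  apply: (derivCM).
    by apply: (derivCM); [exact: phid|apply: derivCV => //; exact: phid].
  have /derivC_isdC Ar := Ad r r1 r2.
  exact: isdC_derivC (isdC_cexp (isdCM Ar (isdC_cst _ r))).
pose E s := phi s 0.
have EE s : E s = cexp (C s) by rewrite /E /phi /gaussF expr0n/= !mulr0 !add0r.
have coefs s : - delta < s -> s < t + delta ->
   [/\ isdC A s (2%:R * A s ^+ 2 + (alpha ^+ 2 / 2)%:C),
       isdC B s (2%:R * A s * B s) & isdC E s ((A s + B s ^+ 2 / 2%:R) * E s)].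
  move=> s1 s2.
  have /derivC_isdC := Ad s s1 s2; set a' := dC A s => Ads.
  have /derivC_isdC := Bd s s1 s2; set b' := dC B s => Bds.
  have /derivC_isdC := phid s 0 s1 s2; set e' := dC _ s => Eds.
  pose c' := e' / E s.
  have e'E : e' = c' * E s by rewrite /c' divfK// EE cexp_neq0.
  have key x : a' * x%:C ^+ 2 + b' * x%:C + c' =
      2%:R^-1 * (2%:R * A s + (2%:R * A s * x%:C + B s) ^+ 2)
      + (alpha ^+ 2 / 2)%:C * x%:C ^+ 2.
    have [_ [_ [_]]] := heat s x s1 s2.
    rewrite (isdC_dC (isdC_gaussF2 _ _ _ x)).
    have -> : dC (fun s => gaussF (A s) (B s) (C s) x%:C) s =
       (a' * x%:C ^+ 2 + b' * x%:C + c') * phi s x.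
      have -> : (fun s => gaussF (A s) (B s) (C s) x%:C) =
         (fun s => cexp (A s * x%:C ^+ 2 + B s * x%:C) * E s).
        by apply/funext => w; rewrite EE -cexpD.
      apply: isdC_dC.
      apply: isdC_eq (isdCM (isdC_cexp (isdCD (isdCM Ads (isdC_cst (x%:C ^+ 2) s))
         (isdCM Bds (isdC_cst (x%:C) s)))) Eds) _.
      rewrite -/(E s) e'E /phi /gaussF [in RHS]cexpD -EE; ring.
    rewrite -!/(phi s x) => H; apply: (mulIf (phi_neq0 s x)); rewrite H.
    have -> : ((alpha ^+ 2 * x ^+ 2) / 2%:R)%:C = (alpha ^+ 2 / 2)%:C * x%:C ^+ 2 :> R[i].
      by apply: ceqP; rewrite !reimE; ring.
    by ring.
  (* Two polynomials of degree 2 in [x] agree; their values at [0], [1] and [-1] determine the three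
     coefficients. *)
  have k0 := key 0; have k1 := key 1; have k2 := key (-1).
  have {}k0 : c' = A s + B s ^+ 2 / 2%:R.
    have -> : c' = a' * (0 : R)%:C ^+ 2 + b' * (0 : R)%:C + c' by rewrite mulr0 expr0n/=; ring.
    by rewrite k0 mulr0 expr0n/=; field.
  split.
  - apply: isdC_eq Ads _.
    have -> : a' = ((a' * (1 : R)%:C ^+ 2 + b' * (1 : R)%:C + c') +
       (a' * (-1 : R)%:C ^+ 2 + b' * (-1 : R)%:C + c')) / 2%:R - c'.
      by rewrite !rmorphN/= !rmorph1; field.
    by rewrite k1 k2 k0 !rmorphN/= !rmorph1; field.
  - apply: isdC_eq Bds _.
    have -> : b' = ((a' * (1 : R)%:C ^+ 2 + b' * (1 : R)%:C + c') -
       (a' * (-1 : R)%:C ^+ 2 + b' * (-1 : R)%:C + c')) / 2%:R.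
      by rewrite !rmorphN/= !rmorph1; field.
    by rewrite k1 k2 !rmorphN/= !rmorph1; field.
  - by apply: isdC_eq Eds _; rewrite e'E k0.
have [iA iB iE] : [/\ A 0 = A0 0, B 0 = B0 0 & cexp (C 0) = cexp (C0 0)].
  by apply: gaussF_inj => x; rewrite init init0.
have cont (f : R -> R[i]) r : r <= t -> (forall s, 0 <= s -> s <= t -> derivC f s) ->
    {within `[0, r], continuous (reC \o f)}.
  move=> rt fd; apply: derivable_within_continuous => s.
  by rewrite in_itv/= => /andP[s0 sr]; case: (fd s s0 (le_trans sr rt)).
have tin s : 0 <= s -> s <= t -> [/\ - delta < s, s < t + delta, - delta0 < s & s < t + delta0].
  by move=> s0 st; split; rewrite ?(le_lt_trans st) ?ltrDl// (lt_le_trans _ s0)// oppr_lt0.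
(* The difference of two solutions of the Riccati equation solves a linear equation with coefficient
   [2 (A + A0)]. *)
have AA s : 0 <= s -> s <= t -> A s = A0 s.
  move=> s0 st; apply/eqP; rewrite -subr_eq0; apply/eqP.
  apply: (@linear_ode_zero _ (fun s => A s - A0 s) (fun s => 2%:R * (A s + A0 s)) s s0).
  - move=> r r0 rs; have [r1 r2 r3 r4] := tin r r0 (le_trans rs st).
    have [Ar _ _] := coefs r r1 r2.
    by apply: isdC_eq (isdCB Ar (dA0 r3 r4)) _; ring.
  - apply: cont => // r r0 rs; have [r1 r2 r3 r4] := tin r r0 rs.
    have [Ar _ _] := coefs r r1 r2.
    exact: isdC_derivC (isdCMl _ (isdCD Ar (dA0 r3 r4))).
  - by rewrite iA subrr.
have BB s : 0 <= s -> s <= t -> B s = B0 s.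
  move=> s0 st; apply/eqP; rewrite -subr_eq0; apply/eqP.
  apply: (@linear_ode_zero _ (fun s => B s - B0 s) (fun s => 2%:R * A0 s) s s0).
  - move=> r r0 rs; have [r1 r2 r3 r4] := tin r r0 (le_trans rs st).
    have [_ Br _] := coefs r r1 r2.
    apply: isdC_eq (isdCB Br (dB0 r3 r4)) _; rewrite AA//; first by ring.
    exact: le_trans st.
  - apply: cont => // r r0 rs; have [r1 r2 r3 r4] := tin r r0 rs.
    exact: isdC_derivC (isdCMl _ (dA0 r3 r4)).
  - by rewrite iB subrr.
have EC : E t = cexp (C0 t).
  apply/eqP; rewrite -subr_eq0; apply/eqP.
  apply: (@linear_ode_zero _ (fun s => E s - cexp (C0 s))
     (fun s => A0 s + (B0 s * B0 s) / 2%:R) t (ltW t0)).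
  - move=> r r0 rs; have [r1 r2 r3 r4] := tin r r0 rs.
    have [_ _ Er] := coefs r r1 r2.
    apply: isdC_eq (isdCB Er (isdC_cexp (dC0 r3 r4))) _; rewrite AA// BB//.
    by rewrite expr2; ring.
  - apply: cont => // r r0 rs; have [r1 r2 r3 r4] := tin r r0 rs.
    exact: isdC_derivC (isdCD (dA0 r3 r4)
      (isdCM (isdCM (dB0 r3 r4) (dB0 r3 r4)) (isdC_cst _ r))).
  - by rewrite EE iE subrr.
by rewrite /gaussF (AA t (ltW t0) (lexx t)) (BB t (ltW t0) (lexx t)) !cexpD -EC EE.
Qed.

End HeatUniqueness.

(** * The integral of [LH] along the complexified flow *)

Section ActionIntegral.
Context {R : realType}.
Implicit Types (s p x alpha : R).

Lemma cint_seg_FTC (t : R) (F f f' : R -> R[i]) : 0 < t ->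
  (forall s, isdC F s (f s)) -> (forall s, isdC f s (f' s)) ->
  cint_seg 0 t f = F t - F 0.
Proof.
move=> t0 Fd fd; apply: ceqP; rewrite /cint_seg !reimE /=.
- rewrite /Rintegral (@continuous_FTC2 _ _ (reC \o F)) //=.
  + by apply: continuous_subspaceT => s; case: (fd s) => /isd_continuous.
  + split=> [s _||].
    * by case: (Fd s) => /isd_derivable.
    * by apply: cvg_at_right_filter; case: (Fd 0) => /isd_continuous.
    * by apply: cvg_at_left_filter; case: (Fd t) => /isd_continuous.
  + by move=> s _; case: (Fd s) => /isd_derive1.
- rewrite /Rintegral (@continuous_FTC2 _ _ (imC \o F)) //=.
  + by apply: continuous_subspaceT => s; case: (fd s) => _ /isd_continuous.
  + split=> [s _||].
    * by case: (Fd s) => _ /isd_derivable.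
    * by apply: cvg_at_right_filter; case: (Fd 0) => _ /isd_continuous.
    * by apply: cvg_at_left_filter; case: (Fd t) => _ /isd_continuous.
  + by move=> s _; case: (Fd s) => _ /isd_derive1.
Qed.

Lemma isd_cosM alpha s :
  is_derive s 1 (fun s => cos (alpha * s)) (- (alpha * sin (alpha * s))).
Proof.
by apply: isd_eq (isd_comp (is_derive_cos _) (isdMl alpha (isd_id s))) _; ring.
Qed.

Lemma isd_sinM alpha s :
  is_derive s 1 (fun s => sin (alpha * s)) (alpha * cos (alpha * s)).
Proof.
by apply: isd_eq (isd_comp (is_derive_sin _) (isdMl alpha (isd_id s))) _; ring.
Qed.

(** Together with [isdC_xflow]: Hamilton's equations of [H] in imaginary time. *)
Lemma isdC_pflow alpha s p x : alpha != 0 ->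
  isdC (fun s => pflow alpha s p x) s ('i * (alpha ^+ 2)%:C * xflow alpha s p x).
Proof.
move=> a0.
have cd := isdC_real (isd_cosM alpha s); have sd := isdC_real (isd_sinM alpha s).
have -> : (fun s => pflow alpha s p x) = (fun s => p%:C * (cos (alpha * s))%:C
    + ('i * (alpha * x)%:C) * (sin (alpha * s))%:C).
  by apply/funext => u; rewrite /pflow; apply: ceqP; rewrite !reimE; ring.
apply: isdC_eq (isdCD (isdCMl _ cd) (isdCMl _ sd)) _.
by rewrite /xflow; apply: ceqP; rewrite !reimE; field.
Qed.

Lemma isdC_xflow alpha s p x : alpha != 0 ->
  isdC (fun s => xflow alpha s p x) s ('i * pflow alpha s p x).
Proof.
move=> a0.
have cd := isdC_real (isd_cosM alpha s); have sd := isdC_real (isd_sinM alpha s).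
have -> : (fun s => xflow alpha s p x) = (fun s => x%:C * (cos (alpha * s))%:C
    + ('i * (p / alpha)%:C) * (sin (alpha * s))%:C).
  by apply/funext => u; rewrite /xflow; apply: ceqP; rewrite !reimE; ring.
apply: isdC_eq (isdCD (isdCMl _ cd) (isdCMl _ sd)) _.
by rewrite /pflow; apply: ceqP; rewrite !reimE; field.
Qed.

(** The primitive vanishing at [s = 0] of [LH] along the flow, which there equals [cos (2 alpha s)
    (p^2 + alpha^2 x^2) / 2 + i alpha sin (2 alpha s) p x]. *)
Definition action alpha s p x : R[i] :=
  (cos (alpha * s) * sin (alpha * s) / (2 * alpha) * (p ^+ 2 + alpha ^+ 2 * x ^+ 2))%:C
  + 'i * (p * x * sin (alpha * s) ^+ 2)%:C.

Lemma isdC_action alpha s p x : alpha != 0 ->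
  isdC (fun s => action alpha s p x) s (LH alpha (pflow alpha s p x) (xflow alpha s p x)).
Proof.
move=> a0.
have cd := isdC_real (isd_cosM alpha s); have sd := isdC_real (isd_sinM alpha s).
have -> : (fun s => action alpha s p x) =
    (fun s => ((p ^+ 2 + alpha ^+ 2 * x ^+ 2) / (2 * alpha))%:C
                * ((cos (alpha * s))%:C * (sin (alpha * s))%:C)
    + ('i * (p * x)%:C) * ((sin (alpha * s))%:C * (sin (alpha * s))%:C)).
  by apply/funext => u; rewrite /action; apply: ceqP; rewrite !reimE; ring.
apply: isdC_eq (isdCD (isdCMl _ (isdCM cd sd)) (isdCMl _ (isdCM sd sd))) _.
by rewrite /LH /pflow /xflow; apply: ceqP; rewrite !reimE; field.
Qed.

Lemma isdC_LH_flow alpha s p x : alpha != 0 -> exists d,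
  isdC (fun s => LH alpha (pflow alpha s p x) (xflow alpha s p x)) s d.
Proof.
move=> a0; have pd := isdC_pflow s p x a0; have xd := isdC_xflow s p x a0.
have -> : (fun s => LH alpha (pflow alpha s p x) (xflow alpha s p x)) =
  (fun s => (pflow alpha s p x * pflow alpha s p x
     + (alpha ^+ 2)%:C * (xflow alpha s p x * xflow alpha s p x)) / 2%:R).
  by apply/funext => u; rewrite -!expr2.
eexists; exact: (isdCM (isdCD (isdCM pd pd) (isdCMl _ (isdCM xd xd))) (isdC_cst _ s)).
Qed.

Lemma action0 alpha p x : action alpha 0 p x = 0.
Proof. by rewrite /action mulr0 sin0; apply: ceqP; rewrite !reimE; ring. Qed.

Lemma cint_LH alpha (t : R) p x : alpha != 0 -> 0 < t ->
  cint_seg 0 t (fun s => LH alpha (pflow alpha s p x) (xflow alpha s p x)) =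
  action alpha t p x.
Proof.
move=> a0 t0; rewrite -[RHS]subr0 -(action0 alpha p x).
pose f' s := projT1 (cid (isdC_LH_flow s p x a0)).
apply: (@cint_seg_FTC _ (fun s => action alpha s p x) _ f' t0) => s; first exact: isdC_action.
by rewrite /f'; case: cid.
Qed.

Lemma cint_LHB alpha (t : R) p x P Q : alpha != 0 -> 0 < t ->
  cint_seg 0 t (fun s => LH alpha (pflow alpha s p x) (xflow alpha s p x)
                         - LH alpha (pflow alpha s P Q) (xflow alpha s P Q)) =
  action alpha t p x - action alpha t P Q.
Proof.
move=> a0 t0.
have -> : action alpha t p x - action alpha t P Q = action alpha t p x - action alpha t P Q
   - (action alpha 0 p x - action alpha 0 P Q) by rewrite !action0 !subr0.
pose f' s := projT1 (cid (isdC_LH_flow s p x a0)) - projT1 (cid (isdC_LH_flow s P Q a0)).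
apply: (@cint_seg_FTC _ (fun s => action alpha s p x - action alpha s P Q) _ f' t0) => s.
  by apply: isdCB; exact: isdC_action.
by rewrite /f'; case: cid => ? /= ?; case: cid => ? /= ?; exact: isdCB.
Qed.

End ActionIntegral.

(** * Closed form of the transform of a coherent state *)

Section ExplicitTransform.
Context {R : realType}.
Variables (alpha t theta : R).
Hypotheses (alpha_gt0 : 0 < alpha) (t_gt0 : 0 < t) (t_lt : t < pi / (2%:R * alpha))
  (theta_gt0 : 0 < theta) (theta_lt : theta < pi / 2%:R) (tan_theta : tan theta = alpha).

Let alpha_neq0 : alpha != 0. Proof. by rewrite gt_eqF. Qed.

Lemma at_lt : alpha * t < pi / 2.
Proof.
move: t_lt; rewrite invfM mulrA ltr_pdivlMr// mulrC; exact.
Qed.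

Lemma cos_theta_gt0 : 0 < cos theta.
Proof.
apply: cos_gt0_pihalf; rewrite theta_lt andbT (lt_trans _ theta_gt0)//.
by rewrite oppr_lt0 divr_gt0// pi_gt0.
Qed.

Lemma sin_theta : sin theta = alpha * cos theta.
Proof. by rewrite -tan_theta /tan divfK// gt_eqF// cos_theta_gt0. Qed.

Lemma sin_theta_gt0 : 0 < sin theta.
Proof. by rewrite sin_theta mulr_gt0// cos_theta_gt0. Qed.

Lemma cos_at_gt0 : 0 < cos (alpha * t).
Proof.
apply: cos_gt0_pihalf; rewrite at_lt andbT (@lt_trans _ _ 0)//.
  by rewrite oppr_lt0 divr_gt0// pi_gt0.
by rewrite mulr_gt0.
Qed.

Lemma sin_at_gt0 : 0 < sin (alpha * t).
Proof.
apply: sin_gt0_pi; rewrite mulr_gt0//= (lt_trans at_lt)//.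
by rewrite ltr_pdivrMr// ltr_pMr ?pi_gt0// ltr1n.
Qed.

(** The margin around [[0, t]] that [heat_gauss] asks for. On it [theta + alpha * s] stays in []0,
    pi[]: the first term guards the left end, the second one, with [alpha * t < pi / 2], the right
    end. *)
Let delta := Num.min (theta / alpha) ((pi / 2 - theta) / alpha).

Let delta_gt0 : 0 < delta.
Proof. by rewrite lt_min !divr_gt0// subr_gt0. Qed.

Lemma sin_shift_gt0 (s : R) : - delta < s -> s < t + delta -> 0 < sin (theta + alpha * s).
Proof.
move=> s1 s2; apply: sin_gt0_pi; apply/andP; split.
- have : - (theta / alpha) < s.
    by apply: le_lt_trans s1; rewrite lerN2 ge_min lexx.
  rewrite -mulNr ltr_pdivrMr// => H; rewrite addrC -ltrBlDr sub0r mulrC; exact: H.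
- have : s < t + (pi / 2 - theta) / alpha.
    by apply: (lt_le_trans s2); rewrite lerD2l ge_min lexx orbT.
  rewrite -(ltr_pM2l alpha_gt0) mulrDr mulrCA divff// mulr1.
  have := at_lt; lra.
Qed.

(** The solution of [b' = - b^2 - alpha^2] with [b 0 = alpha * cot theta = 1], the value that
    belongs to a coherent state. *)
Definition bcoef s : R := alpha * (cos (theta + alpha * s) / sin (theta + alpha * s)).
(** Logarithm of the prefactor of (c) at time [s]: its derivative is [- b / 2], the term [A] in the
    equation for [C]. *)
Definition logpref s : R :=
  ln ((Num.sqrt pi)^-1 * Num.sqrt (sin theta)) - 2^-1 * ln (sin (theta + alpha * s)).

Lemma isd_bcoef (s : R) : - delta < s -> s < t + delta ->
  is_derive s 1 bcoef (- bcoef s ^+ 2 - alpha ^+ 2).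
Proof.
move=> s1 s2; have sg := sin_shift_gt0 s1 s2.
have s0 : sin (theta + alpha * s) != 0 by rewrite gt_eqF.
have ld : is_derive s 1 (fun s => theta + alpha * s) (0 + alpha * 1).
  exact: (isdD (isd_cst _ _) (isdMl _ (isd_id s))).
have cd := isd_comp (g := fun s => theta + alpha * s) (is_derive_cos _) ld.
have sd := isd_comp (g := fun s => theta + alpha * s) (is_derive_sin _) ld.
have vd := @is_deriveV _ (fun s => sin (theta + alpha * s)) s _ 1 s0 sd.
apply: isd_eq (isdMl alpha (isdM cd vd)) _.
rewrite /bcoef /GRing.scale/=.
by field.
Qed.

Lemma isd_logpref (s : R) : - delta < s -> s < t + delta ->
  is_derive s 1 logpref (- (bcoef s / 2)).
Proof.
move=> s1 s2; have sg := sin_shift_gt0 s1 s2.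
have ld : is_derive s 1 (fun s => theta + alpha * s) (0 + alpha * 1).
  exact: (isdD (isd_cst _ _) (isdMl _ (isd_id s))).
have sd := isd_comp (g := fun s => theta + alpha * s) (is_derive_sin _) ld.
have lnd := isd_comp (g := fun s => sin (theta + alpha * s)) (is_derive1_ln sg) sd.
apply: isd_eq (isdB (isd_cst _ _) (isdMl 2^-1 lnd)) _.
by rewrite /bcoef; field; rewrite gt_eqF.
Qed.

Lemma expR_half_ln (y : R) : 0 < y -> expR (2^-1 * ln y) = Num.sqrt y.
Proof.
by move=> y0; rewrite -powR12_sqrt ?ltW// /powR gt_eqF.
Qed.

Lemma expR_logpref (s : R) : - delta < s -> s < t + delta ->
  expR (logpref s) = prefactor alpha s theta.
Proof.
move=> s1 s2; have sg := sin_shift_gt0 s1 s2; have st := sin_theta_gt0.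
rewrite /logpref /prefactor expRD expRN expR_half_ln// lnK; last first.
  by rewrite posrE mulr_gt0// ?invr_gt0 sqrtr_gt0// pi_gt0.
rewrite ger0_norm ?divr_ge0 ?ltW// -mulrA; congr (_ * _).
by rewrite sqrtrM ?ltW// sqrtrV// ltW.
Qed.

Variables P Q : R.

(** The three coefficients come from expanding [logpref + action (P, Q) - i P_s (z - Q_s) - (b / 2)
    (z - Q_s)^2] in powers of [z]; this is the exponent of the first formula of (c), without the
    action at [(x, p)]. *)
Let Acoef s : R[i] := (- (bcoef s / 2))%:C.
Let Bcoef s : R[i] := - ('i * pflow alpha s P Q) + (bcoef s)%:C * xflow alpha s P Q.
Let Ccoef s : R[i] := (logpref s)%:C + action alpha s P Q
  + 'i * (pflow alpha s P Q * xflow alpha s P Q)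
  - (bcoef s / 2)%:C * (xflow alpha s P Q * xflow alpha s P Q).

Let ii : 'i * 'i = -1 :> R[i]. Proof. by apply: ceqP; rewrite !reimE; ring. Qed.

Let dA (s : R) : - delta < s -> s < t + delta ->
  isdC Acoef s (2%:R * Acoef s ^+ 2 + (alpha ^+ 2 / 2)%:C).
Proof.
move=> s1 s2; have bd := isd_bcoef s1 s2.
rewrite /Acoef; have -> : (fun s => (- (bcoef s / 2))%:C) =
   (fun s => (- 2^-1 * bcoef s)%:C) :> (R -> R[i]).
  by apply/funext => u; congr (_%:C); ring.
apply: isdC_eq (isdC_real (isdMl (- 2^-1) bd)) _.
by apply: ceqP; rewrite !reimE; field.
Qed.

Let dB (s : R) : - delta < s -> s < t + delta -> isdC Bcoef s (2%:R * Acoef s * Bcoef s).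
Proof.
move=> s1 s2; have bd := isdC_real (isd_bcoef s1 s2).
have pd := isdC_pflow s P Q alpha_neq0; have xd := isdC_xflow s P Q alpha_neq0.
apply: isdC_eq (isdCD (isdCN (isdCMl 'i pd)) (isdCM bd xd)) _.
rewrite /Acoef /Bcoef.
move: (pflow _ _ _ _) (xflow _ _ _ _) (bcoef s) => p x b.
by apply: ceqP; rewrite !reimE; field.
Qed.

Let dC (s : R) : - delta < s -> s < t + delta ->
  isdC Ccoef s (Acoef s + Bcoef s ^+ 2 / 2%:R).
Proof.
move=> s1 s2; have bd := isdC_real (isdMl 2^-1 (isd_bcoef s1 s2)).
have ld := isdC_real (isd_logpref s1 s2).
have ad := isdC_action s P Q alpha_neq0.
have pd := isdC_pflow s P Q alpha_neq0; have xd := isdC_xflow s P Q alpha_neq0.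
have -> : Ccoef = (fun s => (logpref s)%:C + action alpha s P Q
  + 'i * (pflow alpha s P Q * xflow alpha s P Q)
  - (2^-1 * bcoef s)%:C * (xflow alpha s P Q * xflow alpha s P Q)).
  by apply/funext => u; rewrite /Ccoef [bcoef u / 2]mulrC.
apply: isdC_eq (isdCB (isdCD (isdCD ld ad) (isdCMl 'i (isdCM pd xd)))
   (isdCM bd (isdCM xd xd))) _.
rewrite /Acoef /Bcoef /LH.
move: (pflow _ _ _ _) (xflow _ _ _ _) (bcoef s) => p x b.
by apply: ceqP; rewrite !reimE; field.
Qed.

Let zero_in : - delta < 0 /\ 0 < t + delta.
Proof. by rewrite oppr_lt0 addr_gt0. Qed.

Let t_in : - delta < t /\ t < t + delta.
Proof. by rewrite ltrDl (lt_trans _ t_gt0)// oppr_lt0. Qed.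

Let init x : gaussF (Acoef 0) (Bcoef 0) (Ccoef 0) x%:C = coh P Q x.
Proof.
have [z1 z2] := zero_in.
have b0 : bcoef 0 = 1.
  rewrite /bcoef mulr0 addr0 sin_theta; field.
  by rewrite alpha_neq0 gt_eqF// cos_theta_gt0.
have st := sin_theta_gt0.
have pr0 : prefactor alpha 0 theta = (Num.sqrt pi)^-1.
  by rewrite /prefactor mulr0 addr0 divff ?gt_eqF// normr1 sqrtr1 mulr1.
rewrite /coh -pr0 -(expR_logpref z1 z2) -cexpr -cexpD /gaussF; congr cexp.
rewrite /Acoef /Bcoef /Ccoef action0 b0 /pflow /xflow mulr0 sin0 cos0.
by apply: ceqP; rewrite !reimE; field.
Qed.

Lemma KSH_heat_exists : exists abc, heat_gauss alpha t P Q abc.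
Proof.
eexists; exact: (heat_gauss_exists delta_gt0 dA dB dC init).
Qed.

(** The triple picked by [heat_coef] is unknown. Existence of some solution makes it a solution, and
    uniqueness gives it the Gaussian of the explicit one. *)
Let KSH_cohE x p : KSH_coh alpha t P Q x p =
  cexp (- action alpha t p x) * gaussF (Acoef t) (Bcoef t) (Ccoef t) (wtau alpha t x p).
Proof.
rewrite /KSH_coh /rhoflow cint_LH//; congr (_ * _).
apply: (heat_gauss_unique t_gt0 delta_gt0 dA dB dC init).
exact: (ClassicalEpsilon.epsilon_spec _ _ KSH_heat_exists).
Qed.

Lemma KSH_coh_formula1 x p : KSH_coh alpha t P Q x p = formula1 alpha t theta P Q x p.
Proof.
have [t1 t2] := t_in.
rewrite KSH_cohE /formula1 cint_LHB// -(expR_logpref t1 t2) -cexpr /gaussF -!cexpD.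
congr cexp; rewrite -/(bcoef t) /Acoef /Bcoef /Ccoef.
by apply: ceqP; rewrite !reimE; field.
Qed.

Lemma formula1E2 x p : formula1 alpha t theta P Q x p = formula2 alpha t theta P Q x p.
Proof.
rewrite /formula1 /formula2 cint_LHB// -[LHS]mulrA -[RHS]mulrA -!cexpD; congr (_ * cexp _).
have cth := cos_theta_gt0; have sth := sin_theta.
have cc := cos_at_gt0; have ss := sin_at_gt0.
have cs := cos2Dsin2 (alpha * t).
rewrite [alpha * t + theta]addrC sinD cosD sth /action /pflow /xflow /wtau /wcx /wcp.
set c := cos (alpha * t) in cc cs *; set s := sin (alpha * t) in ss cs *.
set ct := cos theta in cth sth *.
have ct0 : ct != 0 by rewrite gt_eqF.
have S0 : alpha * ct * c + ct * s != 0 by rewrite gt_eqF// addr_gt0// !mulr_gt0.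
(* Multiplying the target by [c^2 + s^2] turns the claim into an identity of rational functions in
   [c] and [s]. *)
have one : 1 = (c ^+ 2 + s ^+ 2)%:C :> R[i] by rewrite cs.
rewrite -[RHS]mul1r one.
by apply: ceqP; rewrite !reimE; field; rewrite S0 alpha_neq0.
Qed.

End ExplicitTransform.

(** * Integration on the line and on the plane *)

Section RealIntegrals.
Context {R : realType}.

(** The sigma-algebra of the product is generated by rectangles, so an open set is written as a
    countable union of squares with rational centre and half side. *)
Lemma continuous2_measurable (f : R * R -> R) : continuous f ->
  measurable_fun [set: measurableTypeR R * measurableTypeR R] f.
Proof.
move=> cf; apply: (measurability _ (RGenOInfty.measurableE R)).
move=> _ [_ [a ->] <-]; rewrite setTI.
set U := f @^-1` _.
have oU : open U by move/continuousP : cf; apply; exact: interval_open.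
have -> : U = \bigcup_(q : rat * rat * rat)
   (if `[< (`](ratr q.1.1 - ratr q.2), (ratr q.1.1 + ratr q.2)[ `*`
      `](ratr q.1.2 - ratr q.2), (ratr q.1.2 + ratr q.2)[ : set (R * R)) `<=` U >]
    then (`](ratr q.1.1 - ratr q.2), (ratr q.1.1 + ratr q.2)[ `*`
      `](ratr q.1.2 - ratr q.2), (ratr q.1.2 + ratr q.2)[ : set (R * R)) else set0).
  apply/seteqP; split=> [[x y] Uxy|z [q _]]; last first.
    by case: ifPn => // /asboolP; apply.
  have /nbhs_ballP[e /= e0 eU] : nbhs (x, y) U by exact: open_nbhs_nbhs.
  (* A square of half side [r < e / 2] whose centre is within [r] of the point stays in the ball of
     radius [e]. *)
  have e4 : e / 4 < e / 2 by lra.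
  have [r /=] := rat_in_itvoo e4; rewrite in_itv/= => /andP[r1 r2].
  have r0 : 0 < ratr r :> R by lra.
  have [q1 /=] := rat_in_itvoo (ltac:(lra) : x - ratr r < x + ratr r).
  rewrite in_itv/= => /andP[q11 q12].
  have [q2 /=] := rat_in_itvoo (ltac:(lra) : y - ratr r < y + ratr r).
  rewrite in_itv/= => /andP[q21 q22].
  exists (q1, q2, r) => //=; case: ifPn => [_|/asboolP[]].
    by split; rewrite /= in_itv/=; apply/andP; split; lra.
  move=> [u v] [] /=; rewrite !in_itv/= => /andP[u1 u2] /andP[v1 v2].
  apply: eU; split; rewrite /ball/= ltr_norml; apply/andP; split; lra.
apply: countable_bigcupT_measurable; first exact: countableP.
by move=> q; case: ifPn => // _; apply: measurableX; exact: measurable_itv.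
Qed.

Section General.
Context d (T : measurableType d) (mu : {measure set T -> \bar R}).

Lemma integrable_dominated (f g : T -> R) : measurable_fun setT f ->
  mu.-integrable setT (EFin \o g) -> (forall x, `|f x| <= g x) ->
  mu.-integrable setT (EFin \o f).
Proof.
move=> mf ig fg; apply: (le_integrable measurableT _ _ ig).
  exact/measurable_EFinP.
by move=> x _ /=; rewrite lee_fin (le_trans (fg x))// ler_norm.
Qed.

Lemma integrable_measurable (f : T -> R) :
  mu.-integrable setT (EFin \o f) -> measurable_fun setT f.
Proof. by case/integrableP => /measurable_EFinP. Qed.

Lemma EFin_Rintegral (f : T -> R) : mu.-integrable setT (EFin \o f) ->
  (\int[mu]_x (f x)%:E = (\int[mu]_x f x)%:E)%E.
Proof. by move=> fi; rewrite /Rintegral fineK//; exact: integrable_fin_num. Qed.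

Lemma ge0_integrable (f : T -> R) : measurable_fun setT f -> (forall x, 0 <= f x) ->
  (\int[mu]_x (f x)%:E < +oo)%E -> mu.-integrable setT (EFin \o f).
Proof.
move=> mf f0 fi; apply/integrableP; split; first exact/measurable_EFinP.
by under eq_integral do rewrite /= ger0_norm//.
Qed.

Lemma Rintegral_dct (f_ : nat -> T -> R) (f g : T -> R) :
  (forall n, measurable_fun setT (f_ n)) ->
  (forall x, f_ ^~ x @ \oo --> f x) ->
  mu.-integrable setT (EFin \o g) ->
  (forall n x, `|f_ n x| <= g x) ->
  mu.-integrable setT (EFin \o f) /\
  (fun n => \int[mu]_x f_ n x) @ \oo --> \int[mu]_x f x.
Proof.
move=> mf ff ig fg.
have mlim : measurable_fun setT f by exact: (measurable_fun_cvg mf) => x _; exact: ff.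
have fgl x : `|f x| <= g x.
  have : (fun n => `|f_ n x|) @ \oo --> `|f x| by apply: cvg_norm; exact: ff.
  move=> H; rewrite -(cvg_lim _ H)//; apply: limr_le; last exact: nearW.
  by apply/cvg_ex; exists `|f x|.
have fi := integrable_dominated mlim ig fgl.
split=> //.
have ifn n : mu.-integrable setT (EFin \o f_ n).
  exact: (integrable_dominated (mf n) ig (fg n)).
have := @dominated_convergence _ T R mu setT measurableT
   (fun n => EFin \o f_ n) (EFin \o f) (EFin \o g).
case.
- by move=> n; exact/measurable_EFinP.
- exact/measurable_EFinP.
- by apply: aeW => x _; apply: cvg_EFin; [exact: nearW|exact: ff].
- exact: ig.
- by apply: aeW => x n _; rewrite /= lee_fin.
move=> _ _ H.
suff : (fun n => (\int[mu]_x f_ n x)%:E) @ \oo --> (\int[mu]_x f x)%:E.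
  by move/fine_cvg.
rewrite -EFin_Rintegral//; move: H; apply: cvg_trans; apply: near_eq_cvg.
by apply: nearW => n; rewrite -EFin_Rintegral.
Qed.

End General.

(** On [[- n, n]] the integral is [F n - F (- n)], which tends to 0; domination by [|f|] lets the
    truncation go. *)
Lemma Rintegral_FTC_line (F f : R -> R) :
  (forall x : R, is_derive x 1 F (f x)) -> continuous f ->
  (@leb R).-integrable setT (EFin \o f) ->
  (fun n : nat => F n%:R) @ \oo --> (0 : R) ->
  (fun n : nat => F (- n%:R)) @ \oo --> (0 : R) ->
  \int[leb]_x f x = 0.
Proof.
move=> Fd fc fi Fp Fm.
pose f_ (n : nat) x := f x * \1_(`[- n%:R, n%:R] : set R) x.
have [] := @Rintegral_dct _ _ (@leb R) f_ f (fun x => `|f x|).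
- move=> n; apply: measurable_funM; first exact: integrable_measurable fi.
  exact: measurable_indic.
- move=> x; apply: cvg_near_cst; near=> n.
  rewrite /f_ indicE mem_set ?mulr1//= in_itv/= -ler_norml.
  by near: n; exact: nbhs_infty_ger.
- exact: integrable_norm.
- move=> n x; rewrite /f_ normrM indicE; case: (_ \in _); rewrite ?normr1 ?mulr1//.
  by rewrite normr0 mulr0.
move=> _ H.
apply: (cvg_unique _ H) => //.
have E : \forall n \near \oo, F n%:R - F (- n%:R) = \int[leb]_x f_ n x.
  near=> n.
  have n0 : (0 : R) < n%:R by rewrite ltr0n; near: n; exists 1%N.
  have -> : \int[leb]_x f_ n x = \int[leb]_(x in `[- n%:R, n%:R]) f x.
    rewrite [RHS]Rintegral_mkcond; apply: eq_Rintegral => x _.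
    by rewrite /f_ indicE patchE; case: ifPn => _; rewrite ?mulr1 ?mulr0.
  rewrite /Rintegral (@continuous_FTC2 _ _ F)//.
  - by rewrite (lt_trans _ n0)// oppr_lt0.
  - exact: continuous_subspaceT.
  - split=> [x _||]; first exact: (isd_derivable (Fd x)).
      by apply: cvg_at_right_filter; exact: (isd_continuous (Fd _)).
    by apply: cvg_at_left_filter; exact: (isd_continuous (Fd _)).
  - by move=> x _; exact: (isd_derive1 (Fd x)).
rewrite -(subr0 (0 : R)); apply: cvg_trans (cvgB Fp Fm).
exact: near_eq_cvg.
Unshelve. all: by end_near. Qed.

Lemma Rintegral_FTC_compact (F f : R -> R) (M : R) :
  (forall x : R, is_derive x 1 F (f x)) -> continuous f ->
  (@leb R).-integrable setT (EFin \o f) ->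
  (forall x, M < `|x| -> F x = 0) -> \int[leb]_x f x = 0.
Proof.
move=> Fd fc fi F0; apply: (Rintegral_FTC_line Fd fc fi);
  apply: cvg_near_cst; near=> n; apply: F0.
  by rewrite normr_nat; near: n; exact: nbhs_infty_gtr.
by rewrite normrN normr_nat; near: n; exact: nbhs_infty_gtr.
Unshelve. all: by end_near. Qed.

Lemma Rintegral_fubini12 (f : R * R -> R) :
  leb2.-integrable setT (EFin \o f) ->
  (forall x, (@leb R).-integrable setT (EFin \o (fun y => f (x, y)))) ->
  \int[leb2]_z f z = \int[leb]_x \int[leb]_y f (x, y).
Proof.
move=> fi fx; rewrite /Rintegral; congr fine.
rewrite -(integral12_prod_meas1 fi); apply: eq_integral => x _.
by rewrite /fubini_F /= EFin_Rintegral//; exact: fx.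
Qed.

Lemma Rintegral_fubini21 (f : R * R -> R) :
  leb2.-integrable setT (EFin \o f) ->
  (forall y, (@leb R).-integrable setT (EFin \o (fun x => f (x, y)))) ->
  \int[leb2]_z f z = \int[leb]_y \int[leb]_x f (x, y).
Proof.
move=> fi fx; rewrite /Rintegral; congr fine.
rewrite -(integral21_prod_meas1 fi); apply: eq_integral => x _.
by rewrite /fubini_G /= EFin_Rintegral//; exact: fx.
Qed.

Lemma compact_support_integrable (f : R -> R) (M : R) : continuous f ->
  (forall x, M < `|x| -> f x = 0) -> (@leb R).-integrable setT (EFin \o f).
Proof.
move=> fc f0.
have : (@leb R).-integrable `[- M, M] (EFin \o f).
  apply: continuous_compact_integrable; first exact: segment_compact.
  exact: continuous_subspaceT.
rewrite integrable_mkcond//; apply: eq_integrable => // x _.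
rewrite /= patchE; case: ifPn => // /negP; rewrite inE/= in_itv/= -ler_norml => /negP.
by rewrite -ltNge => /f0 ->.
Qed.

Lemma leb2_box (M : R) : 0 <= M ->
  leb2 ([set z : R * R | `|z.1| <= M /\ `|z.2| <= M] : set (measurableTypeR R * measurableTypeR R))
  = ((2 * M) ^+ 2)%:E.
Proof.
move=> M0.
have -> : [set z : R * R | `|z.1| <= M /\ `|z.2| <= M] = `[- M, M] `*` `[- M, M].
  by apply/seteqP; split=> z /=; rewrite !in_itv/= -!ler_norml.
rewrite /leb2 product_measure1E//= lebesgue_measure_itv/= lte_fin.
case: ltP => [_|]; first by rewrite -EFinB -EFinM; congr (_%:E); ring.
rewrite lerNr; move=> M1; have -> : M = 0 by apply/eqP; rewrite eq_le M0 andbT; lra.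
by rewrite mule0 mulr0 expr0n.
Qed.

Lemma measurable_box (M : R) :
  measurable ([set z : R * R | `|z.1| <= M /\ `|z.2| <= M] : set (measurableTypeR R * measurableTypeR R)).
Proof.
have -> : [set z : R * R | `|z.1| <= M /\ `|z.2| <= M] = `[- M, M] `*` `[- M, M].
  by apply/seteqP; split=> z /=; rewrite !in_itv/= -!ler_norml.
by apply: measurableX; exact: measurable_itv.
Qed.

Lemma integrable_box (K M : R) : 0 <= M ->
  (@leb2 R).-integrable setT
    (EFin \o (fun z : R * R => K * \1_[set z : R * R | `|z.1| <= M /\ `|z.2| <= M] z)).
Proof.
move=> M0.
have mB := measurable_box M.
apply/integrableP; split.
  by apply/measurable_EFinP; apply: measurable_funM => //; exact: measurable_indic.
under eq_integral => z _ do rewrite /= normrM [`|\1_ _ _|]ger0_norm// EFinM.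
rewrite ge0_integralZl_EFin//; last exact/measurable_EFinP/measurable_indic.
rewrite integral_indic// setIT; have := leb2_box M0; rewrite /leb2 /leb /= => ->.
by rewrite -EFinM ltry.
Qed.

Lemma continuous_bounded_box (f : R * R -> R) (M : R) : continuous f ->
  exists2 K, 0 <= K & forall x p, `|x| <= M -> `|p| <= M -> `|f (x, p)| <= K.
Proof.
move=> fc.
have cB : compact (`[- M, M] `*` `[- M, M] : set (R * R)).
  by apply: compact_setX; exact: segment_compact.
have /compact_bounded[K [_ KP]] : compact (f @` (`[- M, M] `*` `[- M, M])).
  by apply: continuous_compact => //; exact: continuous_subspaceT.
exists (`|K| + 1); first by rewrite addr_ge0.
move=> x p xM pM; apply: KP; first by rewrite (le_lt_trans (ler_norm K))// ltrDl.
by exists (x, p) => //; split; rewrite /= in_itv/= -ler_norml.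
Qed.

Lemma compact_support_bounded (f : R * R -> R) (M : R) : continuous f ->
  (forall z, (`|z.1| <= M /\ `|z.2| <= M) \/ f z = 0) -> exists2 K, 0 <= K & forall z, `|f z| <= K.
Proof.
move=> fc f0; have [K K0 KP] := continuous_bounded_box M fc.
exists K => // z; have [[z1 z2]|->] := f0 z; last by rewrite normr0.
by rewrite [z]surjective_pairing; exact: KP.
Qed.

Lemma compact_support_integrable2 (f : R * R -> R) (M : R) : 0 <= M -> continuous f ->
  (forall z, (`|z.1| <= M /\ `|z.2| <= M) \/ f z = 0) ->
  (@leb2 R).-integrable setT (EFin \o f).
Proof.
move=> M0 fc f0; have [K K0 fK] := compact_support_bounded fc f0.
apply: (integrable_dominated _ (integrable_box K M0)).
  exact: continuous2_measurable.
move=> z; have [zB|->] := f0 z; last by rewrite normr0 mulr_ge0.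
by rewrite indicE mem_set// mulr1.
Qed.

End RealIntegrals.

(** * Continuity rules for real functions *)

Section ContinuityR2.
Context {R : realType} {T : topologicalType}.
Implicit Types f g : T -> R.

Lemma contD f g : continuous f -> continuous g -> continuous (fun z => f z + g z).
Proof. by move=> cf cg z; exact: cvgD (cf z) (cg z). Qed.
Lemma contN f : continuous f -> continuous (fun z => - f z).
Proof. by move=> cf z; exact: cvgN (cf z). Qed.
Lemma contB f g : continuous f -> continuous g -> continuous (fun z => f z - g z).
Proof. by move=> cf cg z; exact: cvgB (cf z) (cg z). Qed.
Lemma contM f g : continuous f -> continuous g -> continuous (fun z => f z * g z).
Proof. by move=> cf cg z; exact: cvgM (cf z) (cg z). Qed.
Lemma contC (k : R) : continuous (fun _ : T => k).
Proof. by move=> z; exact: cvg_cst. Qed.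
Lemma contX2 f : continuous f -> continuous (fun z => f z ^+ 2).
Proof. by move=> cf; under eq_fun do rewrite expr2; exact: contM. Qed.
Lemma cont_comp (h : R -> R) f : continuous h -> continuous f ->
  continuous (fun z => h (f z)).
Proof. by move=> ch cf z; apply: continuous_comp; [exact: cf|exact: ch]. Qed.
Lemma cont_pair (h : R * R -> R) f g : continuous h -> continuous f -> continuous g ->
  continuous (fun z => h (f z, g z)).
Proof.
move=> ch cf cg z; apply: (@continuous_comp _ _ _ (fun z => (f z, g z)) h); last exact: ch.
exact: (cvg_pair (cf z) (cg z)).
Qed.

End ContinuityR2.

(** * Mean value property from the Cauchy-Riemann equations *)

Section MeanValue.
Context {R : realType}.

Lemma Rintegral0 d (T : measurableType d) (mu : {measure set T -> \bar R}) :
  \int[mu]_x (0 : R) = 0.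
Proof. by rewrite /Rintegral integral0. Qed.

Lemma cont_fst : continuous (fun z : R * R => z.1).
Proof. by move=> z; exact: cvg_fst. Qed.
Lemma cont_snd : continuous (fun z : R * R => z.2).
Proof. by move=> z; exact: cvg_snd. Qed.

(** Phrased with distances to [a], so that it serves increments of either sign. *)
Lemma MVT_segment_abs (f f' : R -> R) (a b : R) :
  (forall x : R, is_derive x 1 f (f' x)) ->
  exists2 c, `|c - a| <= `|b - a| & f b - f a = f' c * (b - a).
Proof.
move=> fd.
have fc : continuous f by move=> x; exact: (isd_continuous (fd x)).
have [ab|ba] := leP a b.
- have [c] := @MVT_segment _ f f' a b ab (fun x _ => fd x) (continuous_subspaceT fc).
  by rewrite in_itv/= => /andP[ac cb] H; exists c => //; rewrite !ger0_norm; lra.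
- have [c] := @MVT_segment _ f f' b a (ltW ba) (fun x _ => fd x) (continuous_subspaceT fc).
  rewrite in_itv/= => /andP[ac cb] H; exists c; last by rewrite -opprB H; ring.
  by rewrite !ler0_norm; lra.
Qed.

(** The increment splits into a horizontal and a vertical one, each given by the mean value theorem;
    continuity of the partial derivatives then replaces the intermediate points by [(X, Y)]. *)
Lemma chain_rule_line (u ux up : R * R -> R) (x0 p0 a b l : R) :
  (forall x p : R, is_derive x 1 (fun x => u (x, p)) (ux (x, p))) ->
  (forall x p : R, is_derive p 1 (fun p => u (x, p)) (up (x, p))) ->
  continuous ux -> continuous up ->
  is_derive l 1 (fun l => u (x0 + l * a, p0 + l * b))
    (a * ux (x0 + l * a, p0 + l * b) + b * up (x0 + l * a, p0 + l * b)).
Proof.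
move=> dx dp cx cp.
set X := x0 + l * a; set Y := p0 + l * b.
set L := a * ux (X, Y) + b * up (X, Y).
have : (fun h => h^-1 *: (u (x0 + (h *: 1 + l) * a, p0 + (h *: 1 + l) * b) - u (X, Y)))
     @ 0^' --> L.
  apply/cvgrPdist_lt => e e0.
  pose K := `|a| + `|b| + 1.
  (* Since [(|a| + |b|) / K < 1], errors below [e / K] in both partial derivatives add up to less
     than [e]; the summand 1 keeps [K] positive. *)
  have K0 : 0 < K by rewrite ltr_wpDl// addr_ge0.
  have eK : 0 < e / K by rewrite divr_gt0.
  have /nbhs_ballP[r1 /= r10 B1] : nbhs (X, Y) [set z | `|ux (X, Y) - ux z| < e / K].
    by move/cvgrPdist_lt : (cx (X, Y)); apply.
  have /nbhs_ballP[r2 /= r20 B2] : nbhs (X, Y) [set z | `|up (X, Y) - up z| < e / K].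
    by move/cvgrPdist_lt : (cp (X, Y)); apply.
  near=> h.
  have h0 : h != 0 by near: h; exact: nbhs_dnbhs_neq.
  have hK1 : `|h| * K < Num.min r1 r2.
    rewrite -ltr_pdivlMr//; near: h; apply: dnbhs0_lt.
    by rewrite divr_gt0// lt_min r10.
  have haK : `|h * a| <= `|h| * K.
    by rewrite normrM ler_wpM2l// /K -addrA lerDl addr_ge0.
  have hbK : `|h * b| <= `|h| * K.
    by rewrite normrM ler_wpM2l// /K addrAC lerDr addr_ge0.
  have -> : x0 + (h *: 1 + l) * a = X + h * a by rewrite /X scaler1; ring.
  have -> : p0 + (h *: 1 + l) * b = Y + h * b by rewrite /Y scaler1; ring.
  have [xi xi1] := MVT_segment_abs X (X + h * a) (fun x => dx x (Y + h * b)).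
  have [et et1] := MVT_segment_abs Y (Y + h * b) (fun p => dp X p).
  rewrite [_ + h * b - _]addrC addKr => E2; rewrite [_ + h * a - _]addrC addKr => E1.
  have -> : u (X + h * a, Y + h * b) - u (X, Y) =
     ux (xi, Y + h * b) * (h * a) + up (X, et) * (h * b) by rewrite -E1 -E2; ring.
  have -> : L - h^-1 *: (ux (xi, Y + h * b) * (h * a) + up (X, et) * (h * b)) =
     a * (ux (X, Y) - ux (xi, Y + h * b)) + b * (up (X, Y) - up (X, et)).
    by rewrite /L /GRing.scale/=; field.
  move: xi1 et1; rewrite [_ + h * b - _]addrC addKr [_ + h * a - _]addrC addKr => xi1 et1.
  have [m1 m2] : `|h| * K < r1 /\ `|h| * K < r2.
    by move: hK1; rewrite lt_min => /andP[].
  have u1 : `|ux (X, Y) - ux (xi, Y + h * b)| < e / K.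
    apply: B1; split; rewrite /ball/=.
      by rewrite distrC (le_lt_trans xi1)// (le_lt_trans haK).
    by rewrite opprD addNKr normrN (le_lt_trans hbK).
  have u2 : `|up (X, Y) - up (X, et)| < e / K.
    apply: B2; split; rewrite /ball/=; first by rewrite subrr normr0.
    by rewrite distrC (le_lt_trans et1)// (le_lt_trans hbK).
  apply: (le_lt_trans (ler_normD _ _)); rewrite !normrM.
  apply: (@le_lt_trans _ _ ((`|a| + `|b|) * (e / K))).
    by rewrite mulrDl lerD// ler_wpM2l// ltW.
  by rewrite mulrCA gtr_pMr// ltr_pdivrMr// mul1r ltrDl.
move=> H; apply: DeriveDef; first by apply/cvg_ex; exists L.
by apply: (cvg_lim _ H).
Unshelve. all: by end_near. Qed.

Section Profile.
Variables (c d x0 p0 : R) (h h' : R -> R) (N : R).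
Hypotheses (c0 : 0 < c) (d0 : 0 < d) (N0 : 0 <= N).
Hypotheses (dh : forall s : R, is_derive s 1 h (h' s)) (ch' : continuous h').
Hypotheses (hN : forall s, N < s -> h s = 0).

(** The squared distance [|w - w1|^2] in the coordinate [w = c x + i d p]. *)
Definition qform (x1 p1 : R) (z : R * R) : R :=
  c ^+ 2 * (z.1 - x1) ^+ 2 + d ^+ 2 * (z.2 - p1) ^+ 2.

Lemma cont_qform x1 p1 : continuous (qform x1 p1).
Proof.
apply: contD; apply: contM; try exact: contC; apply: contX2; apply: contB;
  try exact: contC; [exact: cont_fst|exact: cont_snd].
Qed.

Let q := qform x0 p0.
Let ch : continuous h. Proof. by move=> s; exact: (isd_continuous (dh s)). Qed.
Let chq : continuous (fun z => h (q z)).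
Proof. by apply: cont_comp => //; exact: cont_qform. Qed.
Let ch'q : continuous (fun z => h' (q z)).
Proof. by apply: cont_comp => //; exact: cont_qform. Qed.

Let M : R := `|x0| + `|p0| + (1 + N / c ^+ 2) + (1 + N / d ^+ 2).
Let M0 : 0 <= M.
Proof. by rewrite !addr_ge0// divr_ge0// sqr_ge0. Qed.

(** From [w <= 1 + w^2], in place of a square root. *)
Let coord_bound (k y y0 : R) : 0 < k -> k ^+ 2 * (y - y0) ^+ 2 <= N ->
  `|y - y0| <= 1 + N / k ^+ 2.
Proof.
move=> k0; rewrite mulrC -ler_pdivlMr ?exprn_gt0// -[(y - y0) ^+ 2]real_normK ?num_real//.
set w := `|_|; have w0 : 0 <= w by rewrite normr_ge0.
have := sqr_ge0 (w - 1); nra.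
Qed.

Let q_le z : q z <= N -> `|z.1 - x0| <= M /\ `|z.2 - p0| <= M.
Proof.
move=> qN.
have N1 : c ^+ 2 * (z.1 - x0) ^+ 2 <= N.
  by apply: le_trans qN; rewrite lerDl mulr_ge0// sqr_ge0.
have N2 : d ^+ 2 * (z.2 - p0) ^+ 2 <= N.
  by apply: le_trans qN; rewrite lerDr mulr_ge0// sqr_ge0.
have e1 : 0 <= 1 + N / c ^+ 2 by rewrite addr_ge0// divr_ge0// sqr_ge0.
have e2 : 0 <= 1 + N / d ^+ 2 by rewrite addr_ge0// divr_ge0// sqr_ge0.
have := coord_bound c0 N1; have := coord_bound d0 N2.
have := normr_ge0 x0; have := normr_ge0 p0; rewrite /M; split; lra.
Qed.

Let q_box z : (`|z.1| <= M + M /\ `|z.2| <= M + M) \/ N < q z.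
Proof.
have [/q_le[a b]|] := leP (q z) N; last by right.
left; have x0M : `|x0| <= M /\ `|p0| <= M.
  have e1 : 0 <= 1 + N / c ^+ 2 by rewrite addr_ge0// divr_ge0// sqr_ge0.
  have e2 : 0 <= 1 + N / d ^+ 2 by rewrite addr_ge0// divr_ge0// sqr_ge0.
  by have := normr_ge0 x0; have := normr_ge0 p0; rewrite /M; split; lra.
case: x0M => xM pM; split.
  by rewrite -[z.1](subrK x0) (le_trans (ler_normD _ _))// lerD.
by rewrite -[z.2](subrK p0) (le_trans (ler_normD _ _))// lerD.
Qed.

Let MM0 : 0 <= M + M. Proof. by rewrite addr_ge0. Qed.

(* Differentiating W := v * h (q), the terms in h' cancel in the rotation field,
   so that only the two exact derivatives of W remain. *)
Lemma rotation_integral0 (v vx vp : R * R -> R) :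
  (forall x p : R, is_derive x 1 (fun x => v (x, p)) (vx (x, p))) ->
  (forall x p : R, is_derive p 1 (fun p => v (x, p)) (vp (x, p))) ->
  continuous v -> continuous vx -> continuous vp ->
  \int[leb2]_z ((vx z * (d ^+ 2 * (z.2 - p0)) - vp z * (c ^+ 2 * (z.1 - x0))) * h (q z)) = 0.
Proof.
move=> dx dp cv cx cp.
pose W z := v z * h (q z).
pose Wx z := vx z * h (q z) + v z * (h' (q z) * (c ^+ 2 * (2 * (z.1 - x0)))).
pose Wp z := vp z * h (q z) + v z * (h' (q z) * (d ^+ 2 * (2 * (z.2 - p0)))).
have cz1 : continuous (fun z : R * R => z.1 - x0).
  by apply: contB; [exact: cont_fst|exact: contC].
have cz2 : continuous (fun z : R * R => z.2 - p0).
  by apply: contB; [exact: cont_snd|exact: contC].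
have dWx (x p : R) : is_derive x 1 (fun x => W (x, p)) (Wx (x, p)).
  have dq : is_derive x 1 (fun x => q (x, p)) (c ^+ 2 * (2 * (x - x0) * (1 - 0)) + 0).
    rewrite /q /qform/=.
    exact: (isdD (isdMl (c ^+ 2) (isdX2 (isdB (isd_id x) (isd_cst x0 x))))
                 (isd_cst (d ^+ 2 * (p - p0) ^+ 2) x)).
  apply: isd_eq (isdM (dx x p) (isd_comp (g := fun x => q (x, p)) (dh _) dq)) _.
  by rewrite /Wx /=; ring.
have dWp (x p : R) : is_derive p 1 (fun p => W (x, p)) (Wp (x, p)).
  have dq : is_derive p 1 (fun p => q (x, p)) (0 + d ^+ 2 * (2 * (p - p0) * (1 - 0))).
    rewrite /q /qform/=.
    exact: (isdD (isd_cst (c ^+ 2 * (x - x0) ^+ 2) p)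
                 (isdMl (d ^+ 2) (isdX2 (isdB (isd_id p) (isd_cst p0 p))))).
  apply: isd_eq (isdM (dp x p) (isd_comp (g := fun p => q (x, p)) (dh _) dq)) _.
  by rewrite /Wp /=; ring.
have h'0 s : N < s -> h' s = 0.
  move=> Ns; rewrite -(isd_derive1 (dh s)) derive1E.
  rewrite (@near_eq_derive _ _ _ h (fun=> 0)) ?derive_cst//.
  by near=> r; apply: hN; near: r; exact: lt_nbhsr.
have W0 z : N < q z -> W z = 0 by move=> Nq; rewrite /W hN// mulr0.
have Wx0 z : N < q z -> Wx z = 0 by move=> Nq; rewrite /Wx hN// h'0// mul0r !mulr0 addr0.
have Wp0 z : N < q z -> Wp z = 0 by move=> Nq; rewrite /Wp hN// h'0// mul0r !mulr0 addr0.
have cWx : continuous Wx.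
  apply: contD; apply: contM => //; apply: contM => //.
  by apply: contM; [exact: contC|apply: contM => //; exact: contC].
have cWp : continuous Wp.
  apply: contD; apply: contM => //; apply: contM => //.
  by apply: contM; [exact: contC|apply: contM => //; exact: contC].
have bx z k : (forall z, N < q z -> k z = 0) ->
    (`|z.1| <= M + M /\ `|z.2| <= M + M) \/ k z = 0 :> R.
  by move=> k0; have [|/k0] := q_box z; [left|right].
have out x p : M + M < `|x| \/ M + M < `|p| -> N < q (x, p).
  by have [[/= a b]|//] := q_box (x, p); case; rewrite ltNge ?a ?b.
have cid1 : continuous (fun x : R => x) by move=> x; exact: cvg_id.
have cx1 p : continuous (fun x => Wx (x, p)) by exact: (cont_pair cWx cid1 (@contC _ _ p)).
have cp1 x : continuous (fun p => Wp (x, p)) by exact: (cont_pair cWp (@contC _ _ x) cid1).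
have int1 : \int[leb2]_z ((z.2 - p0) * Wx z) = 0.
  rewrite Rintegral_fubini21; last first.
  - move=> p; apply: (@compact_support_integrable _ _ (M + M)).
      by rewrite /=; apply: contM; [exact: contC|exact: cx1].
    by move=> x xM /=; rewrite Wx0 ?mulr0//; apply: out; left.
  - apply: (compact_support_integrable2 MM0); first exact: contM.
    by move=> z; apply: (bx z (fun z => (z.2 - p0) * Wx z)) => w Nw; rewrite Wx0// mulr0.
  rewrite -[RHS](Rintegral0 (@leb R)); apply: eq_Rintegral => p _ /=.
  have ix : (@leb R).-integrable setT (EFin \o (fun x => Wx (x, p))).
    apply: (@compact_support_integrable _ _ (M + M)).
      by exact: cx1.
    by move=> x xM /=; rewrite Wx0//; apply: out; left.
  rewrite RintegralZl//=.
  rewrite (@Rintegral_FTC_compact _ (fun x => W (x, p)) (fun x => Wx (x, p)) (M + M)) ?mulr0//.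
  by move=> x xM /=; rewrite W0//; apply: out; left.
have int2 : \int[leb2]_z ((z.1 - x0) * Wp z) = 0.
  rewrite Rintegral_fubini12; last first.
  - move=> x; apply: (@compact_support_integrable _ _ (M + M)).
      by rewrite /=; apply: contM; [exact: contC|exact: cp1].
    by move=> p pM /=; rewrite Wp0 ?mulr0//; apply: out; right.
  - apply: (compact_support_integrable2 MM0); first exact: contM.
    by move=> z; apply: (bx z (fun z => (z.1 - x0) * Wp z)) => w Nw; rewrite Wp0// mulr0.
  rewrite -[RHS](Rintegral0 (@leb R)); apply: eq_Rintegral => x _ /=.
  have ip : (@leb R).-integrable setT (EFin \o (fun p => Wp (x, p))).
    apply: (@compact_support_integrable _ _ (M + M)).
      by exact: cp1.
    by move=> p pM /=; rewrite Wp0//; apply: out; right.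
  rewrite RintegralZl//=.
  rewrite (@Rintegral_FTC_compact _ (fun p => W (x, p)) (fun p => Wp (x, p)) (M + M)) ?mulr0//.
  by move=> p pM /=; rewrite W0//; apply: out; right.
have i1 : (@leb2 R).-integrable setT (EFin \o (fun z => (z.2 - p0) * Wx z)).
  apply: (compact_support_integrable2 MM0); first exact: contM.
  by move=> z; apply: (bx z (fun z => (z.2 - p0) * Wx z)) => w Nw; rewrite Wx0// mulr0.
have i2 : (@leb2 R).-integrable setT (EFin \o (fun z => (z.1 - x0) * Wp z)).
  apply: (compact_support_integrable2 MM0); first exact: contM.
  by move=> z; apply: (bx z (fun z => (z.1 - x0) * Wp z)) => w Nw; rewrite Wp0// mulr0.
have scal k f : (@leb2 R).-integrable setT (EFin \o f) ->
    (@leb2 R).-integrable setT (EFin \o (fun z => k * f z)).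
  by move=> fi; exact: (integrableZl measurableT k fi).
transitivity (\int[leb2]_z (d ^+ 2 * ((z.2 - p0) * Wx z) - c ^+ 2 * ((z.1 - x0) * Wp z))).
  by apply: eq_Rintegral => z _; rewrite /Wx /Wp; ring.
rewrite RintegralB//=; [|exact: scal|exact: scal].
by rewrite !RintegralZl// int1 int2 !mulr0 subr0.
Unshelve. all: by end_near. Qed.

(** Dilate [u] about the centre by a factor [l]. The weighted integral has as derivative in [l] the
    integral of the radial derivative of [u], which the Cauchy-Riemann equations turn into the
    rotational derivative of [v], of integral 0. Hence the values at [l = 0] and [l = 1] agree. *)
Lemma profile_mean_value (u ux up v vx vp : R * R -> R) :
  (forall x p : R, is_derive x 1 (fun x => u (x, p)) (ux (x, p))) ->
  (forall x p : R, is_derive p 1 (fun p => u (x, p)) (up (x, p))) ->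
  (forall x p : R, is_derive x 1 (fun x => v (x, p)) (vx (x, p))) ->
  (forall x p : R, is_derive p 1 (fun p => v (x, p)) (vp (x, p))) ->
  continuous u -> continuous ux -> continuous up ->
  continuous v -> continuous vx -> continuous vp ->
  (forall z, c * up z = - (d * vx z)) -> (forall z, c * vp z = d * ux z) ->
  \int[leb2]_z (u z * h (q z)) = u (x0, p0) * \int[leb2]_z h (q z).
Proof.
move=> dux dup dvx dvp cu cux cup cv cvx cvp CR1 CR2.
have cne : c != 0 by rewrite gt_eqF.
have dne : d != 0 by rewrite gt_eqF.
pose Lx l (z : R * R) := x0 + l * (z.1 - x0).
pose Lp l (z : R * R) := p0 + l * (z.2 - p0).
pose g l z := u (Lx l z, Lp l z) * h (q z).
pose G l (z : R * R) := ((z.1 - x0) * ux (Lx l z, Lp l z)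
                      + (z.2 - p0) * up (Lx l z, Lp l z)) * h (q z).
have dg (l : R) (z : R * R) : is_derive l 1 (g ^~ z) (G l z).
  have := chain_rule_line x0 p0 (z.1 - x0) (z.2 - p0) l dux dup cux cup.
  by move=> H; apply: isd_eq (isdM H (isd_cst (h (q z)) l)) _; rewrite /G /=; ring.
have cz1 : continuous (fun z : R * R => z.1 - x0).
  by apply: contB; [exact: cont_fst|exact: contC].
have cz2 : continuous (fun z : R * R => z.2 - p0).
  by apply: contB; [exact: cont_snd|exact: contC].
have cLx l : continuous (Lx l).
  by apply: contD; [exact: contC|apply: contM; [exact: contC|exact: cz1]].
have cLp l : continuous (Lp l).
  by apply: contD; [exact: contC|apply: contM; [exact: contC|exact: cz2]].
have cL (k : R * R -> R) l : continuous k -> continuous (fun z => k (Lx l z, Lp l z)).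
  by move=> ck; exact: (cont_pair ck (cLx l) (cLp l)).
have box0 (k : R * R -> R) z : (`|z.1| <= M + M /\ `|z.2| <= M + M) \/ k z * h (q z) = 0 :> R.
  by have [|/hN ->] := q_box z; [left|rewrite mulr0; right].
have ig l : (@leb2 R).-integrable setT (EFin \o g l).
  apply: (compact_support_integrable2 MM0).
    by apply: contM => //; exact: cL.
  by move=> z; exact: (box0 (fun z => u (Lx l z, Lp l z))).
have iG l : (@leb2 R).-integrable setT (EFin \o G l).
  apply: (compact_support_integrable2 MM0).
    by apply: contM => //; apply: contD; apply: contM => //; exact: cL.
  move=> z; exact: (box0 (fun z => (z.1 - x0) * ux (Lx l z, Lp l z)
                      + (z.2 - p0) * up (Lx l z, Lp l z))).
have [K1 K10 K1P] := continuous_bounded_box (M + 2 * M) cux.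
have [K2 K20 K2P] := continuous_bounded_box (M + 2 * M) cup.
have [K3 K30 K3P] : exists2 K, 0 <= K & forall z, `|h (q z)| <= K.
  apply: (compact_support_bounded (M := M + M)) => // z.
  by have := box0 (fun=> 1) z; rewrite mul1r.
pose K := (M * K1 + M * K2) * K3.
pose B := [set z : R * R | `|z.1| <= M + M /\ `|z.2| <= M + M].
(* The open interval []-2, 2[] contains [[0, 1]], so the endpoints are interior points for
   differentiation under the integral; for such [l] the dilated coordinates are at most
   [M + 2 * M]. *)
have Gub l z : `]-2, 2[%classic l -> `|G l z| <= K * \1_B z.
  rewrite /= in_itv/= => /andP[l1 l2].
  have K0 : 0 <= K by rewrite mulr_ge0// addr_ge0// mulr_ge0.
  have [zN|/hN hz] := leP (q z) N; last by rewrite /G hz mulr0 normr0 mulr_ge0.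
  have -> : \1_B z = 1 :> R.
    rewrite indicE mem_set//; have [//|] := q_box z.
    by rewrite ltNge zN.
  have [z1 z2] := q_le zN.
  have x0M : `|x0| <= M /\ `|p0| <= M.
    have e1 : 0 <= 1 + N / c ^+ 2 by rewrite addr_ge0// divr_ge0// sqr_ge0.
    have e2 : 0 <= 1 + N / d ^+ 2 by rewrite addr_ge0// divr_ge0// sqr_ge0.
    by have := normr_ge0 x0; have := normr_ge0 p0; rewrite /M; split; lra.
  have lle : `|l| <= 2 by rewrite ler_norml; apply/andP; split; lra.
  have Lx1 : `|Lx l z| <= M + 2 * M.
    by rewrite (le_trans (ler_normD _ _))// lerD ?x0M.1// normrM ler_pM.
  have Lp1 : `|Lp l z| <= M + 2 * M.
    by rewrite (le_trans (ler_normD _ _))// lerD ?x0M.2// normrM ler_pM.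
  rewrite mulr1 /G normrM ler_pM//.
  rewrite (le_trans (ler_normD _ _))// lerD// normrM ler_pM//.
    exact: K1P.
  exact: K2P.
pose J l := \int[leb2]_z g l z.
have d1g : partial1of2 g = G.
  by apply/funext => l; apply/funext => z; exact: (isd_derive1 (dg l z)).
have Jdiff (l : R) : `]-2, 2[%classic l -> derivable J l 1 /\ J^`() l = \int[leb2]_z G l z.
  move=> lI; split.
  - apply: (@derivable_under_integral R _ _ leb2 g setT measurableT l (-2) 2 lI
      (fun x _ => ig x) (fun x y _ _ => isd_derivable (dg x y)) (fun z => K * \1_B z)).
    + by move=> y; rewrite mulr_ge0// mulr_ge0// addr_ge0// mulr_ge0.
    + exact: integrable_box.
    + by move=> x y xI _; rewrite d1g; exact: Gub.
  - rewrite (@differentiation_under_integral R _ _ leb2 g setT measurableT l (-2) 2 lI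
      (fun x _ => ig x) (fun x y _ _ => isd_derivable (dg x y)) (fun z => K * \1_B z)).
    + by rewrite d1g.
    + by move=> y; rewrite mulr_ge0// mulr_ge0// addr_ge0// mulr_ge0.
    + exact: integrable_box.
    + by move=> x y xI _; rewrite d1g; exact: Gub.
have J0 l : l != 0 -> \int[leb2]_z G l z = 0.
  move=> l0.
  have dLx (x p : R) : is_derive x 1 (fun x => Lx l (x, p)) (0 + l * (1 - 0)).
    exact: (isdD (isd_cst x0 x) (isdMl l (isdB (isd_id x) (isd_cst x0 x)))).
  have dLp (x p : R) : is_derive p 1 (fun p => Lp l (x, p)) (0 + l * (1 - 0)).
    exact: (isdD (isd_cst p0 p) (isdMl l (isdB (isd_id p) (isd_cst p0 p)))).
  have H : \int[leb2]_z ((l * vx (Lx l z, Lp l z) * (d ^+ 2 * (z.2 - p0))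
     - l * vp (Lx l z, Lp l z) * (c ^+ 2 * (z.1 - x0))) * h (q z)) = 0.
    apply: (@rotation_integral0 (fun z => v (Lx l z, Lp l z))
       (fun z => l * vx (Lx l z, Lp l z)) (fun z => l * vp (Lx l z, Lp l z))).
    - move=> x p; apply: isd_eq (isd_comp (f := fun y => v (y, Lp l (x, p)))
         (g := fun x => Lx l (x, p)) (dvx _ _) (dLx x p)) _.
      by ring.
    - move=> x p; apply: isd_eq (isd_comp (f := fun y => v (Lx l (x, p), y))
         (g := fun p => Lp l (x, p)) (dvp _ _) (dLp x p)) _.
      by ring.
    - exact: cL.
    - by apply: contM; [exact: contC|exact: cL].
    - by apply: contM; [exact: contC|exact: cL].
  (* By the Cauchy-Riemann equations the rotational integrand of the dilated [v] is [- l c d] times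
     the radial integrand of [u]; this is why [l] must be nonzero here. *)
  have : - (l * (c * d)) * \int[leb2]_z G l z = 0.
    rewrite -RintegralZl// -[RHS]H; apply: eq_Rintegral => z _.
    set w := (Lx l z, Lp l z).
    have -> : vx w = - (c * up w) / d by rewrite CR1 opprK mulrC mulKf.
    have -> : vp w = d * ux w / c by rewrite -CR2 mulrC mulKf.
    by rewrite /G -/w; field; rewrite cne dne.
  move/eqP; rewrite mulf_eq0 oppr_eq0 !mulf_eq0 (negbTE l0) (negbTE cne) (negbTE dne)/=.
  by move/eqP.
have Jc : {within `[0, 1], continuous J}.
  apply: derivable_within_continuous => l; rewrite in_itv/= => /andP[l0 l1].
  by apply: (Jdiff l _).1; rewrite /= in_itv/=; apply/andP; split; lra.
have Jd (l : R) : l \in `]0, 1[%R -> derivable J l 1 /\ J^`() l = 0.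
  rewrite in_itv/= => /andP[l0 l1].
  have [a b] := Jdiff l ltac:(by rewrite /= in_itv/=; apply/andP; split; lra).
  by split=> //; rewrite b J0// gt_eqF.
have J01 : J 0 = J 1.
  have i0 : (0 : R) \in `[0, 1]%R by rewrite in_itv/= lexx ler01.
  have i1 : (1 : R) \in `[0, 1]%R by rewrite in_itv/= lexx ler01.
  apply/eqP; rewrite eq_le; apply/andP; split.
  - apply: (@ger0_derive1_le_cc _ J 0 1) => //.
    + by move=> l /Jd[].
    + by move=> l /Jd[_ ->].
  - apply: (@ler0_derive1_le_cc _ J 0 1) => //.
    + by move=> l /Jd[].
    + by move=> l /Jd[_ ->].
have ih : (@leb2 R).-integrable setT (EFin \o (fun z => h (q z))).
  apply: (compact_support_integrable2 MM0) => // z.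
  by have := box0 (fun=> 1) z; rewrite mul1r.
rewrite -RintegralZl//.
have -> : \int[leb2]_z (u (x0, p0) * h (q z)) = J 0.
  by apply: eq_Rintegral => z _; rewrite /g /Lx /Lp !mul0r !addr0.
by rewrite J01; apply: eq_Rintegral => -[x p] _; rewrite /g /Lx /Lp !mul1r !subrKC.
Qed.

End Profile.
End MeanValue.

(** * Gaussian integrals and the Gaussian mean value property *)

Section GaussianIntegrals.
Context {R : realType}.

Lemma gauss_line (a m : R) : 0 < a ->
  (@leb R).-integrable setT (EFin \o (fun x => expR (- (a * (x - m) ^+ 2)))) /\
  \int[leb]_x expR (- (a * (x - m) ^+ 2)) = Num.sqrt (pi / a).
Proof.
(* The standard deviation for which the normal density is proportional to this Gaussian:
   [s^2 = 1 / (2 a)]. *)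
move=> a0; pose s := (Num.sqrt (2 * a))^-1.
have a20 : 0 < 2 * a by rewrite mulr_gt0.
have s0 : s != 0 by rewrite invr_neq0// gt_eqF// sqrtr_gt0.
have s2 : s ^+ 2 = (2 * a)^-1 by rewrite exprVn sqr_sqrtr// ltW.
have pa0 : 0 < pi / a by rewrite divr_gt0// pi_gt0.
have E x : expR (- (a * (x - m) ^+ 2)) = Num.sqrt (pi / a) * normal_pdf m s x.
  rewrite normal_pdfE//= /normal_peak /normal_fun s2.
  have -> : (2 * a)^-1 * pi *+ 2 = pi / a by rewrite -mulr_natr; field; rewrite gt_eqF.
  rewrite [RHS]mulrA divff ?mul1r; last by rewrite gt_eqF// sqrtr_gt0.
  by congr expR; rewrite -mulr_natr; field; rewrite gt_eqF.
have i : (@leb R).-integrable setT (EFin \o (fun x => normal_pdf m s x)).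
  exact: integrable_normal_pdf.
have -> : (fun x => expR (- (a * (x - m) ^+ 2))) =
  (fun x => Num.sqrt (pi / a) * normal_pdf m s x) by apply/funext => x; exact: E.
split; first exact: (integrableZl measurableT (Num.sqrt (pi / a)) i).
rewrite RintegralZl//; have := EFin_Rintegral i; rewrite integral_normal_pdf => -[<-].
by rewrite mulr1.
Qed.

Lemma prod_integrable (f g : R -> R) :
  (@leb R).-integrable setT (EFin \o f) -> (@leb R).-integrable setT (EFin \o g) ->
  (@leb2 R).-integrable setT (EFin \o (fun z : R * R => f z.1 * g z.2)) /\
  \int[leb2]_z (f z.1 * g z.2) = \int[leb]_x f x * \int[leb]_y g y.
Proof.
move=> fi gi.
have mf := integrable_measurable fi; have mg := integrable_measurable gi.
have fgi : (@leb2 R).-integrable setT (EFin \o (fun z : R * R => f z.1 * g z.2)).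
  apply/integrable12ltyP.
    apply/measurable_EFinP; apply: measurable_funM.
      exact: (measurableT_comp mf measurable_fst).
    exact: (measurableT_comp mg measurable_snd).
  have gn := integrable_norm gi; have fn := integrable_norm fi.
  have H x : (\int[leb]_y `|(f x * g y)%:E| = (`|f x| * \int[leb]_y `|g y|)%R%:E)%E.
    rewrite EFinM -EFin_Rintegral// -ge0_integralZl_EFin//.
      by apply: eq_integral => y _; rewrite /= normrM EFinM.
    by apply/measurable_EFinP; exact: (integrable_measurable gn).
  rewrite [X in (X < _)%E](_ : _ = (\int[leb]_x (`|f x| * \int[leb]_y `|g y|)%R%:E)%E); last first.
    by apply: eq_integral => x _; exact: H.
  rewrite EFin_Rintegral ?ltry//.
  exact: (integrableZr measurableT (\int[leb]_y `|g y|) fn).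
split=> //; rewrite Rintegral_fubini12//; last first.
  by move=> x; exact: (integrableZl measurableT (f x) gi).
under eq_Rintegral => x _ do rewrite /= RintegralZl//.
by rewrite RintegralZr.
Qed.

Lemma gauss_plane (a b m n : R) : 0 < a -> 0 < b ->
  (@leb2 R).-integrable setT (EFin \o
     (fun z : R * R => expR (- (a * (z.1 - m) ^+ 2 + b * (z.2 - n) ^+ 2)))) /\
  \int[leb2]_z expR (- (a * (z.1 - m) ^+ 2 + b * (z.2 - n) ^+ 2))
    = pi / Num.sqrt (a * b).
Proof.
move=> a0 b0; have [i1 e1] := gauss_line m a0; have [i2 e2] := gauss_line n b0.
have [i e] := prod_integrable i1 i2.
have E : (fun z : R * R => expR (- (a * (z.1 - m) ^+ 2 + b * (z.2 - n) ^+ 2))) =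
   (fun z => expR (- (a * (z.1 - m) ^+ 2)) * expR (- (b * (z.2 - n) ^+ 2))).
  by apply/funext => z; rewrite -expRD opprD.
rewrite E; split; first exact: i.
rewrite e e1 e2 -sqrtrM ?divr_ge0 ?pi_ge0 ?ltW//.
have -> : pi / a * (pi / b) = pi ^+ 2 / (a * b) by field; rewrite !gt_eqF.
by rewrite sqrtrM ?sqr_ge0// sqrtr_sqr ger0_norm ?pi_ge0// sqrtrV// mulr_ge0// ltW.
Qed.

(** Its square has a continuous derivative, which provides cut-off profiles that are still
    continuously differentiable. *)
Definition pospart (y : R) := (y + `|y|) / 2.

Lemma pospart_ge0 y : 0 <= pospart y.
Proof. by rewrite divr_ge0//; have := ler_norm (- y); rewrite normrN; lra. Qed.

Lemma pospart_id y : 0 <= y -> pospart y = y.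
Proof. by move=> y0; rewrite /pospart ger0_norm//; field. Qed.

Lemma pospart_0 y : y <= 0 -> pospart y = 0.
Proof. by move=> y0; rewrite /pospart ler0_norm// subrr mul0r. Qed.

Lemma cont_pospart : continuous pospart.
Proof.
apply: contM; last exact: contC.
by apply: contD => y; [exact: cvg_id|apply: cvg_norm; exact: cvg_id].
Qed.

Lemma isd_quadratic (k : R -> R) (y L : R) :
  (forall r, `|k (r + y) - k y - L * r| <= r ^+ 2) -> is_derive y 1 k L.
Proof.
move=> kb.
have H : (fun r => r^-1 *: (k (r *: 1 + y) - k y)) @ 0^' --> L.
  apply/cvgrPdist_lt => e e0; near=> r.
  have r0 : r != 0 by near: r; exact: nbhs_dnbhs_neq.
  have -> : L - r^-1 *: (k (r *: 1 + y) - k y) = - r^-1 * (k (r + y) - k y - L * r).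
    by rewrite scaler1 /GRing.scale/=; field.
  rewrite normrM normrN normfV; apply: (@le_lt_trans _ _ (`|r|^-1 * r ^+ 2)).
    by rewrite ler_wpM2l// invr_ge0.
  rewrite -[r ^+ 2]real_normK ?num_real// expr2 mulKf ?normr_eq0//.
  by near: r; exact: dnbhs0_lt.
apply: DeriveDef; first by apply/cvg_ex; exists L.
by apply: (cvg_lim _ H).
Unshelve. all: by end_near. Qed.

Lemma isd_pospart2 (y : R) : is_derive y 1 (fun y => pospart y ^+ 2) (2 * pospart y).
Proof.
apply: isd_quadratic => r.
have [y0|/ltW y0] := leP 0 y; have [ry|/ltW ry] := leP 0 (r + y);
  rewrite ?(pospart_id y0) ?(pospart_0 y0) ?(pospart_id ry) ?(pospart_0 ry);
  rewrite ler_norml; apply/andP; split; nra.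
Qed.

(** A Gaussian profile never vanishes, whereas [profile_mean_value] wants a profile that is zero
    beyond some [N]. With [E s = exp (- b s / 3)], the profiles [E (E - E n)_+^2] vanish beyond [n],
    lie below [E^3 = exp (- b s)] and converge to it, so domination passes both sides to the
    limit. *)
Lemma mean_value_gauss (c d b x0 p0 : R) (u ux up v vx vp : R * R -> R) :
  0 < c -> 0 < d -> 0 < b ->
  (forall x p : R, is_derive x 1 (fun x => u (x, p)) (ux (x, p))) ->
  (forall x p : R, is_derive p 1 (fun p => u (x, p)) (up (x, p))) ->
  (forall x p : R, is_derive x 1 (fun x => v (x, p)) (vx (x, p))) ->
  (forall x p : R, is_derive p 1 (fun p => v (x, p)) (vp (x, p))) ->
  continuous u -> continuous ux -> continuous up ->
  continuous v -> continuous vx -> continuous vp ->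
  (forall z, c * up z = - (d * vx z)) -> (forall z, c * vp z = d * ux z) ->
  (@leb2 R).-integrable setT
     (EFin \o (fun z => u z * expR (- (b * qform c d x0 p0 z)))) ->
  \int[leb2]_z (u z * expR (- (b * qform c d x0 p0 z)))
    = u (x0, p0) * (pi / (b * c * d)).
Proof.
move=> c0 d0 b0 dux dup dvx dvp cu cux cup cv cvx cvp CR1 CR2 ui.
set q := qform c d x0 p0 in ui *.
(* One third, because the approximating profiles are cubic in [E]. *)
pose be := b / 3.
have be0 : 0 < be by rewrite divr_gt0.
pose E s := expR (- (be * s)).
pose h (n : nat) s := E s * pospart (E s - E n%:R) ^+ 2.
pose h' (n : nat) s := (E s * - be) * pospart (E s - E n%:R) ^+ 2 +
   E s * (2 * pospart (E s - E n%:R) * (E s * - be - 0)).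
have dE (s : R) : is_derive s 1 E (E s * - be).
  apply: isd_eq (isd_comp (g := fun s => - (be * s)) (is_derive_expR _)
     (isdN (isdMl be (isd_id s)))) _; rewrite /E; ring.
have cE : continuous E by move=> s; exact: (isd_continuous (dE s)).
have dh n (s : R) : is_derive s 1 (h n) (h' n s).
  exact: (isdM (dE s) (isd_comp (f := fun y => pospart y ^+ 2)
     (g := fun s => E s - E n%:R) (isd_pospart2 _) (isdB (dE s) (isd_cst _ s)))).
have cpp n : continuous (fun s => pospart (E s - E n%:R)).
  apply: cont_comp; first exact: cont_pospart.
  by apply: contB => //; exact: contC.
have ch' n : continuous (h' n).
  apply: contD.
    by apply: contM; [apply: contM => //; exact: contC|apply: contX2].
  apply: contM => //; apply: contM; first by apply: contM => //; exact: contC.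
  by apply: contB; [apply: contM => //; exact: contC|exact: contC].
have hN n s : n%:R < s -> h n s = 0.
  move=> ns; rewrite /h pospart_0 ?expr0n/= ?mulr0//.
  by rewrite subr_le0 ler_expR lerN2 ler_pM2l// ltW.
have Ege0 s : 0 < E s by exact: expR_gt0.
have E3 s : E s * E s ^+ 2 = expR (- (b * s)).
  by rewrite /E expr2 -!expRD /be; congr expR; field.
have hle n s : 0 <= h n s <= expR (- (b * s)).
  apply/andP; split; first by rewrite mulr_ge0 ?sqr_ge0// ltW.
  rewrite /h -E3 (ler_pM2l (Ege0 s)) ler_sqr ?nnegrE ?pospart_ge0 ?(ltW (Ege0 s))//.
  have [l|l] := leP 0 (E s - E n%:R); first by rewrite pospart_id// gerBl ltW.
  by rewrite (pospart_0 (ltW l)) ltW.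
have hcvg s : (fun n => h n s) @ \oo --> expR (- (b * s)).
  have -> : expR (- (b * s)) = E s * (pospart (E s - 0) * pospart (E s - 0)).
    by rewrite subr0 (pospart_id (ltW (Ege0 s))) -expr2 E3.
  have En : (fun n : nat => E n%:R) @ \oo --> (0 : R).
    apply: (cvg_comp (fun n : nat => be * n%:R) (fun y => expR (- y)) _ (@cvgr_expR R)).
    apply/cvgryPge => A; have /cvgryPge H := @cvgr_idn R.
    by apply: filterS (H (A / be)) => n; rewrite ler_pdivrMr// mulrC.
  have pp : (fun n : nat => pospart (E s - E n%:R)) @ \oo --> pospart (E s - 0).
    apply: continuous_cvg; first exact: cont_pospart.
    by apply: cvgB => //; exact: cvg_cst.
  by apply: cvgM; [exact: cvg_cst|exact: cvgM].
have cq : continuous q by exact: cont_qform.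
have c20 : 0 < b * c ^+ 2 by rewrite mulr_gt0// exprn_gt0.
have d20 : 0 < b * d ^+ 2 by rewrite mulr_gt0// exprn_gt0.
have [gi ge] := gauss_plane x0 p0 c20 d20.
have qE : (fun z : R * R => expR (- (b * c ^+ 2 * (z.1 - x0) ^+ 2 + b * d ^+ 2 * (z.2 - p0) ^+ 2)))
   = (fun z => expR (- (b * q z))).
  by apply/funext => z; congr expR; rewrite /q /qform; ring.
rewrite qE in gi ge.
have mh n : measurable_fun [set: measurableTypeR R * measurableTypeR R] (fun z => h n (q z)).
  apply: continuous2_measurable; apply: cont_comp => // s.
  exact: (isd_continuous (dh n s)).
have [] := @Rintegral_dct _ _ _ (@leb2 R) (fun n z => u z * h n (q z))
   (fun z => u z * expR (- (b * q z))) (fun z => `|u z * expR (- (b * q z))|).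
- by move=> n; apply: measurable_funM => //; exact: continuous2_measurable.
- by move=> z; apply: cvgM; [exact: cvg_cst|exact: hcvg].
- exact: integrable_norm.
- move=> n z; rewrite normrM [X in _ <= X]normrM; have /andP[a1 a2] := hle n (q z).
  by rewrite (ger0_norm a1) (ger0_norm (expR_ge0 _)); exact: ler_wpM2l.
move=> _ lim1.
have [] := @Rintegral_dct _ _ _ (@leb2 R) (fun n z => h n (q z))
   (fun z => expR (- (b * q z))) (fun z => expR (- (b * q z))).
- exact: mh.
- by move=> z; exact: hcvg.
- exact: gi.
- by move=> n z; have /andP[a1 a2] := hle n (q z); rewrite ger0_norm.
move=> _ lim2.
have sE : Num.sqrt (b * c ^+ 2 * (b * d ^+ 2)) = b * c * d.
  have -> : b * c ^+ 2 * (b * d ^+ 2) = (b * c * d) ^+ 2 by ring.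
  by rewrite sqrtr_sqr ger0_norm// !mulr_ge0// ltW.
have pm n : \int[leb2]_z (u z * h n (q z)) = u (x0, p0) * \int[leb2]_z h n (q z).
  by apply: (profile_mean_value x0 p0 c0 d0 (ler0n R n) (dh n) (ch' n) (hN n) dux dup dvx dvp).
rewrite -sE -ge; apply: (cvg_unique _ lim1) => //.
rewrite (_ : (fun n => _) = (fun n => u (x0, p0) * \int[leb2]_z h n (q z))); last first.
  by apply/funext => n; exact: pm.
by apply: cvgM => //; exact: cvg_cst.
Qed.

End GaussianIntegrals.

(** * Complex-valued integrals and Gaussians with complex linear term *)

Section ComplexIntegrals.
Context {R : realType}.

Section General.
Context d (T : measurableType d) (mu : {measure set T -> \bar R}).
Implicit Types (f g : T -> R[i]) (k : R[i]).

Definition cInt f : R[i] :=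
  Complex (\int[mu]_x reC (f x)) (\int[mu]_x imC (f x)).
Definition cIable f := mu.-integrable setT (EFin \o (reC \o f)) /\
  mu.-integrable setT (EFin \o (imC \o f)).

Lemma cIableD f g : cIable f -> cIable g -> cIable (fun x => f x + g x).
Proof.
move=> [fr fi] [gr gi]; split.
- have -> : reC \o (fun x => f x + g x) = (fun x => reC (f x) + reC (g x)).
    by apply/funext => x /=; rewrite reCD.
  exact: (integrableD measurableT fr gr).
- have -> : imC \o (fun x => f x + g x) = (fun x => imC (f x) + imC (g x)).
    by apply/funext => x /=; rewrite imCD.
  exact: (integrableD measurableT fi gi).
Qed.

Lemma cIntD f g : cIable f -> cIable g ->
  cInt (fun x => f x + g x) = cInt f + cInt g.
Proof.
move=> [fr fi] [gr gi]; apply: ceqP; rewrite !reimE.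
- by rewrite -[LHS]/(\int[mu]_x _); under eq_Rintegral do rewrite reCD; rewrite RintegralD.
- by rewrite -[LHS]/(\int[mu]_x _); under eq_Rintegral do rewrite imCD; rewrite RintegralD.
Qed.

Let iZ (c : R) (f : T -> R) : mu.-integrable setT (EFin \o f) ->
  mu.-integrable setT (EFin \o (fun x => c * f x)).
Proof. by move=> fi; exact: (integrableZl measurableT c fi). Qed.

Lemma cIableZ k f : cIable f -> cIable (fun x => k * f x).
Proof.
move=> [fr fi]; split.
- have -> : reC \o (fun x => k * f x) =
     (fun x => reC k * reC (f x) - imC k * imC (f x)).
    by apply/funext => x /=; rewrite reCM.
  exact: (integrableB measurableT (iZ (reC k) fr) (iZ (imC k) fi)).
- have -> : imC \o (fun x => k * f x) =
     (fun x => reC k * imC (f x) + imC k * reC (f x)).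
    by apply/funext => x /=; rewrite imCM.
  exact: (integrableD measurableT (iZ (reC k) fi) (iZ (imC k) fr)).
Qed.

Lemma cIntZ k f : cIable f -> cInt (fun x => k * f x) = k * cInt f.
Proof.
move=> [fr fi]; apply: ceqP; rewrite !reimE.
- rewrite -[LHS]/(\int[mu]_x _); under eq_Rintegral do rewrite reCM.
  by rewrite (RintegralB measurableT (iZ (reC k) fr) (iZ (imC k) fi)) !RintegralZl.
- rewrite -[LHS]/(\int[mu]_x _); under eq_Rintegral do rewrite imCM.
  by rewrite (RintegralD measurableT (iZ (reC k) fi) (iZ (imC k) fr)) !RintegralZl.
Qed.

Lemma cInt0 : cInt (fun=> 0) = 0.
Proof. by apply: ceqP; rewrite !reimE; exact: Rintegral0. Qed.

Lemma cIable0 : cIable (fun=> 0).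
Proof. by split; exact: integrable0. Qed.

Lemma cInt_sum (I : Type) (s : seq I) (F : I -> T -> R[i]) :
  (forall i, cIable (F i)) ->
  cIable (fun x => \sum_(i <- s) F i x) /\
  cInt (fun x => \sum_(i <- s) F i x) = \sum_(i <- s) cInt (F i).
Proof.
move=> FI; elim: s => [|i s [IH1 IH2]].
  have -> : (fun x => \sum_(i <- [::]) F i x) = (fun=> 0).
    by apply/funext => x; rewrite big_nil.
  by rewrite big_nil cInt0; split=> //; exact: cIable0.
have -> : (fun x => \sum_(j <- i :: s) F j x) =
   (fun x => F i x + \sum_(j <- s) F j x) by apply/funext => x; rewrite big_cons.
by rewrite big_cons -IH2 cIntD//; split=> //; exact: cIableD.
Qed.

Lemma cIable_dominated f (g : T -> R) :
  measurable_fun setT (reC \o f) -> measurable_fun setT (imC \o f) ->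
  mu.-integrable setT (EFin \o g) -> (forall x, cabs2 (f x) <= g x ^+ 2) ->
  (forall x, 0 <= g x) -> cIable f.
Proof.
move=> mr mi gi fg g0; split.
- apply: (integrable_dominated mr gi) => x.
  rewrite -(@ler_pXn2r _ 2)// ?nnegrE//.
  by apply: le_trans (fg x); exact: normr_reC_le.
- apply: (integrable_dominated mi gi) => x.
  rewrite -(@ler_pXn2r _ 2)// ?nnegrE//.
  by apply: le_trans (fg x); exact: normr_imC_le.
Qed.

End General.

Lemma cInt_prod (f g : R -> R[i]) : cIable (@leb R) f -> cIable (@leb R) g ->
  cIable (@leb2 R) (fun z : R * R => f z.1 * g z.2) /\
  cInt (@leb2 R) (fun z : R * R => f z.1 * g z.2) = cInt (@leb R) f * cInt (@leb R) g.
Proof.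
move=> [fr fi] [gr gi].
have [rr rrE] := prod_integrable fr gr; have [ii iiE] := prod_integrable fi gi.
have [ri riE] := prod_integrable fr gi; have [ir irE] := prod_integrable fi gr.
split; [split|].
- have -> : reC \o (fun z : R * R => f z.1 * g z.2) =
     (fun z => reC (f z.1) * reC (g z.2) - imC (f z.1) * imC (g z.2)).
    by apply/funext => z /=; rewrite reCM.
  exact: (integrableB measurableT rr ii).
- have -> : imC \o (fun z : R * R => f z.1 * g z.2) =
     (fun z => reC (f z.1) * imC (g z.2) + imC (f z.1) * reC (g z.2)).
    by apply/funext => z /=; rewrite imCM.
  exact: (integrableD measurableT ri ir).
- apply: ceqP; rewrite !reimE.
  + rewrite -[LHS]/(\int[leb2]_x _); under eq_Rintegral do rewrite reCM.
    by rewrite (RintegralB measurableT rr ii) rrE iiE.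
  + rewrite -[LHS]/(\int[leb2]_x _); under eq_Rintegral do rewrite imCM.
    by rewrite (RintegralD measurableT ri ir) riE irE.
Qed.

(* Mean value of exp (s (x + i p)) against a Gaussian: the real integral in x is
   known, so the mean value identity yields the oscillating integral in p. *)
Lemma gauss_fourier (b s m : R) : 0 < b ->
  [/\ (@leb R).-integrable setT
        (EFin \o (fun p => cos (s * (p - m)) * expR (- (b * (p - m) ^+ 2)))),
      (@leb R).-integrable setT
        (EFin \o (fun p => sin (s * (p - m)) * expR (- (b * (p - m) ^+ 2)))),
      \int[leb]_p (cos (s * (p - m)) * expR (- (b * (p - m) ^+ 2)))
        = Num.sqrt (pi / b) * expR (- (s ^+ 2 / (4 * b))) &
      \int[leb]_p (sin (s * (p - m)) * expR (- (b * (p - m) ^+ 2))) = 0].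
Proof.
move=> b0; have bne : b != 0 by rewrite gt_eqF.
have [gi ge] := gauss_line m b0.
have cid1 : continuous (fun p : R => p) by move=> p; exact: cvg_id.
have cpm : continuous (fun p : R => p - m) by apply: contB => //; exact: contC.
have cspm : continuous (fun p : R => s * (p - m)) by apply: contM => //; exact: contC.
have cexpb : continuous (fun p : R => expR (- (b * (p - m) ^+ 2))).
  apply: (cont_comp (@continuous_expR R)); apply: contN; apply: contM; first exact: contC.
  exact: contX2.
have Ci : (@leb R).-integrable setT
    (EFin \o (fun p => cos (s * (p - m)) * expR (- (b * (p - m) ^+ 2)))).
  apply: (integrable_dominated _ gi).
    apply: continuous_measurable_fun; apply: contM => //.
    exact: (cont_comp (@continuous_cos R) cspm).
  move=> p; rewrite normrM [`|expR _|]ger0_norm ?expR_ge0// ler_piMl ?expR_ge0//.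
  by rewrite ler_norml cos_geN1 cos_le1.
have Si : (@leb R).-integrable setT
    (EFin \o (fun p => sin (s * (p - m)) * expR (- (b * (p - m) ^+ 2)))).
  apply: (integrable_dominated _ gi).
    apply: continuous_measurable_fun; apply: contM => //.
    exact: (cont_comp (@continuous_sin R) cspm).
  move=> p; rewrite normrM [`|expR _|]ger0_norm ?expR_ge0// ler_piMl ?expR_ge0//.
  by rewrite ler_norml sin_geN1 sin_le1.
(* Completing the square: [s (x - m) - b (x - m)^2] is a Gaussian exponent centred at
   [m + s / (2 b)] plus the constant [s^2 / (4 b)], the logarithm of [K]. *)
have [xi xe] := gauss_line (m + s / (2 * b)) b0.
pose K := expR (s ^+ 2 / (4 * b)).
have K0 : K != 0 by rewrite gt_eqF// expR_gt0.
have XE x : expR (s * (x - m)) * expR (- (b * (x - m) ^+ 2)) =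
   K * expR (- (b * (x - (m + s / (2 * b))) ^+ 2)).
  by rewrite -!expRD; congr expR; field.
have Xi : (@leb R).-integrable setT
    (EFin \o (fun x => expR (s * (x - m)) * expR (- (b * (x - m) ^+ 2)))).
  have -> : (fun x => expR (s * (x - m)) * expR (- (b * (x - m) ^+ 2))) =
     (fun x => K * expR (- (b * (x - (m + s / (2 * b))) ^+ 2))).
    by apply/funext => x; exact: XE.
  exact: (integrableZl measurableT K xi).
have Xe : \int[leb]_x (expR (s * (x - m)) * expR (- (b * (x - m) ^+ 2))) =
   K * Num.sqrt (pi / b).
  by under eq_Rintegral do rewrite XE; rewrite RintegralZl// xe.
have [XCi XCe] := prod_integrable Xi Ci.
have [XSi XSe] := prod_integrable Xi Si.
pose e (z : R * R) := expR (s * (z.1 - m)).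
pose C (z : R * R) := cos (s * (z.2 - m)).
pose S (z : R * R) := sin (s * (z.2 - m)).
have ce : continuous e.
  apply: (cont_comp (@continuous_expR R)); apply: contM; first exact: contC.
  by apply: contB; [exact: cont_fst|exact: contC].
have cC : continuous C.
  apply: (cont_comp (@continuous_cos R)); apply: contM; first exact: contC.
  by apply: contB; [exact: cont_snd|exact: contC].
have cS : continuous S.
  apply: (cont_comp (@continuous_sin R)); apply: contM; first exact: contC.
  by apply: contB; [exact: cont_snd|exact: contC].
have dl (x : R) : is_derive x 1 (fun x => s * (x - m)) (s * (1 - 0)).
  exact: (isdMl s (isdB (isd_id x) (isd_cst m x))).
have de (x p : R) : is_derive x 1 (fun x => e (x, p)) (s * e (x, p)).
  apply: isd_eq (isd_comp (g := fun x => s * (x - m)) (is_derive_expR _) (dl x)) _.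
  by rewrite /e/=; ring.
have dCo (x p : R) : is_derive p 1 (fun p => C (x, p)) (- (s * S (x, p))).
  apply: isd_eq (isd_comp (g := fun x => s * (x - m)) (is_derive_cos _) (dl p)) _.
  by rewrite /S/=; ring.
have dS (x p : R) : is_derive p 1 (fun p => S (x, p)) (s * C (x, p)).
  apply: isd_eq (isd_comp (g := fun x => s * (x - m)) (is_derive_sin _) (dl p)) _.
  by rewrite /C/=; ring.
have qE z : expR (- (b * qform 1 1 m m z)) =
   expR (- (b * (z.1 - m) ^+ 2)) * expR (- (b * (z.2 - m) ^+ 2)).
  by rewrite -expRD; congr expR; rewrite /qform; ring.
have cons k : continuous (fun _ : R * R => k : R) by exact: contC.
have u1 (x p : R) : is_derive x 1 (fun x => e (x, p) * C (x, p)) (s * (e (x, p) * C (x, p))).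
  by apply: isd_eq (isdM (de x p) (isd_cst (C (x, p)) x)) _; ring.
have u2 (x p : R) : is_derive p 1 (fun p => e (x, p) * C (x, p)) (- (s * (e (x, p) * S (x, p)))).
  by apply: isd_eq (isdMl (e (x, p)) (dCo x p)) _; ring.
have v1 (x p : R) : is_derive x 1 (fun x => e (x, p) * S (x, p)) (s * (e (x, p) * S (x, p))).
  by apply: isd_eq (isdM (de x p) (isd_cst (S (x, p)) x)) _; ring.
have v2 (x p : R) : is_derive p 1 (fun p => e (x, p) * S (x, p)) (s * (e (x, p) * C (x, p))).
  by apply: isd_eq (isdMl (e (x, p)) (dS x p)) _; ring.
have ceC : continuous (fun z => e z * C z) by exact: contM.
have ceS : continuous (fun z => e z * S z) by exact: contM.
have cseC : continuous (fun z => s * (e z * C z)) by exact: contM.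
have cseS : continuous (fun z => s * (e z * S z)) by exact: contM.
have uE : (fun z => e z * C z * expR (- (b * qform 1 1 m m z))) =
   (fun z => expR (s * (z.1 - m)) * expR (- (b * (z.1 - m) ^+ 2)) *
      (cos (s * (z.2 - m)) * expR (- (b * (z.2 - m) ^+ 2)))).
  by apply/funext => z; rewrite qE /e /C; ring.
have vE : (fun z => e z * S z * expR (- (b * qform 1 1 m m z))) =
   (fun z => expR (s * (z.1 - m)) * expR (- (b * (z.1 - m) ^+ 2)) *
      (sin (s * (z.2 - m)) * expR (- (b * (z.2 - m) ^+ 2)))).
  by apply/funext => z; rewrite qE /e /S; ring.
(* [e * C] and [e * S] are the real and imaginary parts of [exp (s ((x - m) + i (p - m)))]; at the
   centre [(m, m)] they are 1 and 0. *)
have MC : \int[leb2]_z (e z * C z * expR (- (b * qform 1 1 m m z)))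
    = (e (m, m) * C (m, m)) * (pi / (b * 1 * 1)).
  apply: (mean_value_gauss (u := fun z => e z * C z) (v := fun z => e z * S z)
    ltr01 ltr01 b0 u1 u2 v1 v2 ceC cseC (contN cseS) ceS cseS cseC) => //.
  - by move=> z; ring.
  - by rewrite uE; exact: XCi.
have MS : \int[leb2]_z (e z * S z * expR (- (b * qform 1 1 m m z)))
    = (e (m, m) * S (m, m)) * (pi / (b * 1 * 1)).
  have nu1 (x p : R) := isdN (u1 x p); have nu2 (x p : R) := isdN (u2 x p).
  apply: (mean_value_gauss (u := fun z => e z * S z) (v := fun z => - (e z * C z))
    ltr01 ltr01 b0 v1 v2 nu1 nu2 ceS cseS cseC (contN ceC) (contN cseC)
    (contN (contN cseS))) => //.
  - by move=> z; ring.
  - by move=> z; ring.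
  - by rewrite vE; exact: XSi.
have sq0 : Num.sqrt (pi / b) != 0 by rewrite gt_eqF// sqrtr_gt0 divr_gt0// pi_gt0.
split=> //.
- move: MC; rewrite uE XCe Xe /e /C /= subrr mulr0 expR0 cos0 !mulr1 mul1r => MC.
  apply: (mulfI (mulf_neq0 K0 sq0)); rewrite MC expRN -/K.
  have {1}-> : pi / b = Num.sqrt (pi / b) ^+ 2.
    by rewrite sqr_sqrtr// divr_ge0 ?pi_ge0// ltW.
  by field.
- move: MS; rewrite vE XSe Xe /e /S /= subrr mulr0 sin0 mulr0 mul0r => /eqP.
  by rewrite mulf_eq0 (negbTE (mulf_neq0 K0 sq0)) => /eqP.
Qed.

(** The real part of [z] moves the centre to [m = Re z / (2 a)], and the imaginary part becomes the
    frequency in [gauss_fourier]. *)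
Lemma gauss_line_complex (a : R) (z : R[i]) : 0 < a ->
  cIable (@leb R) (fun x => cexp (- (a * x ^+ 2)%:C + z * x%:C)) /\
  cInt (@leb R) (fun x => cexp (- (a * x ^+ 2)%:C + z * x%:C)) =
    (Num.sqrt (pi / a))%:C * cexp (z ^+ 2 / (4 * a)%:C).
Proof.
move=> a0; have ane : a != 0 by rewrite gt_eqF.
pose xi := reC z; pose eta := imC z; pose m := xi / (2 * a).
have [ci si ce se] := gauss_fourier eta m a0.
pose g x : R[i] := Complex (cos (eta * (x - m)) * expR (- (a * (x - m) ^+ 2)))
                           (sin (eta * (x - m)) * expR (- (a * (x - m) ^+ 2))).
have gI : cIable (@leb R) g by split.
pose k := cexp ((xi ^+ 2 / (4 * a))%:C + 'i * (eta * m)%:C).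
have E : (fun x => cexp (- (a * x ^+ 2)%:C + z * x%:C)) = (fun x => k * g x).
  apply/funext => x.
  have -> : g x = cexp ((- (a * (x - m) ^+ 2))%:C + 'i * (eta * (x - m))%:C).
    apply: ceqP; rewrite !reimE !(mul0r, mul1r, mulr0, subr0, addr0, add0r) /g/=;
      by rewrite mulrC.
  rewrite -cexpD; congr cexp; apply: ceqP; rewrite !reimE -/xi -/eta /m; by field.
rewrite E; split; first exact: cIableZ.
rewrite cIntZ//.
have -> : cInt (@leb R) g = (Num.sqrt (pi / a))%:C * cexp (- (eta ^+ 2 / (4 * a)))%:C.
  apply: ceqP; rewrite cexpr !reimE !(mul0r, mulr0, subr0, addr0).
    exact: ce.
  exact: se.
rewrite mulrCA -cexpD; congr (_ * cexp _).
by apply: ceqP; rewrite !reimE -/xi -/eta /m; field.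
Qed.

End ComplexIntegrals.

(** * A class of smooth functions on the plane *)

Section ElementaryFunctions.
Context {R : realType}.

(** The class is stable under both partial derivatives, so that smoothness of every order follows by
    a single induction. *)
Inductive elemf : (R -> R -> R[i]) -> Prop :=
| elemf_cst k : elemf (fun _ _ => k)
| elemf_x : elemf (fun x _ => x%:C)
| elemf_p : elemf (fun _ p => p%:C)
| elemf_add f g : elemf f -> elemf g -> elemf (fun x p => f x p + g x p)
| elemf_mul f g : elemf f -> elemf g -> elemf (fun x p => f x p * g x p)
| elemf_exp f : elemf f -> elemf (fun x p => cexp (f x p)).

Lemma elemf_isdC f : elemf f -> exists fx fp, [/\ elemf fx, elemf fp,
  (forall x p, isdC (fun x => f x p) x (fx x p)) &
  (forall x p, isdC (f x) p (fp x p))].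
Proof.
elim=> [k||| g h eg [gx [gp [egx egp dgx dgp]]] eh [hx [hp [ehx ehp dhx dhp]]]
  | g h eg [gx [gp [egx egp dgx dgp]]] eh [hx [hp [ehx ehp dhx dhp]]]
  | g eg [gx [gp [egx egp dgx dgp]]]].
- exists (fun _ _ => 0), (fun _ _ => 0); split; try exact: elemf_cst; move=> x p; exact: isdC_cst.
- exists (fun _ _ => 1), (fun _ _ => 0); split; try exact: elemf_cst; move=> x p.
    exact: isdC_id.
  exact: isdC_cst.
- exists (fun _ _ => 0), (fun _ _ => 1); split; try exact: elemf_cst; move=> x p.
    exact: isdC_cst.
  exact: isdC_id.
- exists (fun x p => gx x p + hx x p), (fun x p => gp x p + hp x p); split.
  + exact: elemf_add.
  + exact: elemf_add.
  + by move=> x p; exact: (isdCD (dgx x p) (dhx x p)).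
  + by move=> x p; exact: (isdCD (dgp x p) (dhp x p)).
- exists (fun x p => gx x p * h x p + g x p * hx x p),
         (fun x p => gp x p * h x p + g x p * hp x p); split.
  + by apply: elemf_add; exact: elemf_mul.
  + by apply: elemf_add; exact: elemf_mul.
  + by move=> x p; exact: (isdCM (dgx x p) (dhx x p)).
  + by move=> x p; exact: (isdCM (dgp x p) (dhp x p)).
- exists (fun x p => gx x p * cexp (g x p)), (fun x p => gp x p * cexp (g x p)); split.
  + by apply: elemf_mul => //; exact: elemf_exp.
  + by apply: elemf_mul => //; exact: elemf_exp.
  + by move=> x p; exact: (isdC_cexp (dgx x p)).
  + by move=> x p; exact: (isdC_cexp (dgp x p)).
Qed.

Lemma elemf_continuous f : elemf f ->
  continuous (fun z : R * R => reC (f z.1 z.2)) /\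
  continuous (fun z : R * R => imC (f z.1 z.2)).
Proof.
elim=> [k||| g h eg [g1 g2] eh [h1 h2] | g h eg [g1 g2] eh [h1 h2] | g eg [g1 g2]].
- by split; exact: contC.
- by split; [exact: cont_fst|exact: contC].
- by split; [exact: cont_snd|exact: contC].
- by split; [under eq_fun do rewrite reCD|under eq_fun do rewrite imCD]; exact: contD.
- split; [under eq_fun do rewrite reCM; apply: contB|under eq_fun do rewrite imCM; apply: contD];
    exact: contM.
- split; [under eq_fun do rewrite reC_cexp|under eq_fun do rewrite imC_cexp]; apply: contM.
  + exact: (cont_comp (@continuous_expR R) g1).
  + exact: (cont_comp (@continuous_cos R) g2).
  + exact: (cont_comp (@continuous_expR R) g1).
  + exact: (cont_comp (@continuous_sin R) g2).
Qed.

Lemma elemf_smooth f : elemf f -> smooth2 f.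
Proof.
move=> ef n; elim: n f ef => [f /elemf_continuous//|n IH f ef].
have [fx [fp [efx efp dx dp]]] := elemf_isdC ef.
split; first by move=> x p; split; [exact: isdC_derivC (dx x p)|exact: isdC_derivC (dp x p)].
split; first exact: IH.
have -> : pdx f = fx.
  by apply/funext => x; apply/funext => p; rewrite /pdx (isdC_dC (dx x p)).
have -> : pdp f = fp.
  by apply/funext => x; apply/funext => p; rewrite /pdp (isdC_dC (dp x p)).
by split; exact: IH.
Qed.

Lemma elemf_sum (I : Type) (s : seq I) (F : I -> R -> R -> R[i]) :
  (forall i, elemf (F i)) -> elemf (fun x p => \sum_(i <- s) F i x p).
Proof.
move=> eF; elim: s => [|i s IH].
  have -> : (fun x p => \sum_(i <- [::]) F i x p) = (fun _ _ => 0).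
    by apply/funext => x; apply/funext => p; rewrite big_nil.
  exact: elemf_cst.
have -> : (fun x p => \sum_(j <- i :: s) F j x p) =
   (fun x p => F i x p + \sum_(j <- s) F j x p).
  by apply/funext => x; apply/funext => p; rewrite big_cons.
exact: elemf_add.
Qed.

End ElementaryFunctions.

(** * Images of coherent states: inner products and reproducing formula *)

Section SqueezedStates.
Context {R : realType}.
Variables (c d : R).
Hypotheses (c0 : 0 < c) (d0 : 0 < d).

(** Up to sign, [a] and [b] are the coefficients of [(p - P)^2] and [(x - Q)^2] in the second
    formula of (c), once [sin (theta + alpha t)] is replaced by [sin theta (c + d)]. *)
Let a : R := d / (2 * (c + d)).
Let b : R := c / (2 * (c + d)).

Let cd0 : 0 < c + d. Proof. by rewrite addr_gt0. Qed.
Let cdne : c + d != 0. Proof. by rewrite gt_eqF. Qed.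
Let cne : c != 0. Proof. by rewrite gt_eqF. Qed.
Let dne : d != 0. Proof. by rewrite gt_eqF. Qed.
Let a0 : 0 < a. Proof. by rewrite divr_gt0// mulr_gt0. Qed.
Let b0 : 0 < b. Proof. by rewrite divr_gt0// mulr_gt0. Qed.
Let abE : b = 2^-1 - a. Proof. by rewrite /a /b; field. Qed.

Definition sq_exponent (P Q x p : R) : R[i] :=
  Complex (- (a * (p - P) ^+ 2) - b * (x - Q) ^+ 2)
          (- (P * (x - Q)) - 2 * a * (x - Q) * (p - P)).

(* For [c = cos (alpha t)] and [d = sin (alpha t) / alpha] this is the image of [coh P Q]. *)
Definition sq_state (P Q x p : R) : R[i] :=
  ((Num.sqrt (pi * (c + d)))^-1)%:C * cexp (sq_exponent P Q x p).

(** Vanishing of [nabla_Xw], with [c] for [wcx] and [i d] for [wcp]. *)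
Definition polarized (psi : R -> R -> R[i]) := forall x p,
  'i * d%:C * pdx psi x p - c%:C * pdp psi x p
  + 'i * p%:C * ('i * d%:C) * psi x p = 0.

Let sq_exponent_poly P Q x p : sq_exponent P Q x p =
  (- a)%:C * ((p%:C + (- P)%:C) * (p%:C + (- P)%:C))
  + (- b)%:C * ((x%:C + (- Q)%:C) * (x%:C + (- Q)%:C))
  + (- (P%:C * 'i)) * (x%:C + (- Q)%:C)
  + (- ((2 * a)%:C * 'i)) * ((x%:C + (- Q)%:C) * (p%:C + (- P)%:C)).
Proof. by apply: ceqP; rewrite !reimE /sq_exponent/=; ring. Qed.

Lemma sq_state_elemf P Q : elemf (sq_state P Q).
Proof.
have -> : sq_state P Q = (fun x p => ((Num.sqrt (pi * (c + d)))^-1)%:C * cexp (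
   (- a)%:C * ((p%:C + (- P)%:C) * (p%:C + (- P)%:C))
  + (- b)%:C * ((x%:C + (- Q)%:C) * (x%:C + (- Q)%:C))
  + (- (P%:C * 'i)) * (x%:C + (- Q)%:C)
  + (- ((2 * a)%:C * 'i)) * ((x%:C + (- Q)%:C) * (p%:C + (- P)%:C)))).
  by apply/funext => x; apply/funext => p; rewrite /sq_state sq_exponent_poly.
have ex : elemf (fun x _ => x%:C + (- Q)%:C) by apply: elemf_add; [exact: elemf_x|exact: elemf_cst].
have ep : elemf (fun _ p => p%:C + (- P)%:C) by apply: elemf_add; [exact: elemf_p|exact: elemf_cst].
apply: (elemf_mul (elemf_cst _)); apply: elemf_exp.
apply: elemf_add; last by apply: (elemf_mul (elemf_cst _)); exact: elemf_mul.
apply: elemf_add; last by apply: (elemf_mul (elemf_cst _)).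
by apply: elemf_add; apply: (elemf_mul (elemf_cst _)); exact: elemf_mul.
Qed.

Lemma sq_state_dx P Q x p : isdC (fun x => sq_state P Q x p) x
  (Complex (- (2 * b * (x - Q))) (- P - 2 * a * (p - P)) * sq_state P Q x p).
Proof.
have xd := isdCD (isdC_id x) (isdC_cst (- Q)%:C x).
have cp := isdC_cst (p%:C + (- P)%:C) x.
have Ed : isdC (fun x => sq_exponent P Q x p) x
    (Complex (- (2 * b * (x - Q))) (- P - 2 * a * (p - P))).
  have -> : (fun x => sq_exponent P Q x p) = _ := funext (fun x => sq_exponent_poly P Q x p).
  apply: isdC_eq (isdCD (isdCD (isdCD (isdC_cst _ x) (isdCMl _ (isdCM xd xd)))
     (isdCMl _ xd)) (isdCMl _ (isdCM xd cp))) _.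
  by apply: ceqP; rewrite !reimE/=; ring.
by apply: isdC_eq (isdCMl _ (isdC_cexp Ed)) _; rewrite /sq_state; ring.
Qed.

Lemma sq_state_dp P Q x p : isdC (sq_state P Q x) p
  (Complex (- (2 * a * (p - P))) (- (2 * a * (x - Q))) * sq_state P Q x p).
Proof.
have pd := isdCD (isdC_id p) (isdC_cst (- P)%:C p).
have cx := isdC_cst (x%:C + (- Q)%:C) p.
have Ed : isdC (sq_exponent P Q x) p
    (Complex (- (2 * a * (p - P))) (- (2 * a * (x - Q)))).
  have -> : sq_exponent P Q x = _ := funext (sq_exponent_poly P Q x).
  apply: isdC_eq (isdCD (isdCD (isdCD (isdCMl _ (isdCM pd pd)) (isdC_cst _ p))
     (isdC_cst _ p)) (isdCMl _ (isdCM cx pd))) _.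
  by apply: ceqP; rewrite !reimE/=; ring.
by apply: isdC_eq (isdCMl _ (isdC_cexp Ed)) _; rewrite /sq_state; ring.
Qed.

Lemma sq_state_polarized P Q : polarized (sq_state P Q).
Proof.
move=> x p; rewrite /pdx /pdp (isdC_dC (sq_state_dx P Q x p)) (isdC_dC (sq_state_dp P Q x p)).
set s := sq_state P Q x p.
transitivity (('i * d%:C * Complex (- (2 * b * (x - Q))) (- P - 2 * a * (p - P)) -
   c%:C * Complex (- (2 * a * (p - P))) (- (2 * a * (x - Q))) +
   'i * p%:C * ('i * d%:C)) * s); first by ring.
suff -> : 'i * d%:C * Complex (- (2 * b * (x - Q))) (- P - 2 * a * (p - P)) -
   c%:C * Complex (- (2 * a * (p - P))) (- (2 * a * (x - Q))) +
   'i * p%:C * ('i * d%:C) = 0 by rewrite mul0r.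
by apply: ceqP; rewrite !reimE/= /a /b; field.
Qed.

Lemma sq_state_abs2 P Q x p : cabs2 (sq_state P Q x p) =
  (pi * (c + d))^-1 * expR (- (2 * b * (x - Q) ^+ 2 + 2 * a * (p - P) ^+ 2)).
Proof.
rewrite cabs2M cabs2_cexp cabs2_real exprVn sqr_sqrtr; last first.
  by rewrite mulr_ge0 ?pi_ge0// ltW.
by congr (_ * _); rewrite expr2 -expRD; congr expR => /=; ring.
Qed.

Lemma sq_state_abs2_integrable P Q :
  (@leb2 R).-integrable setT (EFin \o (fun z => cabs2 (sq_state P Q z.1 z.2))).
Proof.
have [gi _] := gauss_plane Q P (mulr_gt0 (ltr0n R 2) b0) (mulr_gt0 (ltr0n R 2) a0).
have -> : (fun z : R * R => cabs2 (sq_state P Q z.1 z.2)) = (fun z =>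
   (pi * (c + d))^-1 * expR (- (2 * b * (z.1 - Q) ^+ 2 + 2 * a * (z.2 - P) ^+ 2))).
  by apply/funext => z; exact: sq_state_abs2.
exact: (integrableZl measurableT _ gi).
Qed.

(** The Gram kernel shared by the coherent states and their images; that it contains neither [c] nor
    [d] is the isometry. *)
Definition overlap (P Q P' Q' : R) : R[i] :=
  cexp (Complex (- ((Q - Q') ^+ 2 + (P - P') ^+ 2) / 4) ((P + P') * (Q' - Q) / 2)).

(** Both states have the same imaginary coefficient on [x p], and conjugating one of them cancels
    it. The integrand thus separates into a Gaussian in [x] and one in [p], with complex linear
    terms [z1] and [z2]. *)
Lemma sq_state_inner P Q P' Q' :
  cIable (@leb2 R) (fun z => (sq_state P Q z.1 z.2)^* * sq_state P' Q' z.1 z.2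
                             * (Num.sqrt (c * d))%:C) /\
  cInt (@leb2 R) (fun z => (sq_state P Q z.1 z.2)^* * sq_state P' Q' z.1 z.2
                           * (Num.sqrt (c * d))%:C) = overlap P Q P' Q'.
Proof.
pose z1 : R[i] := Complex (2 * b * (Q + Q')) (2 * b * (P - P')).
pose z2 : R[i] := Complex (2 * a * (P + P')) (2 * a * (Q' - Q)).
pose K : R[i] := Complex (- (a * (P ^+ 2 + P' ^+ 2)) - b * (Q ^+ 2 + Q' ^+ 2))
                         (2 * b * (P' * Q' - P * Q)).
have [i1 e1] := gauss_line_complex z1 (mulr_gt0 (ltr0n R 2) b0).
have [i2 e2] := gauss_line_complex z2 (mulr_gt0 (ltr0n R 2) a0).
have [i e] := cInt_prod i1 i2.
pose k : R[i] := ((pi * (c + d))^-1 * Num.sqrt (c * d))%:C * cexp K.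
have E : (fun z : R * R => (sq_state P Q z.1 z.2)^* * sq_state P' Q' z.1 z.2
            * (Num.sqrt (c * d))%:C) =
   (fun z => k * (cexp (- (2 * b * z.1 ^+ 2)%:C + z1 * z.1%:C) *
                  cexp (- (2 * a * z.2 ^+ 2)%:C + z2 * z.2%:C))).
  apply/funext => z; move: (z.1) (z.2) => x p; rewrite /sq_state.
  have conjE (K1 W : R) (u v : R[i]) : (K1%:C * cexp u)^* * (K1%:C * cexp v) * W%:C =
     K1%:C * K1%:C * W%:C * (cexp u^* * cexp v).
    by apply: ceqP; rewrite !reimE cosN sinN; ring.
  rewrite conjE.
  have -> : k = ((Num.sqrt (pi * (c + d)))^-1)%:C * ((Num.sqrt (pi * (c + d)))^-1)%:C
     * (Num.sqrt (c * d))%:C * cexp K.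
    rewrite /k -!rmorphM/= -expr2 exprVn sqr_sqrtr//.
    by rewrite mulr_ge0 ?pi_ge0// ltW.
  rewrite -[RHS]mulrA; congr (_ * _); rewrite -!cexpD; congr cexp.
  by apply: ceqP; rewrite !reimE /sq_exponent/= !abE; field.
rewrite E; split; first exact: cIableZ.
rewrite cIntZ// e e1 e2 /k.
have -> : (Num.sqrt (pi / (2 * b)))%:C * cexp (z1 ^+ 2 / (4 * (2 * b))%:C) *
   ((Num.sqrt (pi / (2 * a)))%:C * cexp (z2 ^+ 2 / (4 * (2 * a))%:C)) =
   (Num.sqrt (pi / (2 * b)) * Num.sqrt (pi / (2 * a)))%:C *
   cexp (z1 ^+ 2 / (4 * (2 * b))%:C + z2 ^+ 2 / (4 * (2 * a))%:C).
  by rewrite cexpD rmorphM/=; ring.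
rewrite mulrACA -rmorphM -cexpD/= -sqrtrM; last first.
  by rewrite divr_ge0 ?pi_ge0// mulr_ge0// ltW.
have -> : pi / (2 * b) * (pi / (2 * a)) = (pi * (c + d)) ^+ 2 / (c * d).
  by rewrite /a /b; field; rewrite cne dne cdne.
rewrite (sqrtrM _ (sqr_ge0 (pi * (c + d)))) sqrtr_sqr ger0_norm; last by rewrite mulr_ge0 ?pi_ge0// ltW.
rewrite sqrtrV ?mulr_ge0 ?ltW//.
(* The half-form weight [sqrt (c d)] is exactly what makes the constants cancel. *)
have -> : (pi * (c + d))^-1 * Num.sqrt (c * d) * (pi * (c + d) / Num.sqrt (c * d)) = 1.
  have sne : Num.sqrt (c * d) != 0 by rewrite gt_eqF// sqrtr_gt0 mulr_gt0.
  have pine : pi != 0 :> R by rewrite gt_eqF// pi_gt0.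
  by rewrite mulrACA mulVf ?mulf_neq0// mul1r divff.
rewrite mul1r; congr cexp; apply: ceqP; rewrite !reimE/= /a /b;
  by field; rewrite cne dne cdne.
Qed.

(** As a function of its label, the kernel is [cexp F] times a Gaussian in [qform]. The mean value
    property returns the value at the centre, where [F] vanishes; the constant is the mass [2 pi] of
    that Gaussian times the normalisation of the states. *)
Lemma reproducing_formula (psi : R -> R -> R[i]) (x0 p0 : R) :
  smoothn 1 psi -> polarized psi ->
  (@leb2 R).-integrable setT (EFin \o (fun z => cabs2 (psi z.1 z.2))) ->
  cIable (@leb2 R) (fun z => psi z.1 z.2 * sq_state z.2 z.1 x0 p0) /\
  cInt (@leb2 R) (fun z => psi z.1 z.2 * sq_state z.2 z.1 x0 p0) =
    (2 * pi / Num.sqrt (pi * (c + d)))%:C * psi x0 p0.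
Proof.
move=> [dpsi [[cre cim] [[crex cimx] [crep cimp]]]] pol psi2.
(* The Cauchy-Riemann equations for [psi * cexp F] impose [be * c * d = 1 / 2]; this is also what
   makes the mass [pi / (be * c * d)] equal to [2 pi]. *)
pose be := (2 * c * d)^-1.
have be0 : 0 < be by rewrite invr_gt0 !mulr_gt0.
pose q := qform c d x0 p0.
(* [psi * cexp F] is holomorphic in [c x + i d p], so the mean value property applies to it. *)
pose F (x p : R) : R[i] :=
  (be * c ^+ 2 - b)%:C * ((x%:C + (- x0)%:C) * (x%:C + (- x0)%:C))
  + (be * d ^+ 2 - a)%:C * ((p%:C + (- p0)%:C) * (p%:C + (- p0)%:C))
  + 'i * (p%:C * (x%:C + (- x0)%:C))
  + (- ((2 * a)%:C * 'i)) * ((x%:C + (- x0)%:C) * (p%:C + (- p0)%:C)).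
have kernelE x p : sq_state p x x0 p0 =
   ((Num.sqrt (pi * (c + d)))^-1)%:C * (cexp (F x p) * (expR (- (be * q (x, p))))%:C).
  rewrite /sq_state -cexpr -cexpD; congr (_ * cexp _).
  by apply: ceqP; rewrite !reimE /sq_exponent /F /q /qform/= ?reimE; ring.
have ex : elemf (fun x _ => x%:C + (- x0)%:C) by apply: elemf_add; [exact: elemf_x|exact: elemf_cst].
have ep : elemf (fun _ p => p%:C + (- p0)%:C) by apply: elemf_add; [exact: elemf_p|exact: elemf_cst].
have eF : elemf F.
  apply: elemf_add; last by apply: (elemf_mul (elemf_cst _)); exact: elemf_mul.
  apply: elemf_add; last first.
    by apply: (elemf_mul (elemf_cst _)); apply: elemf_mul => //; exact: elemf_p.
  by apply: elemf_add; apply: (elemf_mul (elemf_cst _)); exact: elemf_mul.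
pose Fx (x p : R) : R[i] := Complex (2 * (be * c ^+ 2 - b) * (x - x0)) (p - 2 * a * (p - p0)).
pose Fp (x p : R) : R[i] := Complex (2 * (be * d ^+ 2 - a) * (p - p0)) ((x - x0) - 2 * a * (x - x0)).
have dFx x p : isdC (fun x => F x p) x (Fx x p).
  have xd := isdCD (isdC_id x) (isdC_cst (- x0)%:C x).
  have cp k := isdC_cst k x.
  apply: isdC_eq (isdCD (isdCD (isdCD (isdCMl _ (isdCM xd xd)) (cp _))
     (isdCMl _ (isdCMl _ xd))) (isdCMl _ (isdCM xd (cp _)))) _.
  by apply: ceqP; rewrite /Fx !reimE/=; ring.
have dFp x p : isdC (F x) p (Fp x p).
  have pd := isdCD (isdC_id p) (isdC_cst (- p0)%:C p).
  have cx k := isdC_cst k p.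
  apply: isdC_eq (isdCD (isdCD (isdCD (cx _) (isdCMl _ (isdCM pd pd)))
     (isdCMl _ (isdCM (isdC_id p) (cx _)))) (isdCMl _ (isdCM (cx _) pd))) _.
  by apply: ceqP; rewrite /Fp !reimE/=; ring.
pose Phi x p := psi x p * cexp (F x p).
pose Phx x p := pdx psi x p * cexp (F x p) + psi x p * (Fx x p * cexp (F x p)).
pose Php x p := pdp psi x p * cexp (F x p) + psi x p * (Fp x p * cexp (F x p)).
have dPhx x p : isdC (fun x => Phi x p) x (Phx x p).
  by apply: isdCM; [exact: derivC_isdC (dpsi x p).1|exact: isdC_cexp (dFx x p)].
have dPhp x p : isdC (Phi x) p (Php x p).
  by apply: isdCM; [exact: derivC_isdC (dpsi x p).2|exact: isdC_cexp (dFp x p)].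
have CR x p : c%:C * Php x p = 'i * d%:C * Phx x p.
  have pe := pol x p.
  have {}pe : c%:C * pdp psi x p = 'i * d%:C * pdx psi x p - (p * d)%:C * psi x p.
    apply/eqP; rewrite -subr_eq0 -oppr_eq0 -[X in _ == X]pe; apply/eqP.
    have -> : 'i * p%:C * ('i * d%:C) = - (p * d)%:C :> R[i].
      by apply: ceqP; rewrite !reimE; ring.
    by ring.
  have fe : c%:C * Fp x p = 'i * d%:C * Fx x p + (p * d)%:C.
    by apply: ceqP; rewrite /Fp /Fx !reimE/= /a /b /be; field; rewrite cne dne cdne.
  rewrite /Php /Phx [LHS]mulrDr mulrA pe [c%:C * (_ * _)]mulrCA [c%:C * (_ * _)]mulrA fe.
  by ring.
have [cFr cFi] := elemf_continuous (elemf_exp eF).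
have contCM (f g : R -> R -> R[i]) : continuous (fun z : R * R => reC (f z.1 z.2)) ->
    continuous (fun z : R * R => imC (f z.1 z.2)) ->
    continuous (fun z : R * R => reC (g z.1 z.2)) ->
    continuous (fun z : R * R => imC (g z.1 z.2)) ->
    continuous (fun z : R * R => reC (f z.1 z.2 * g z.1 z.2)) /\
    continuous (fun z : R * R => imC (f z.1 z.2 * g z.1 z.2)).
  move=> fr fi gr gi; split; [under eq_fun do rewrite reCM; apply: contB|
     under eq_fun do rewrite imCM; apply: contD]; exact: contM.
have contCD (f g : R -> R -> R[i]) : continuous (fun z : R * R => reC (f z.1 z.2)) /\
    continuous (fun z : R * R => imC (f z.1 z.2)) ->
    continuous (fun z : R * R => reC (g z.1 z.2)) /\
    continuous (fun z : R * R => imC (g z.1 z.2)) ->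
    continuous (fun z : R * R => reC (f z.1 z.2 + g z.1 z.2)) /\
    continuous (fun z : R * R => imC (f z.1 z.2 + g z.1 z.2)).
  move=> [fr fi] [gr gi]; split; [under eq_fun do rewrite reCD|
     under eq_fun do rewrite imCD]; exact: contD.
have cx0 : continuous (fun z : R * R => z.1 - x0) by apply: contB; [exact: cont_fst|exact: contC].
have cp0 : continuous (fun z : R * R => z.2 - p0) by apply: contB; [exact: cont_snd|exact: contC].
have [cPr cPi] : continuous (fun z : R * R => reC (Phi z.1 z.2)) /\
   continuous (fun z : R * R => imC (Phi z.1 z.2)).
  exact: (contCM psi (fun x p => cexp (F x p)) cre cim cFr cFi).
have cFx : continuous (fun z : R * R => reC (Fx z.1 z.2)) /\
   continuous (fun z : R * R => imC (Fx z.1 z.2)).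
  split => /=; first by apply: contM => //; exact: contC.
  by apply: contB; [exact: cont_snd|apply: contM => //; exact: contC].
have cFp : continuous (fun z : R * R => reC (Fp z.1 z.2)) /\
   continuous (fun z : R * R => imC (Fp z.1 z.2)).
  split => /=; first by apply: contM => //; exact: contC.
  by apply: contB => //; apply: contM => //; exact: contC.
have [cPxr cPxi] : continuous (fun z : R * R => reC (Phx z.1 z.2)) /\
   continuous (fun z : R * R => imC (Phx z.1 z.2)).
  have [l1 l2] := contCM Fx (fun x p => cexp (F x p)) cFx.1 cFx.2 cFr cFi.
  exact: (contCD (fun x p => pdx psi x p * cexp (F x p))
     (fun x p => psi x p * (Fx x p * cexp (F x p)))
     (contCM (pdx psi) (fun x p => cexp (F x p)) crex cimx cFr cFi)
     (contCM psi (fun x p => Fx x p * cexp (F x p)) cre cim l1 l2)).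
have [cPpr cPpi] : continuous (fun z : R * R => reC (Php z.1 z.2)) /\
   continuous (fun z : R * R => imC (Php z.1 z.2)).
  have [l1 l2] := contCM Fp (fun x p => cexp (F x p)) cFp.1 cFp.2 cFr cFi.
  exact: (contCD (fun x p => pdp psi x p * cexp (F x p))
     (fun x p => psi x p * (Fp x p * cexp (F x p)))
     (contCM (pdp psi) (fun x p => cexp (F x p)) crep cimp cFr cFi)
     (contCM psi (fun x p => Fp x p * cexp (F x p)) cre cim l1 l2)).
(* The modulus of the product is at most half the sum of [|psi|^2] and the squared modulus of the
   other factor, which is a Gaussian; both are integrable. *)
have keI : cIable (@leb2 R) (fun z => Phi z.1 z.2 * (expR (- (be * q z)))%:C).
  have [gi _] := gauss_plane x0 p0 (mulr_gt0 (ltr0n R 2) b0) (mulr_gt0 (ltr0n R 2) a0).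
  have cG : continuous (fun z => expR (- (be * q z))).
    apply: (cont_comp (@continuous_expR R)); apply: contN; apply: contM; first exact: contC.
    exact: cont_qform.
  apply: (@cIable_dominated _ _ _ (@leb2 R) _ (fun z : R * R => 2^-1 * (cabs2 (psi z.1 z.2) +
     expR (- (2 * b * (z.1 - x0) ^+ 2 + 2 * a * (z.2 - p0) ^+ 2))))).
  - apply: continuous2_measurable.
    have -> : reC \o (fun z : R * R => Phi z.1 z.2 * (expR (- (be * q z)))%:C) =
       (fun z => reC (Phi z.1 z.2) * expR (- (be * q z))).
      by apply/funext => z /=; rewrite reCM reCr imCr mulr0 subr0.
    exact: contM.
  - apply: continuous2_measurable.
    have -> : imC \o (fun z : R * R => Phi z.1 z.2 * (expR (- (be * q z)))%:C) =
       (fun z => imC (Phi z.1 z.2) * expR (- (be * q z))).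
      by apply/funext => z /=; rewrite imCM reCr imCr mulr0 add0r.
    exact: contM.
  - exact: (integrableZl measurableT 2^-1 (integrableD measurableT psi2 gi)).
  - move=> z; rewrite /Phi -mulrA cabs2M.
    have -> : cabs2 (cexp (F z.1 z.2) * (expR (- (be * q z)))%:C) =
       expR (- (2 * b * (z.1 - x0) ^+ 2 + 2 * a * (z.2 - p0) ^+ 2)).
      rewrite -cexpr -cexpD cabs2_cexp expr2 -expRD; congr expR.
      by rewrite /F !reimE /q /qform; ring.
    set u := cabs2 _; set v := expR _.
    by have := sqr_ge0 (u - v); nra.
  - by move=> z; rewrite mulr_ge0// addr_ge0 ?expR_ge0 ?cabs2_ge0.
have kE : (fun z : R * R => psi z.1 z.2 * sq_state z.2 z.1 x0 p0) =
   (fun z => ((Num.sqrt (pi * (c + d)))^-1)%:C * (Phi z.1 z.2 * (expR (- (be * q z)))%:C)).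
  by apply/funext => -[x p] /=; rewrite kernelE /Phi; ring.
rewrite kE; split; first exact: cIableZ.
rewrite cIntZ//.
have rE z : reC (Phi z.1 z.2 * (expR (- (be * q z)))%:C) = reC (Phi z.1 z.2) * expR (- (be * q z)).
  by rewrite reCM reCr imCr mulr0 subr0.
have iE z : imC (Phi z.1 z.2 * (expR (- (be * q z)))%:C) = imC (Phi z.1 z.2) * expR (- (be * q z)).
  by rewrite imCM reCr imCr mulr0 add0r.
have [kr ki] := keI.
have CRr z : c * reC (Php z.1 z.2) = - (d * imC (Phx z.1 z.2)).
  transitivity (reC (c%:C * Php z.1 z.2)); first by rewrite reCM reCr imCr; ring.
  by rewrite CR !reCM ?reCM ?imCM !reCr !imCr ?reCi ?imCi; ring.
have CRi z : c * imC (Php z.1 z.2) = d * reC (Phx z.1 z.2).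
  transitivity (imC (c%:C * Php z.1 z.2)); first by rewrite imCM reCr imCr; ring.
  by rewrite CR !imCM ?reCM ?imCM !reCr !imCr ?reCi ?imCi; ring.
have Phi0 : Phi x0 p0 = psi x0 p0.
  rewrite /Phi; have -> : F x0 p0 = 0 by apply: ceqP; rewrite /F !reimE; ring.
  by rewrite cexp0 mulr1.
have mass : pi / (be * c * d) = 2 * pi by rewrite /be; field; rewrite cne dne.
suff -> : cInt (@leb2 R) (fun z => Phi z.1 z.2 * (expR (- (be * q z)))%:C) =
   (2 * pi)%:C * psi x0 p0.
  by rewrite mulrA -rmorphM/= [_^-1 * _]mulrC.
rewrite -Phi0.
have rd1 (x p : R) := (dPhx x p).1; have id1 (x p : R) := (dPhx x p).2.
have rd2 (x p : R) := (dPhp x p).1; have id2 (x p : R) := (dPhp x p).2.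
apply: ceqP.
- rewrite reCM reCr imCr mul0r subr0 -mass mulrC.
  rewrite -[LHS]/(\int[leb2]_z _); under eq_Rintegral do rewrite rE.
  apply: (@mean_value_gauss R c d be x0 p0 (fun z => reC (Phi z.1 z.2))
     (fun z => reC (Phx z.1 z.2)) (fun z => reC (Php z.1 z.2)) (fun z => imC (Phi z.1 z.2))
     (fun z => imC (Phx z.1 z.2)) (fun z => imC (Php z.1 z.2))
     c0 d0 be0 rd1 rd2 id1 id2 cPr cPxr cPpr cPi cPxi cPpi CRr CRi).
  have -> : (fun z : R * R => reC (Phi z.1 z.2) * expR (- (be * qform c d x0 p0 z))) = (reC \o
     (fun z => Phi z.1 z.2 * (expR (- (be * q z)))%:C)) by apply/funext => z; exact/esym/rE.
  exact: kr.
(* [- i Phi] is holomorphic as well, so the imaginary part is paired with minus the real part. *)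
- rewrite imCM reCr imCr mul0r addr0 -mass mulrC.
  rewrite -[LHS]/(\int[leb2]_z _); under eq_Rintegral do rewrite iE.
  have nrd1 (x p : R) := isdN (rd1 x p); have nrd2 (x p : R) := isdN (rd2 x p).
  have CRi' z : c * imC (Php z.1 z.2) = - (d * - reC (Phx z.1 z.2)) by rewrite CRi mulrN opprK.
  have CRr' z : c * - reC (Php z.1 z.2) = d * imC (Phx z.1 z.2) by rewrite mulrN CRr opprK.
  apply: (@mean_value_gauss R c d be x0 p0 (fun z => imC (Phi z.1 z.2))
     (fun z => imC (Phx z.1 z.2)) (fun z => imC (Php z.1 z.2)) (fun z => - reC (Phi z.1 z.2))
     (fun z => - reC (Phx z.1 z.2)) (fun z => - reC (Php z.1 z.2))
     c0 d0 be0 id1 id2 nrd1 nrd2 cPi cPxi cPpi (contN cPr) (contN cPxr) (contN cPpr) CRi' CRr').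
  have -> : (fun z : R * R => imC (Phi z.1 z.2) * expR (- (be * qform c d x0 p0 z))) = (imC \o
     (fun z => Phi z.1 z.2 * (expR (- (be * q z)))%:C)) by apply/funext => z; exact/esym/iE.
  exact: ki.
Qed.

End SqueezedStates.

(** * Inner products of finite combinations *)

Section SesquilinearExpansion.
Context {R : realType} {d} {T : measurableType d} (mu : {measure set T -> \bar R}).
Variables (st : R * R -> T -> R[i]) (w : T -> R[i]) (G : R * R -> R * R -> R[i]).
Hypothesis stI : forall Y Y', cIable mu (fun z => (st Y z)^* * st Y' z * w z).
Hypothesis stG : forall Y Y', cInt mu (fun z => (st Y z)^* * st Y' z * w z) = G Y Y'.

Lemma conjC_sum (I : Type) (s : seq I) (F : I -> R[i]) :
  (\sum_(i <- s) F i)^* = \sum_(i <- s) (F i)^*.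
Proof.
elim: s => [|i s IH]; first by rewrite !big_nil; apply: ceqP; rewrite !reimE ?oppr0.
rewrite !big_cons -IH; apply: ceqP; rewrite !reimE//; ring.
Qed.

(** Family and weight are abstract because it serves on the line with weight 1 and on the plane with
    the half-form weight. *)
Lemma cInt_sesquilinear (u v : seq (R[i] * (R * R))) :
  cIable mu (fun z => (\sum_(k <- u) k.1 * st k.2 z)^* * (\sum_(l <- v) l.1 * st l.2 z) * w z) /\
  cInt mu (fun z => (\sum_(k <- u) k.1 * st k.2 z)^* * (\sum_(l <- v) l.1 * st l.2 z) * w z)
  = \sum_(k <- u) \sum_(l <- v) (k.1^* * l.1) * G k.2 l.2.
Proof.
have -> : (fun z => (\sum_(k <- u) k.1 * st k.2 z)^* * (\sum_(l <- v) l.1 * st l.2 z) * w z)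
  = (fun z => \sum_(k <- u) \sum_(l <- v) (k.1^* * l.1) * ((st k.2 z)^* * st l.2 z * w z)).
  apply/funext => z.
  rewrite [X in X * _ * _](_ : _ = \sum_(k <- u) (k.1 * st k.2 z)^*); last first.
    exact: (conjC_sum u (fun k => k.1 * st k.2 z)).
  rewrite !mulr_suml; apply: eq_bigr => k _.
  rewrite mulr_sumr mulr_suml; apply: eq_bigr => l _.
  by apply: ceqP; rewrite !reimE; ring.
have inner k : cIable mu (fun z => \sum_(l <- v) (k.1^* * l.1) * ((st k.2 z)^* * st l.2 z * w z))
   /\ cInt mu (fun z => \sum_(l <- v) (k.1^* * l.1) * ((st k.2 z)^* * st l.2 z * w z)) =
      \sum_(l <- v) (k.1^* * l.1) * G k.2 l.2.
  have [|i e] := @cInt_sum _ _ _ mu _ v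
    (fun l z => (k.1^* * l.1) * ((st k.2 z)^* * st l.2 z * w z)).
    by move=> l; exact: cIableZ.
  split; first exact: i.
  by rewrite e; apply: eq_bigr => l _; rewrite cIntZ ?stG.
have [|i e] := @cInt_sum _ _ _ mu _ u (fun k z =>
   \sum_(l <- v) (k.1^* * l.1) * ((st k.2 z)^* * st l.2 z * w z)).
  by move=> k; exact: (inner k).1.
by split; [exact: i|rewrite e; apply: eq_bigr => k _; exact: (inner k).2].
Qed.

End SesquilinearExpansion.

Section CoherentOverlap.
Context {R : realType}.

(** The factor [* 1] gives the integrand the weighted shape of [cInt_sesquilinear]; the remaining
    [1 / sqrt pi] is undone by the [sqrt pi] of [sch_inner]. *)
Lemma coh_inner (P Q P' Q' : R) :
  cIable (@leb R) (fun x => (coh P Q x)^* * coh P' Q' x * 1) /\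
  cInt (@leb R) (fun x => (coh P Q x)^* * coh P' Q' x * 1) =
    ((Num.sqrt pi)^-1)%:C * overlap P Q P' Q'.
Proof.
pose z : R[i] := Complex (Q + Q') (P - P').
pose K : R[i] := Complex (- (Q ^+ 2 + Q' ^+ 2) / 2) (P' * Q' - P * Q).
have [i e] := gauss_line_complex z (ltr01 : 0 < 1 :> R).
have pp : 0 < pi :> R := pi_gt0 R.
have spne : Num.sqrt pi != 0 :> R by rewrite gt_eqF// sqrtr_gt0.
have E : (fun x => (coh P Q x)^* * coh P' Q' x * 1) =
   (fun x => ((Num.sqrt pi)^-1 * (Num.sqrt pi)^-1)%:C * cexp K
      * cexp (- (1 * x ^+ 2)%:C + z * x%:C)).
  apply/funext => x; rewrite /coh.
  have conjE (K1 : R) (u v : R[i]) : (K1%:C * cexp u)^* * (K1%:C * cexp v) * 1 =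
     (K1 * K1)%:C * (cexp u^* * cexp v).
    by apply: ceqP; rewrite !reimE cosN sinN; ring.
  rewrite conjE -[RHS]mulrA -!cexpD; congr (_ * cexp _).
  by apply: ceqP; rewrite !reimE/=; field.
rewrite E; split; first exact: cIableZ.
rewrite cIntZ// e.
have -> : Num.sqrt (pi / 1) = Num.sqrt pi :> R by rewrite divr1.
have -> : ((Num.sqrt pi)^-1 * (Num.sqrt pi)^-1)%:C * cexp K *
   ((Num.sqrt pi)%:C * cexp (z ^+ 2 / (4 * 1)%:C)) =
   ((Num.sqrt pi)^-1)%:C * (cexp K * cexp (z ^+ 2 / (4 * 1)%:C)) :> R[i].
  have rr : ((Num.sqrt pi)^-1 * (Num.sqrt pi)^-1)%:C * (Num.sqrt pi)%:C = ((Num.sqrt pi)^-1)%:C :> R[i].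
    by rewrite -rmorphM/= -mulrA mulVf ?mulr1.
  by rewrite -[in RHS]rr; ring.
rewrite -cexpD; congr (_ * cexp _).
by apply: ceqP; rewrite !reimE/=; field.
Qed.

End CoherentOverlap.

(** * The transform on the span of the coherent states *)

Section Transform.
Context {R : realType}.
Variables (alpha t theta : R).
Hypotheses (alpha_gt0 : 0 < alpha) (t_gt0 : 0 < t) (t_lt : t < pi / (2%:R * alpha))
  (theta_gt0 : 0 < theta) (theta_lt : theta < pi / 2%:R) (tan_theta : tan theta = alpha).

Let c := cos (alpha * t).
Let d := sin (alpha * t) / alpha.
Let c0 : 0 < c. Proof. exact: (cos_at_gt0 alpha_gt0 t_gt0 t_lt). Qed.
Let d0 : 0 < d. Proof. by rewrite divr_gt0//; exact: (sin_at_gt0 alpha_gt0 t_gt0 t_lt). Qed.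

(** Since [sin theta = alpha cos theta], one has [sin (theta + alpha t) = sin theta (c + d)], and
    [theta] cancels from the prefactor and from the exponent. *)
Lemma KSH_coh_sq P Q : KSH_coh alpha t P Q = sq_state c d P Q.
Proof.
apply/funext => x; apply/funext => p.
rewrite (KSH_coh_formula1 alpha_gt0 t_gt0 t_lt theta_gt0 theta_lt tan_theta).
rewrite (formula1E2 alpha_gt0 t_gt0 t_lt theta_gt0 theta_lt tan_theta).
have ct := cos_theta_gt0 theta_gt0 theta_lt.
have st := sin_theta theta_gt0 theta_lt tan_theta.
have ane : alpha != 0 by rewrite gt_eqF.
have ctne : cos theta != 0 by rewrite gt_eqF.
have cdne : c + d != 0 by rewrite gt_eqF// addr_gt0.
have SE : sin (theta + alpha * t) = sin theta * (c + d).
  by rewrite sinD st -/c /d; field.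
have stp : 0 < sin theta by rewrite st mulr_gt0.
have sE : sin (alpha * t) = alpha * d by rewrite /d [RHS]mulrCA divff ?mulr1.
rewrite /formula2 /sq_state -[LHS]mulrA -cexpD; congr (_ * cexp _).
  congr (_%:C); rewrite /prefactor SE invfM mulrA divff ?gt_eqF// mul1r.
  rewrite ger0_norm ?invr_ge0 ?addr_ge0 ?ltW// sqrtrM ?pi_ge0// invfM.
  by rewrite sqrtrV// addr_ge0// ltW.
rewrite [alpha * t + theta]addrC SE -/c sE st.
apply: ceqP; rewrite !reimE /sq_exponent/=; field; rewrite ?ctne ?ane ?cdne//.
Qed.

Lemma KSHE u x p : KSH alpha t u x p = \sum_(k <- u) k.1 * sq_state c d k.2.1 k.2.2 x p.
Proof. by apply: eq_bigr => k _; rewrite KSH_coh_sq. Qed.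

Lemma KSH_elemf u : elemf (KSH alpha t u).
Proof.
have -> : KSH alpha t u = (fun x p => \sum_(k <- u) k.1 * sq_state c d k.2.1 k.2.2 x p).
  by apply/funext => x; apply/funext => p; exact: KSHE.
apply: elemf_sum => k; apply: (elemf_mul (elemf_cst _)); exact: (sq_state_elemf c d).
Qed.

Lemma hf_weightE : hf_weight alpha t = Num.sqrt (c * d).
Proof.
rewrite /hf_weight; congr (Num.sqrt _); rewrite /wcx /wcp -/c -/d.
have -> : - (2%:R * 'i) = Complex 0 (-2) :> R[i] by apply: ceqP; rewrite !reimE/=; ring.
have -> : c%:C * ('i * d%:C)^* - 'i * d%:C * (c%:C)^* = (c * d)%:C * Complex 0 (-2) :> R[i].
  by apply: ceqP; rewrite !reimE/=; ring.
rewrite mulfK//; apply/eqP => /(congr1 imC)/= /eqP.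
by rewrite oppr_eq0 pnatr_eq0.
Qed.

Lemma KSH_polarized u : polarized c d (KSH alpha t u).
Proof.
elim: u => [|k u IH] x p.
  have -> : KSH alpha t [::] = (fun _ _ => 0).
    by apply/funext => y; apply/funext => r; rewrite /KSH big_nil.
  by rewrite /pdx /pdp !(isdC_dC (isdC_cst _ _)); ring.
have E : KSH alpha t (k :: u) =
  (fun x p => k.1 * sq_state c d k.2.1 k.2.2 x p + KSH alpha t u x p).
  by apply/funext => y; apply/funext => r; rewrite /KSH big_cons KSH_coh_sq.
have [fx [fp [_ _ dx dp]]] := elemf_isdC (KSH_elemf u).
have sx := sq_state_dx c d k.2.1 k.2.2 x p; have sp := sq_state_dp c d k.2.1 k.2.2 x p.
rewrite E /pdx /pdp (isdC_dC (isdCD (isdCMl k.1 sx) (dx x p))).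
rewrite (isdC_dC (isdCD (isdCMl k.1 sp) (dp x p))).
have := IH x p; rewrite /pdx /pdp (isdC_dC (dx x p)) (isdC_dC (dp x p)) => e1.
have := sq_state_polarized c0 d0 k.2.1 k.2.2 x p.
rewrite /pdx /pdp (isdC_dC sx) (isdC_dC sp) => e2.
have := congr2 (fun a b : R[i] => k.1 * a + b) e2 e1; rewrite mulr0 addr0 => <-; ring.
Qed.

Lemma HP_inner_overlap u v :
  cIable (@leb2 R) (fun z => (KSH alpha t u z.1 z.2)^* * KSH alpha t v z.1 z.2
                             * (hf_weight alpha t)%:C) /\
  HP_inner alpha t (KSH alpha t u) (KSH alpha t v) =
  \sum_(k <- u) \sum_(l <- v) (k.1^* * l.1) * overlap k.2.1 k.2.2 l.2.1 l.2.2.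
Proof.
have := @cInt_sesquilinear R _ _ (@leb2 R)
   (fun Y z => sq_state c d Y.1 Y.2 z.1 z.2) (fun=> (Num.sqrt (c * d))%:C)
   (fun Y Y' => overlap Y.1 Y.2 Y'.1 Y'.2)
   (fun Y Y' => (sq_state_inner c0 d0 Y.1 Y.2 Y'.1 Y'.2).1)
   (fun Y Y' => (sq_state_inner c0 d0 Y.1 Y.2 Y'.1 Y'.2).2) u v.
have -> : (fun z : R * R => (KSH alpha t u z.1 z.2)^* * KSH alpha t v z.1 z.2
     * (hf_weight alpha t)%:C) = (fun z => (\sum_(k <- u) k.1 * sq_state c d k.2.1 k.2.2 z.1 z.2)^*
     * (\sum_(l <- v) l.1 * sq_state c d l.2.1 l.2.2 z.1 z.2) * (Num.sqrt (c * d))%:C).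
  by apply/funext => z; rewrite !KSHE hf_weightE.
move=> [i e]; split; first exact: i.
rewrite /HP_inner; under eq_fun do rewrite !KSHE hf_weightE.
exact: e.
Qed.

Lemma sch_inner_overlap (u v : Vlist) : sch_inner (Vsum u) (Vsum v) =
  \sum_(k <- u) \sum_(l <- v) (k.1^* * l.1) * @overlap R k.2.1 k.2.2 l.2.1 l.2.2.
Proof.
have [i e] := @cInt_sesquilinear R _ _ (@leb R) (fun Y x => coh Y.1 Y.2 x) (fun=> 1)
   (fun Y Y' => ((Num.sqrt pi)^-1)%:C * overlap Y.1 Y.2 Y'.1 Y'.2)
   (fun Y Y' => (coh_inner Y.1 Y.2 Y'.1 Y'.2).1)
   (fun Y Y' => (coh_inner Y.1 Y.2 Y'.1 Y'.2).2) u v.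
rewrite /sch_inner.
have -> : cint_line (fun x => (Vsum u x)^* * Vsum v x) =
   cInt (@leb R) (fun x => (\sum_(k <- u) k.1 * coh k.2.1 k.2.2 x)^* *
      (\sum_(l <- v) l.1 * coh l.2.1 l.2.2 x) * 1).
  by under [in RHS]eq_fun do rewrite mulr1.
rewrite e mulr_sumr; apply: eq_bigr => k _; rewrite mulr_sumr; apply: eq_bigr => l _.
rewrite mulrCA; congr (_ * _); rewrite mulrA -rmorphM/= divff ?rmorph1 ?mul1r//.
by rewrite gt_eqF// sqrtr_gt0 pi_gt0.
Qed.

Lemma KSH_isometry u v :
  HP_inner alpha t (KSH alpha t u) (KSH alpha t v) = sch_inner (Vsum u) (Vsum v).
Proof. by rewrite (HP_inner_overlap u v).2 sch_inner_overlap. Qed.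

Let W := hf_weight alpha t.
Let W_gt0 : 0 < W. Proof. by rewrite /W hf_weightE sqrtr_gt0 mulr_gt0. Qed.

Lemma KSH_abs2W_integrable u : (@leb2 R).-integrable setT
  (EFin \o (fun z => cabs2 (KSH alpha t u z.1 z.2) * hf_weight alpha t)).
Proof.
have [[i _] _] := HP_inner_overlap u u.
have -> : (fun z : R * R => cabs2 (KSH alpha t u z.1 z.2) * hf_weight alpha t) =
  reC \o (fun z => (KSH alpha t u z.1 z.2)^* * KSH alpha t u z.1 z.2 * (hf_weight alpha t)%:C).
  by apply/funext => z /=; rewrite cabs2E -rmorphM.
exact: i.
Qed.

Lemma KSH_in_HP u : in_HP alpha t (KSH alpha t u).
Proof.
split; first exact: elemf_smooth (KSH_elemf u).
split; first exact: KSH_polarized.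
have := KSH_abs2W_integrable u => i.
by rewrite (EFin_Rintegral i) ltry.
Qed.

Lemma in_HP_abs2_integrable psi : in_HP alpha t psi ->
  (@leb2 R).-integrable setT (EFin \o (fun z => cabs2 (psi z.1 z.2))).
Proof.
move=> [sm [_ fin]].
have [cr ci] := sm 0%N.
have m2 : measurable_fun [set: measurableTypeR R * measurableTypeR R]
   (fun z : R * R => cabs2 (psi z.1 z.2)).
  by apply: continuous2_measurable; apply: contD; exact: contX2.
have i : (@leb2 R).-integrable setT (EFin \o (fun z => cabs2 (psi z.1 z.2) * W)).
  apply: ge0_integrable => //; first by apply: measurable_funM.
  by move=> z; rewrite mulr_ge0 ?cabs2_ge0// ltW.
have -> : (fun z : R * R => cabs2 (psi z.1 z.2)) =
   (fun z => W^-1 * (cabs2 (psi z.1 z.2) * W)).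
  by apply/funext => z; rewrite mulrC mulfK// gt_eqF.
exact: (integrableZl measurableT W^-1 i).
Qed.

Lemma KSH_reproducing psi x0 p0 : in_HP alpha t psi ->
  cIable (@leb2 R) (fun z => psi z.1 z.2 * sq_state c d z.2 z.1 x0 p0) /\
  cInt (@leb2 R) (fun z => psi z.1 z.2 * sq_state c d z.2 z.1 x0 p0) =
    (2 * pi / Num.sqrt (pi * (c + d)))%:C * psi x0 p0.
Proof.
move=> H; have [sm [pol _]] := H.
exact: (reproducing_formula c0 d0 x0 p0 (sm 1%N) pol (in_HP_abs2_integrable H)).
Qed.

(** Every value of [psi] is a multiple of the integral of [psi K], and
    [|psi K| <= l |psi|^2 + |K|^2 / l] for all [l > 0]; the first term integrates to 0 and [l] can
    be taken large. So [psi] vanishes at every point, not merely almost everywhere. *)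
Lemma zero_norm_zero psi : in_HP alpha t psi ->
  \int[leb2]_z cabs2 (psi z.1 z.2) = 0 -> psi = (fun _ _ => 0).
Proof.
move=> H n0; apply/funext => x0; apply/funext => p0.
have [[ir ii] e] := KSH_reproducing x0 p0 H.
have i1 := in_HP_abs2_integrable H.
pose K (z : R * R) := sq_state c d z.2 z.1 x0 p0.
(* Exchanging label and point does not change the modulus of a state, so [K] is square
   integrable. *)
pose g (z : R * R) := cabs2 (sq_state c d p0 x0 z.1 z.2).
have Kg z : cabs2 (K z) = g z.
  by rewrite /K /g !(sq_state_abs2 c0 d0) -[x0 - z.1]opprB -[p0 - z.2]opprB !sqrrN.
have i2 : (@leb2 R).-integrable setT (EFin \o g) := sq_state_abs2_integrable c0 d0 p0 x0.
pose N := \int[leb2]_z g z.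
have small (f : R * R -> R) : (@leb2 R).-integrable setT (EFin \o f) ->
    (forall z, `|f z| ^+ 2 <= cabs2 (psi z.1 z.2 * K z)) -> \int[leb2]_z f z = 0.
  move=> fi fb.
  have bnd l : 0 < l -> `|\int[leb2]_z f z| <= l^-1 * N.
    move=> l0.
    have i3 : (@leb2 R).-integrable setT (EFin \o (fun z => l * cabs2 (psi z.1 z.2))).
      exact: (integrableZl measurableT l i1).
    have i4 : (@leb2 R).-integrable setT (EFin \o (fun z => l^-1 * g z)).
      exact: (integrableZl measurableT l^-1 i2).
    apply: (le_trans (le_normr_Rintegral measurableT fi)).
    apply: (@le_trans _ _ (\int[leb2]_z (l * cabs2 (psi z.1 z.2) + l^-1 * g z))).
      apply: le_Rintegral => //; first exact: integrable_norm.
        exact: (integrableD measurableT i3 i4).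
      move=> z _; have := fb z; rewrite cabs2M Kg.
      set A := cabs2 _; set B := g z; set F := `|f z| => FB.
      have A0 : 0 <= A by exact: cabs2_ge0.
      have B0 : 0 <= B by exact: cabs2_ge0.
      have L0 : 0 <= l * A + l^-1 * B by rewrite addr_ge0// mulr_ge0// ?invr_ge0 ltW.
      rewrite -(@ler_pXn2r _ 2)// ?nnegrE// ?normr_ge0// (le_trans FB)//.
      have -> : A * B = (l * A) * (l^-1 * B) by field; rewrite gt_eqF.
      have := mulr_ge0 (ltW l0) A0; have : 0 <= l^-1 * B by rewrite mulr_ge0// invr_ge0 ltW.
      by move: (l * A) (l^-1 * B) => u v *; nra.
    by rewrite RintegralD//= !RintegralZl// n0 mulr0 add0r.
  have N0 : 0 <= N by apply: Rintegral_ge0 => z _; exact: cabs2_ge0.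
  apply/eqP; rewrite -normr_le0; apply/ler_addgt0Pr => e0 e00; rewrite add0r.
  (* With this [l] the bound [N / l] is [e0 * N / (N + 1)], at most [e0]. *)
  apply: (le_trans (bnd ((N + 1) / e0) _)); first by rewrite divr_gt0// ltr_wpDl.
  rewrite invf_div mulrC mulrCA ler_piMr ?(ltW e00)//.
  by rewrite ler_pdivrMr ?mul1r ?lerDl// ltr_wpDl.
have I0 : cInt (@leb2 R) (fun z => psi z.1 z.2 * K z) = 0.
  apply: ceqP; [apply: (small _ ir)|apply: (small _ ii)] => z.
    exact: normr_reC_le.
  exact: normr_imC_le.
move: e; rewrite -/(cInt _ (fun z => psi z.1 z.2 * K z)) I0 => /esym/eqP.
rewrite mulf_eq0 => /orP[/eqP/(congr1 reC)/= |/eqP//].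
move/eqP; rewrite mulf_eq0 invr_eq0 mulf_eq0 pnatr_eq0/= gt_eqF ?pi_gt0//=.
by rewrite gt_eqF// sqrtr_gt0 mulr_gt0 ?pi_gt0// addr_gt0.
Qed.

Lemma KSH_cat u v x p : KSH alpha t (u ++ v) x p = KSH alpha t u x p + KSH alpha t v x p.
Proof. by rewrite /KSH big_cat. Qed.

Definition Vscale (k : R[i]) (u : @Vlist R) : Vlist := [seq (k * l.1, l.2) | l <- u].

Lemma KSH_scale k u x p : KSH alpha t (Vscale k u) x p = k * KSH alpha t u x p.
Proof. by rewrite /KSH big_map mulr_sumr; apply: eq_bigr => l _ /=; rewrite mulrA. Qed.

Lemma Vsum_cat (u v : @Vlist R) x : Vsum (u ++ v) x = Vsum u x + Vsum v x.
Proof. by rewrite /Vsum big_cat. Qed.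

Lemma Vsum_scale k (u : @Vlist R) x : Vsum (Vscale k u) x = k * Vsum u x.
Proof. by rewrite /Vsum big_map mulr_sumr; apply: eq_bigr => l _ /=; rewrite mulrA. Qed.

(** Many lists can represent the same function. By the isometry the difference of two of them has an
    image of norm 0, and such an image vanishes. *)
Lemma KSH_well_defined u v : Vsum u = Vsum v -> KSH alpha t u = KSH alpha t v.
Proof.
move=> uv; pose w := u ++ Vscale (-1) v.
have Vw : Vsum w = (fun=> 0).
  by apply/funext => x; rewrite Vsum_cat Vsum_scale uv mulN1r subrr.
have n0 : \int[leb2]_z cabs2 (KSH alpha t w z.1 z.2) = 0.
  have /(congr1 reC) := KSH_isometry w w; rewrite Vw /sch_inner.
  have -> : (fun x : R => (0 : R[i])^* * 0) = (fun=> 0) by apply/funext => x; rewrite mulr0.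
  have -> : cint_line (fun=> 0 : R[i]) = 0 by exact: (cInt0 (@leb R)).
  rewrite mulr0 => e.
  have E : \int[leb2]_z (cabs2 (KSH alpha t w z.1 z.2) * W) = 0.
    rewrite -[RHS]e; apply: eq_Rintegral => z _ /=.
    by rewrite cabs2E -rmorphM.
  move: E; rewrite RintegralZr//; last exact: in_HP_abs2_integrable (KSH_in_HP w).
  by move/eqP; rewrite mulf_eq0 (gt_eqF W_gt0) orbF => /eqP.
have := zero_norm_zero (KSH_in_HP w) n0 => K0.
apply/funext => x; apply/funext => p; apply/eqP; rewrite -subr_eq0; apply/eqP.
by rewrite -mulN1r -KSH_scale -KSH_cat -/w K0.
Qed.

(** A character sends a coherent state to the one with momentum [P + P0], times the phase
    [exp (- i P0 Q)]; the images obey the same rule under [Vtau]. *)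
Lemma KSH_V P0 u : (exists v : Vlist, Vsum v = V0 P0 (Vsum u)) /\
  (forall v : Vlist, Vsum v = V0 P0 (Vsum u) ->
     KSH alpha t v = Vtau P0 (KSH alpha t u)).
Proof.
pose v0 : @Vlist R := [seq (k.1 * cexp (- ('i * (P0 * k.2.2)%:C)), (k.2.1 + P0, k.2.2)) | k <- u].
have V0E : Vsum v0 = V0 P0 (Vsum u).
  apply/funext => x; rewrite /Vsum big_map /V0 mulr_sumr; apply: eq_bigr => k _ /=.
  rewrite /coh -mulrA [RHS]mulrCA; congr (_ * _).
  rewrite mulrCA [RHS]mulrCA -!cexpD; congr (_ * cexp _).
  by apply: ceqP; rewrite !reimE; ring.
split; first by exists v0.
move=> v; rewrite -V0E => /KSH_well_defined ->.
apply/funext => x; apply/funext => p; rewrite /Vtau !KSHE big_map mulr_sumr.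
apply: eq_bigr => k _ /=.
rewrite /sq_state -mulrA [RHS]mulrCA; congr (_ * _).
rewrite mulrCA [RHS]mulrCA -!cexpD; congr (_ * cexp _).
by apply: ceqP; rewrite !reimE/=; ring.
Qed.

(** A translation moves the label [Q] by [Q0] without any phase, for coherent states and for their
    images. *)
Lemma KSH_W Q0 u : (exists v : Vlist, Vsum v = Defs.W0 Q0 (Vsum u)) /\
  (forall v : Vlist, Vsum v = Defs.W0 Q0 (Vsum u) ->
     KSH alpha t v = Wtau Q0 (KSH alpha t u)).
Proof.
pose v0 : @Vlist R := [seq (k.1, (k.2.1, k.2.2 + Q0)) | k <- u].
have W0E : Vsum v0 = Defs.W0 Q0 (Vsum u).
  apply/funext => x; rewrite /Vsum big_map /Defs.W0; apply: eq_bigr => k _ /=.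
  rewrite /coh; congr (_ * (_ * cexp _)).
  by apply: ceqP; rewrite !reimE; ring.
split; first by exists v0.
move=> v; rewrite -W0E => /KSH_well_defined ->.
apply/funext => x; apply/funext => p; rewrite /Wtau !KSHE big_map.
apply: eq_bigr => k _ /=; rewrite /sq_state; congr (_ * (_ * cexp _)).
by apply: ceqP; rewrite /=; ring.
Qed.

End Transform.

Lemma rCM {R : realType} (a b : R) : (a * b)%:C = a%:C * b%:C :> R[i].
Proof. by apply: ceqP; rewrite !reimE; ring. Qed.

(** * Squared L^2 distances *)

Section SquareDistance.
Context {R : realType} {d} {T : measurableType d} (mu : {measure set T -> \bar R}).
Implicit Types F G H : T -> R[i].

Definition mC F := measurable_fun setT (reC \o F) /\ measurable_fun setT (imC \o F).

Lemma mCD F G : mC F -> mC G -> mC (fun x => F x + G x).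
Proof.
move=> [Fr Fi] [Gr Gi]; split.
- have -> : reC \o (fun x => F x + G x) = (fun x => reC (F x) + reC (G x)).
    by apply/funext => x /=; rewrite reCD.
  exact: measurable_funD.
- have -> : imC \o (fun x => F x + G x) = (fun x => imC (F x) + imC (G x)).
    by apply/funext => x /=; rewrite imCD.
  exact: measurable_funD.
Qed.

Lemma mCM F G : mC F -> mC G -> mC (fun x => F x * G x).
Proof.
move=> [Fr Fi] [Gr Gi]; split.
- have -> : reC \o (fun x => F x * G x) =
     (fun x => reC (F x) * reC (G x) - imC (F x) * imC (G x)).
    by apply/funext => x /=; rewrite reCM.
  by apply: measurable_funB; exact: measurable_funM.
- have -> : imC \o (fun x => F x * G x) =
     (fun x => reC (F x) * imC (G x) + imC (F x) * reC (G x)).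
    by apply/funext => x /=; rewrite imCM.
  by apply: measurable_funD; exact: measurable_funM.
Qed.

Lemma mC_cst k : mC (fun=> k).
Proof. by split; exact: measurable_cst. Qed.

Lemma mC_real (h : T -> R) : measurable_fun setT h -> mC (fun x => (h x)%:C).
Proof. by move=> mh; split; [exact: mh|exact: measurable_cst]. Qed.

Lemma mCB F G : mC F -> mC G -> mC (fun x => F x - G x).
Proof.
move=> mF mG; have := mCD mF (mCM (mC_cst (-1)) mG).
by congr mC; apply/funext => x; rewrite mulN1r.
Qed.

Lemma mC_sum (I : Type) (s : seq I) (F : I -> T -> R[i]) :
  (forall i, mC (F i)) -> mC (fun x => \sum_(i <- s) F i x).
Proof.
move=> mF; elim: s => [|i s IH].
  have -> : (fun x => \sum_(i <- [::]) F i x) = (fun=> 0).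
    by apply/funext => x; rewrite big_nil.
  exact: mC_cst.
have -> : (fun x => \sum_(j <- i :: s) F j x) = (fun x => F i x + \sum_(j <- s) F j x).
  by apply/funext => x; rewrite big_cons.
exact: mCD.
Qed.

Lemma measurable_cabs2 F : mC F -> measurable_fun setT (fun x => cabs2 (F x)).
Proof. by move=> [Fr Fi]; apply: measurable_funD; exact: measurable_funX. Qed.

Definition dist2 F G : \bar R := (\int[mu]_x (cabs2 (F x - G x))%:E)%E.

Lemma dist2_le (F G F' G' : T -> R[i]) (K : R) : mC F -> mC G -> mC F' -> mC G' -> 0 <= K ->
  (forall x, cabs2 (F x - G x) <= K * cabs2 (F' x - G' x)) ->
  (dist2 F G <= K%:E * dist2 F' G')%E.
Proof.
move=> mF mG mF' mG' K0 le.
have m' : measurable_fun setT (fun x => cabs2 (F' x - G' x)) by apply: measurable_cabs2; exact: mCB.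
rewrite /dist2 -ge0_integralZl_EFin//; last 2 first.
- by move=> x _; rewrite lee_fin cabs2_ge0.
- exact/measurable_EFinP.
apply: ge0_le_integral => //.
- by move=> x _; rewrite lee_fin cabs2_ge0.
- by apply/measurable_EFinP; apply: measurable_cabs2; exact: mCB.
- have : measurable_fun setT (EFin \o (fun x => K * cabs2 (F' x - G' x))).
    by apply/measurable_EFinP; apply: measurable_funM.
  exact.
- by move=> x _; rewrite -EFinM lee_fin.
Qed.

(** Triangle inequality for squares; its factors 2 explain the tolerances [eps / 4] further on. *)
Lemma dist2_add (F G F1 G1 F2 G2 : T -> R[i]) :
  mC F -> mC G -> mC F1 -> mC G1 -> mC F2 -> mC G2 ->
  (forall x, F x - G x = (F1 x - G1 x) + (F2 x - G2 x)) ->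
  (dist2 F G <= 2%:E * dist2 F1 G1 + 2%:E * dist2 F2 G2)%E.
Proof.
move=> mF mG m1 m1' m2 m2' e.
have k1 : measurable_fun setT (fun x => cabs2 (F1 x - G1 x)) by apply: measurable_cabs2; exact: mCB.
have k2 : measurable_fun setT (fun x => cabs2 (F2 x - G2 x)) by apply: measurable_cabs2; exact: mCB.
rewrite /dist2 -!ge0_integralZl_EFin//;
  try (by move=> x _; rewrite lee_fin cabs2_ge0); try exact/measurable_EFinP.
have l1 : measurable_fun setT (fun x => (2%:E * (cabs2 (F1 x - G1 x))%:E)%E).
  have : measurable_fun setT (EFin \o (fun x => 2 * cabs2 (F1 x - G1 x))).
    by apply/measurable_EFinP; apply: measurable_funM.
  exact.
have l2 : measurable_fun setT (fun x => (2%:E * (cabs2 (F2 x - G2 x))%:E)%E).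
  have : measurable_fun setT (EFin \o (fun x => 2 * cabs2 (F2 x - G2 x))).
    by apply/measurable_EFinP; apply: measurable_funM.
  exact.
rewrite -ge0_integralD//;
  try (by move=> x _; rewrite -EFinM lee_fin mulr_ge0// cabs2_ge0).
apply: ge0_le_integral => //.
- by move=> x _; rewrite lee_fin cabs2_ge0.
- by apply/measurable_EFinP; apply: measurable_cabs2; exact: mCB.
- exact: emeasurable_funD.
- by move=> x _; rewrite -!EFinM -EFinD lee_fin e; exact: cabs2D_le.
Qed.

Lemma dct_small (f_ : nat -> T -> R) (g : T -> R) (eps : R) :
  (forall n, measurable_fun setT (f_ n)) -> (forall n x, 0 <= f_ n x) ->
  (forall x, f_ ^~ x @ \oo --> (0 : R)) ->
  mu.-integrable setT (EFin \o g) -> (forall n x, f_ n x <= g x) -> 0 < eps ->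
  exists n, (\int[mu]_x (f_ n x)%:E < eps%:E)%E.
Proof.
move=> mf f0 fc gi fg e0.
have fb n x : `|f_ n x| <= g x by rewrite ger0_norm.
have [_ lim] := Rintegral_dct mf fc gi fb.
rewrite Rintegral0 in lim.
have /cvgrPdist_lt/(_ _ e0)[n _ /(_ n (leqnn n))] := lim.
rewrite sub0r normrN => H; exists n.
rewrite EFin_Rintegral ?lte_fin; last exact: (integrable_dominated (mf n) gi).
exact: le_lt_trans (ler_norm _) H.
Qed.

End SquareDistance.

Import HBNNSimple.

(** * Density of the coherent states on the line *)

Section LineDensity.
Context {R : realType}.
Let lebR := (@leb R).

Lemma isdC_coh (P Q x : R) : exists k, isdC (coh P Q) x k.
Proof.
have d1 := isdMl P (isdB (isd_id x) (isd_cst Q x)).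
have d2 := isdMl 2^-1 (isdX2 (isdB (isd_id x) (isd_cst Q x))).
have -> : coh P Q = (fun x => ((Num.sqrt pi)^-1)%:C *
   cexp (- ('i * (P * (x - Q))%:C) - (2^-1 * (x - Q) ^+ 2)%:C)).
  by apply/funext => y; rewrite /coh [_ / 2]mulrC.
eexists; exact: (isdCMl _ (isdC_cexp (isdCB (isdCN (isdCMl 'i (isdC_real d1))) (isdC_real d2)))).
Qed.

Lemma mC_coh P Q : mC (coh P Q : _ -> R[i]).
Proof.
by split; apply: continuous_measurable_fun => x; have [k [kr ki]] := isdC_coh P Q x;
  [exact: isd_continuous kr|exact: isd_continuous ki].
Qed.

Definition gauss0 (x : R) : R := (Num.sqrt pi)^-1 * expR (- (2^-1 * (x - 0) ^+ 2)).

Lemma gauss0_gt0 x : 0 < gauss0 x.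
Proof. by rewrite mulr_gt0 ?expR_gt0// invr_gt0 sqrtr_gt0 pi_gt0. Qed.

Lemma coh_gauss0 P x : coh P 0 x = cexp (- ('i * (P * x)%:C)) * (gauss0 x)%:C.
Proof.
rewrite /coh /gauss0 (rCM (Num.sqrt pi)^-1) -cexpr [RHS]mulrCA -cexpD subr0; congr (_ * cexp _).
by apply: ceqP; rewrite !reimE; ring.
Qed.

Lemma gauss0_sqr_integrable k :
  lebR.-integrable setT (EFin \o (fun x => k * gauss0 x ^+ 2)).
Proof.
have [i _] := gauss_line 0 (ltr01 : 0 < 1 :> R).
have -> : (fun x => k * gauss0 x ^+ 2) =
   (fun x => (k * (Num.sqrt pi)^-1 ^+ 2) * expR (- (1 * (x - 0) ^+ 2))).
  apply/funext => x; rewrite /gauss0 exprMn -mulrA; congr (_ * (_ * _)).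
  by rewrite expr2 -expRD; congr expR; field.
exact: (integrableZl measurableT _ i).
Qed.

Lemma measurable_gauss0 : measurable_fun setT gauss0.
Proof.
have -> : gauss0 = reC \o (coh 0 0).
  apply/funext => x; rewrite -[RHS]/(reC (coh 0 0 x)) coh_gauss0 !reimE.
  by rewrite !(mul0r, mul1r, mulr0, subr0, addr0, oppr0) expR0 cos0 !mul1r.
exact: (mC_coh 0 0).1.
Qed.

(** Only coherent states at position 0 occur: they are characters times [gauss0], so these sums are
    trigonometric polynomials times a Gaussian. *)
Definition Tsum (w : seq (R[i] * R)) (x : R) : R[i] := \sum_(k <- w) k.1 * coh k.2 0 x.

Lemma mC_Tsum w : mC (Tsum w).
Proof. by apply: mC_sum => k; apply: mCM; [exact: mC_cst|exact: mC_coh]. Qed.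

Definition clT (F : R -> R[i]) := mC F /\
  forall eps : R, 0 < eps -> exists w, (dist2 lebR F (Tsum w) < eps%:E)%E.

Lemma clT_limit F : mC F ->
  (forall eps : R, 0 < eps -> exists2 G, clT G & (dist2 lebR F G < eps%:E)%E) -> clT F.
Proof.
move=> mF app; split=> // eps e0.
have e4 : 0 < eps / 4 by rewrite divr_gt0.
have [G [mG /(_ _ e4)[w Gw]] FG] := app _ e4.
exists w; apply: (le_lt_trans (dist2_add lebR mF (mC_Tsum w) mF mG mG (mC_Tsum w) _)).
  by move=> x; rewrite addrA subrK.
have -> : eps%:E = (2%:E * (eps / 4)%:E + 2%:E * (eps / 4)%:E)%E.
  by rewrite -!EFinM -EFinD; congr (_%:E); field.
by apply: lteD; rewrite lte_pmul2l.
Qed.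

Lemma clT_Tsum w : clT (Tsum w).
Proof.
split; first exact: mC_Tsum.
move=> eps e0; exists w; rewrite /dist2.
under eq_integral do rewrite subrr /cabs2 expr0n/= addr0.
by rewrite integral0 lte_fin.
Qed.

Lemma clTD F G : clT F -> clT G -> clT (fun x => F x + G x).
Proof.
move=> [mF aF] [mG aG]; split; first exact: mCD.
move=> eps e0; have e4 : 0 < eps / 4 by rewrite divr_gt0.
have [u Fu] := aF _ e4; have [v Gv] := aG _ e4.
have E x : Tsum (u ++ v) x = Tsum u x + Tsum v x by rewrite /Tsum big_cat.
exists (u ++ v); apply: (le_lt_trans (dist2_add lebR (mCD mF mG) (mC_Tsum _)
   mF (mC_Tsum u) mG (mC_Tsum v) _)).
  by move=> x; rewrite E; ring.
have -> : eps%:E = (2%:E * (eps / 4)%:E + 2%:E * (eps / 4)%:E)%E.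
  by rewrite -!EFinM -EFinD; congr (_%:E); field.
by apply: lteD; rewrite lte_pmul2l.
Qed.

Lemma clTZ k F : clT F -> clT (fun x => k * F x).
Proof.
move=> [mF aF]; split; first by apply: mCM => //; exact: mC_cst.
move=> eps e0.
have k0 : 0 < cabs2 k + 1 by rewrite ltr_wpDl// cabs2_ge0.
have [u Fu] := aF _ (divr_gt0 e0 k0).
pose v := [seq (k * l.1, l.2) | l <- u].
have E x : Tsum v x = k * Tsum u x.
  by rewrite /Tsum big_map mulr_sumr; apply: eq_bigr => l _ /=; rewrite mulrA.
exists v; apply: (@le_lt_trans _ _ ((cabs2 k + 1)%:E * dist2 lebR F (Tsum u))%E).
  apply: dist2_le => //; [by apply: mCM => //; exact: mC_cst|exact: mC_Tsum|exact: mC_Tsum|exact: ltW|].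
  move=> x; rewrite E -mulrBr cabs2M ler_wpM2r ?cabs2_ge0//.
  by rewrite lerDl.
have -> : eps%:E = ((cabs2 k + 1)%:E * (eps / (cabs2 k + 1))%:E)%E.
  by rewrite -EFinM; congr (_%:E); field; rewrite gt_eqF.
by rewrite lte_pmul2l.
Qed.

Lemma clT_sum (I : Type) (s : seq I) (F : I -> R -> R[i]) :
  (forall i, clT (F i)) -> clT (fun x => \sum_(i <- s) F i x).
Proof.
move=> cF; elim: s => [|i s IH].
  have -> : (fun x => \sum_(i <- [::]) F i x) = Tsum [::].
    by apply/funext => x; rewrite /Tsum !big_nil.
  exact: clT_Tsum.
have -> : (fun x => \sum_(j <- i :: s) F j x) = (fun x => F i x + \sum_(j <- s) F j x).
  by apply/funext => x; rewrite big_cons.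
exact: clTD.
Qed.

(** A character shifts the frequencies of a [Tsum] and preserves distances. *)
Lemma clT_modulate P F : clT F -> clT (fun x => cexp (- ('i * (P * x)%:C)) * F x).
Proof.
move=> [mF aF].
have me : mC (fun x : R => cexp (- ('i * (P * x)%:C))).
  have e x := isdC_cexp (isdCN (isdCMl 'i (isdC_real (isdMl P (isd_id x))))).
  by split; apply: continuous_measurable_fun => x; have [kr ki] := e x;
    [exact: isd_continuous kr|exact: isd_continuous ki].
split; first exact: mCM.
move=> eps e0; have [u Fu] := aF _ e0.
pose v := [seq (l.1, l.2 + P) | l <- u].
have E x : Tsum v x = cexp (- ('i * (P * x)%:C)) * Tsum u x.
  rewrite /Tsum big_map mulr_sumr; apply: eq_bigr => l _ /=.
  rewrite !coh_gauss0 [RHS]mulrCA; congr (_ * _); rewrite [RHS]mulrA -cexpD; congr (cexp _ * _).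
  by apply: ceqP; rewrite !reimE; ring.
exists v; apply: (le_lt_trans _ Fu); rewrite -[leRHS]mul1e.
apply: dist2_le => //; [exact: mCM|exact: mC_Tsum|exact: mC_Tsum|].
move=> x; rewrite E -mulrBr cabs2M cabs2_cexp ler_wpM2r ?cabs2_ge0//.
by rewrite !reimE !(mul0r, mul1r, mulr0, subr0, oppr0) expR0 expr1n.
Qed.

(** The factor [gauss0] makes bounded measurable functions square integrable, so that they can be
    treated as an algebra stable under bounded pointwise limits. *)
Definition Bcl (h : R -> R) := [/\ measurable_fun setT h,
  (exists2 M, 0 <= M & forall x, `|h x| <= M) & clT (fun x => (h x * gauss0 x)%:C)].

Lemma BclD h1 h2 : Bcl h1 -> Bcl h2 -> Bcl (fun x => h1 x + h2 x).
Proof.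
move=> [m1 [M1 p1 b1] c1] [m2 [M2 p2 b2] c2]; split.
- exact: measurable_funD.
- exists (M1 + M2); first exact: addr_ge0.
  by move=> x; rewrite (le_trans (ler_normD _ _))// lerD.
- have := clTD c1 c2; congr clT; apply/funext => x.
  by rewrite -rmorphD/= mulrDl.
Qed.

Lemma BclZ k h : Bcl h -> Bcl (fun x => k * h x).
Proof.
move=> [m [M p b] c]; split; first by apply: measurable_funM.
- exists (`|k| * M); first exact: mulr_ge0.
  by move=> x; rewrite normrM ler_wpM2l.
- have := clTZ k%:C c; congr clT; apply/funext => x.
  by rewrite -rmorphM/= mulrA.
Qed.

(** Approximate [h2 * gauss0] by a [Tsum]. Multiplied by [h1] it becomes a combination of
    modulations of [h1 * gauss0], which stays in the closure, and the bound on [h1] controls the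
    error. *)
Lemma BclM h1 h2 : Bcl h1 -> Bcl h2 -> Bcl (fun x => h1 x * h2 x).
Proof.
move=> [m1 [M1 p1 b1] c1] [m2 [M2 p2 b2] [mc2 c2]]; split.
- exact: measurable_funM.
- exists (M1 * M2); first exact: mulr_ge0.
  by move=> x; rewrite normrM ler_pM.
have mg := measurable_gauss0.
have m12 : mC (fun x => (h1 x * h2 x * gauss0 x)%:C).
  by apply: mC_real; apply: measurable_funM => //; exact: measurable_funM.
apply: clT_limit => // eps e0.
have K0 : 0 < M1 ^+ 2 + 1 by rewrite ltr_wpDl// sqr_ge0.
have [w hw] := c2 _ (divr_gt0 e0 K0).
have E x : (h1 x)%:C * Tsum w x =
   \sum_(k <- w) k.1 * (cexp (- ('i * (k.2 * x)%:C)) * (h1 x * gauss0 x)%:C).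
  rewrite /Tsum mulr_sumr; apply: eq_bigr => k _; rewrite coh_gauss0 (rCM (h1 x)); ring.
exists (fun x => (h1 x)%:C * Tsum w x).
  have -> : (fun x => (h1 x)%:C * Tsum w x) = _ := funext E.
  by apply: clT_sum => k; apply: clTZ; exact: clT_modulate.
apply: (@le_lt_trans _ _ ((M1 ^+ 2 + 1)%:E *
    dist2 lebR (fun x => (h2 x * gauss0 x)%:C) (Tsum w))%E).
  apply: dist2_le => //.
  - by apply: mCM; [exact: mC_real|exact: mC_Tsum].
  - exact: mC_Tsum.
  - exact: ltW.
  - move=> x; rewrite -mulrA (rCM (h1 x)) -mulrBr cabs2M ler_wpM2r ?cabs2_ge0//.
    rewrite cabs2_real -[h1 x ^+ 2]real_normK ?num_real//.
    have := b1 x; have := normr_ge0 (h1 x); move: `|h1 x| => r *; nra.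
have -> : eps%:E = ((M1 ^+ 2 + 1)%:E * (eps / (M1 ^+ 2 + 1))%:E)%E.
  by rewrite -EFinM; congr (_%:E); field; rewrite gt_eqF.
by rewrite lte_pmul2l.
Qed.

Lemma Bcl_limit (h_ : nat -> R -> R) h M : (forall n, Bcl (h_ n)) -> 0 <= M ->
  (forall n x, `|h_ n x| <= M) -> (forall x, h_ ^~ x @ \oo --> h x) -> Bcl h.
Proof.
move=> Bh M0 hb hc.
have mh_ n : measurable_fun setT (h_ n) by case: (Bh n).
have mh : measurable_fun setT h by apply: (measurable_fun_cvg mh_) => x _; exact: hc.
have hM x : `|h x| <= M.
  have H : (fun n => `|h_ n x|) @ \oo --> `|h x| by apply: cvg_norm; exact: hc.
  rewrite -(cvg_lim _ H)//; apply: limr_le; last exact: nearW.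
  by apply/cvg_ex; exists `|h x|.
have mg := measurable_gauss0.
split=> //; first by exists M.
apply: clT_limit; first by apply: mC_real; apply: measurable_funM.
move=> eps e0.
have sq n x : cabs2 ((h x * gauss0 x)%:C - (h_ n x * gauss0 x)%:C) =
    (h x - h_ n x) ^+ 2 * gauss0 x ^+ 2.
  by rewrite -rmorphB/= cabs2_real -mulrBl exprMn.
have [||||||n Hn] := @dct_small R _ _ lebR (fun n x => (h x - h_ n x) ^+ 2 * gauss0 x ^+ 2)
    (fun x => (2 * M) ^+ 2 * gauss0 x ^+ 2) eps.
- move=> n; apply: measurable_funM; last exact: measurable_funX.
  by apply: measurable_funX; exact: (measurable_funB mh (mh_ n)).
- by move=> n x; rewrite mulr_ge0// sqr_ge0.
- move=> x; rewrite -(mul0r (gauss0 x ^+ 2)); apply: cvgM; last exact: cvg_cst.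
  have H : (fun n => h x - h_ n x) @ \oo --> (0 : R).
    by rewrite -(subrr (h x)); apply: cvgB; [exact: cvg_cst|exact: hc].
  by rewrite -(mulr0 (0 : R)); under eq_fun do rewrite expr2; exact: cvgM.
- exact: gauss0_sqr_integrable.
- move=> n x; rewrite ler_wpM2r ?sqr_ge0// -[(h x - _) ^+ 2]real_normK ?num_real//.
  rewrite lerXn2r ?nnegrE ?normr_ge0 ?mulr_ge0//.
  rewrite (le_trans (ler_normB _ _))//; have := hM x; have := hb n x; lra.
- exact: e0.
exists (fun x => (h_ n x * gauss0 x)%:C); first by case: (Bh n).
by rewrite /dist2; under eq_integral do rewrite sq.
Qed.

Lemma Bcl_cst k : Bcl (fun=> k).
Proof.
split; first exact: measurable_cst.
  by exists (`|k|) => // x; exact: lexx.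
have := clT_Tsum [:: (k%:C, 0)]; congr clT; apply/funext => x.
rewrite /Tsum big_seq1/= coh_gauss0 (rCM k); congr (_ * _).
rewrite (_ : - _ = 0) ?cexp0 ?mul1r//; by apply: ceqP; rewrite !reimE; ring.
Qed.

Lemma Bcl_sin (de a : R) : Bcl (fun x => sin (de * (x - a))).
Proof.
split.
- apply: continuous_measurable_fun; apply: (cont_comp (@continuous_sin R)).
  apply: contM; first exact: contC.
  by apply: contB; [move=> x; exact: cvg_id|exact: contC].
- by exists 1 => // x; rewrite ler_norml sin_geN1 sin_le1.
(* Euler's formula for the sine; the term in [exp (i de x)] has label [- de] because [coh P 0]
   carries [exp (- i P x)]. *)
have := clT_Tsum [:: (Complex 0 (- 2^-1) * cexp (- ('i * (de * a)%:C)), - de);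
                     (Complex 0 (2^-1) * cexp ('i * (de * a)%:C), de)].
congr clT; apply/funext => x.
rewrite (rCM (sin _)) /Tsum !big_cons big_nil addr0 ![(_, _).1]/= ![(_, _).2]/= !coh_gauss0.
rewrite [in LHS]mulrA [X in _ + X = _]mulrA -mulrDl; congr (_ * _).
rewrite -(mulrA (Complex 0 (- 2^-1))) -(mulrA (Complex 0 2^-1)) -!cexpD.
have -> : - ('i * (de * a)%:C) - 'i * (- de * x)%:C = 'i * (de * (x - a))%:C :> R[i].
  by apply: ceqP; rewrite !reimE; ring.
have -> : 'i * (de * a)%:C - 'i * (de * x)%:C = - ('i * (de * (x - a))%:C) :> R[i].
  by apply: ceqP; rewrite !reimE; ring.
apply: ceqP; rewrite !reimE/= !(mul0r, mul1r, mulr0, subr0, oppr0, addr0, add0r) expR0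
  ?cosN ?sinN; by field.
Qed.

(* The iterates tend to the sign on [-1, 1]; applied to a sine they bring indicators of
   intervals into the closure of the trigonometric polynomials. *)
Definition smooth_sign (s : R) := (3 * s - s ^+ 3) / 2.

(** One step gives [1 - smooth_sign r = (1 - r) (1 - (r^2 + r) / 2)]. The iterates never fall below
    [s], so each step multiplies the gap to 1 by at most [1 - s / 2]. *)
Lemma iter_sign_pos (s : R) n : 0 < s <= 1 ->
  s <= iter n smooth_sign s <= 1 /\ 1 - iter n smooth_sign s <= (1 - s / 2) ^+ n.
Proof.
move=> /andP[s0 s1]; elim: n => [|n [/andP[l u] IH]].
  by split; [rewrite /= lexx s1|rewrite expr0 /=; lra].
rewrite iterS; set r := iter n _ _ in l u IH *.
have r0 : 0 < r by exact: lt_le_trans l.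
have r1 : 0 <= 1 - r by rewrite subr_ge0.
have g1 : 0 <= r * (1 - r) * (1 + r) / 2.
  exact: (divr_ge0 (mulr_ge0 (mulr_ge0 (ltW r0) r1) (addr_ge0 ler01 (ltW r0))) (ler0n _ 2)).
have g2 : 0 <= (1 - r) ^+ 2 * (r + 2) / 2.
  exact: (divr_ge0 (mulr_ge0 (sqr_ge0 _) (addr_ge0 (ltW r0) (ler0n _ 2))) (ler0n _ 2)).
have g3 : 0 <= (1 - r) * (r ^+ 2 + (r - s)) / 2.
  by rewrite divr_ge0// mulr_ge0// addr_ge0 ?sqr_ge0// subr_ge0.
have e1 : smooth_sign r = r + r * (1 - r) * (1 + r) / 2 by rewrite /smooth_sign; field.
have e2 : smooth_sign r = 1 - (1 - r) ^+ 2 * (r + 2) / 2 by rewrite /smooth_sign; field.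
have e3 : 1 - smooth_sign r = (1 - r) * (1 - s / 2) - (1 - r) * (r ^+ 2 + (r - s)) / 2.
  by rewrite /smooth_sign; field.
split; first by apply/andP; split; [rewrite e1 (le_trans l)// lerDl|rewrite e2 gerBl].
have q0 : 0 <= 1 - s / 2 by lra.
apply: (@le_trans _ _ ((1 - r) * (1 - s / 2))); first by rewrite e3 gerBl.
by rewrite exprSr ler_wpM2r.
Qed.

Lemma iter_sign_opp s n : iter n smooth_sign (- s) = - iter n smooth_sign s.
Proof. by elim: n => // n IH; rewrite !iterS IH /smooth_sign; ring. Qed.

Lemma iter_sign_cvg (s : R) : `|s| <= 1 ->
  (fun n => iter n smooth_sign s) @ \oo --> Num.sg s.
Proof.
have pos r : 0 < r <= 1 -> (fun n => iter n smooth_sign r) @ \oo --> (1 : R).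
  move=> r01; have := r01 => /andP[r0 r1].
  have H : (fun n => (1 - r / 2) ^+ n) @ \oo --> (0 : R).
    by apply: cvg_expr; rewrite ger0_norm; lra.
  have L : (fun n => 1 - iter n smooth_sign r) @ \oo --> (0 : R).
    have sq : \forall n \near \oo, 0 <= 1 - iter n smooth_sign r <= (1 - r / 2) ^+ n.
      apply: nearW => n; have [/andP[a b] ->] := iter_sign_pos n r01.
      by rewrite subr_ge0 b.
    by apply: (squeeze_cvgr sq _ H); exact: cvg_cst.
  rewrite -[X in _ --> X](subr0 (1 : R)).
  have -> : (fun n => iter n smooth_sign r) = (fun n => 1 - (1 - iter n smooth_sign r)).
    by apply/funext => n; ring.
  by apply: cvgB => //; exact: cvg_cst.
have [s0|s0|->] := ltrgtP s 0; rewrite ler_norml => /andP[a b].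
- rewrite ltr0_sg//.
  have -> : (fun n => iter n smooth_sign s) = (fun n => - iter n smooth_sign (- s)).
    by apply/funext => n; rewrite iter_sign_opp opprK.
  by apply: cvgN; apply: pos; lra.
- by rewrite gtr0_sg//; apply: pos; lra.
- rewrite sgr0; have -> : (fun n => iter n smooth_sign 0) = (fun=> 0).
    by apply/funext; elim=> // n IH; rewrite iterS IH /smooth_sign; ring.
  exact: cvg_cst.
Qed.

Lemma iter_sign_le1 s n : `|s| <= 1 -> `|iter n smooth_sign s| <= 1.
Proof.
move=> s1; elim: n => // n; rewrite iterS; set r := iter n _ _.
rewrite !ler_norml => /andP[a b].
have a' : 0 <= r + 1 by lra.
have b' : 0 <= 1 - r by lra.
have e1 : smooth_sign r = 1 - (1 - r) ^+ 2 * ((1 + (r + 1)) / 2) by rewrite /smooth_sign; field.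
have e2 : smooth_sign r = - 1 + (r + 1) ^+ 2 * ((1 + (1 - r)) / 2) by rewrite /smooth_sign; field.
have g1 : 0 <= (1 - r) ^+ 2 * ((1 + (r + 1)) / 2).
  by rewrite mulr_ge0 ?sqr_ge0// divr_ge0// addr_ge0.
have g2 : 0 <= (r + 1) ^+ 2 * ((1 + (1 - r)) / 2).
  by rewrite mulr_ge0 ?sqr_ge0// divr_ge0// addr_ge0.
by apply/andP; split; [rewrite e2 lerDl|rewrite e1 gerBl].
Qed.

Lemma Bcl_iter_sign h n : Bcl h -> Bcl (fun x => iter n smooth_sign (h x)).
Proof.
move=> Bh; elim: n => // n IH.
have -> : (fun x => iter n.+1 smooth_sign (h x)) = (fun x => 3 / 2 * iter n smooth_sign (h x)
   + - 2^-1 * (iter n smooth_sign (h x) * (iter n smooth_sign (h x) * iter n smooth_sign (h x)))).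
  by apply/funext => x; rewrite iterS {1}/smooth_sign; field.
by apply: BclD; apply: BclZ => //; apply: BclM => //; exact: BclM.
Qed.

Lemma Bcl_sg_sin de a : Bcl (fun x => Num.sg (sin (de * (x - a)))).
Proof.
apply: (@Bcl_limit (fun n x => iter n smooth_sign (sin (de * (x - a)))) _ 1) => //.
- by move=> n; apply: Bcl_iter_sign; exact: Bcl_sin.
- by move=> n x; apply: iter_sign_le1; rewrite ler_norml sin_geN1 sin_le1.
- by move=> x; apply: iter_sign_cvg; rewrite ler_norml sin_geN1 sin_le1.
Qed.

(** Slowing the sine down to [(x - a) / (n + 1)] pushes its other zeros to infinity: for fixed [x]
    its sign is eventually that of [x - a]. *)
Lemma Bcl_sg a : Bcl (fun x => Num.sg (x - a)).
Proof.
apply: (@Bcl_limit (fun n x => Num.sg (sin (n.+1%:R^-1 * (x - a)))) _ 1) => //.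
- by move=> n; exact: Bcl_sg_sin.
- by move=> n x; rewrite normr_sg; case: eqP => _; rewrite ?lexx ?ler01.
move=> x; apply: cvg_near_cst; near=> n.
have xn : `|x - a| < n.+1%:R.
  by apply: (@lt_le_trans _ _ n%:R); [near: n; exact: nbhs_infty_gtr|rewrite ler_nat].
have n0 : (0 : R) < n.+1%:R by rewrite ltr0n.
have pi1 : 1 < pi :> R by have := @pi_ge2 R; lra.
have [x0|x0|->] := ltrgtP (x - a) 0.
- rewrite !ltr0_sg// -[_ * _]opprK sinN oppr_lt0 -mulrN; apply: sin_gt0_pi.
  rewrite ltr0_norm// in xn; apply/andP; split; first by rewrite mulr_gt0 ?invr_gt0 ?oppr_gt0.
  by rewrite mulrC (lt_trans _ pi1)// ltr_pdivrMr// mul1r.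
- rewrite !gtr0_sg//; apply: sin_gt0_pi.
  rewrite gtr0_norm// in xn; apply/andP; split; first by rewrite mulr_gt0 ?invr_gt0.
  by rewrite mulrC (lt_trans _ pi1)// ltr_pdivrMr// mul1r.
- by rewrite mulr0 sin0.
Unshelve. all: by end_near. Qed.

(** The sets with this property form a sigma-algebra: products give finite unions, bounded limits
    give countable ones. It contains the rays []a, +oo[], whose indicator is [(sg + sg^2) / 2] at
    [x - a]. *)
Lemma Bcl_indic (A : set (measurableTypeR R)) : measurable A -> Bcl (\1_A : R -> R).
Proof.
move=> mA.
have : sigma_algebra [set: R] [set A : set R | Bcl (\1_A : R -> R)].
  split => /=.
  - by have := Bcl_cst 0; congr Bcl; apply/funext => x; rewrite indic0.
  - move=> B BB; have := BclD (Bcl_cst 1) (BclZ (-1) BB); congr Bcl.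
    apply/funext => x; rewrite !indicE in_setD in_setT/=; case: (x \in B) => /=; ring.
  - move=> F BF.
    have fin n : Bcl (\1_(\bigcup_(i < n) F i) : R -> R).
      elim: n => [|n IH].
        have := Bcl_cst 0; congr Bcl; apply/funext => x.
        by rewrite bigcup_mkord big_ord0 indic0.
      have B1 := BclD (BF n) (BclD IH (BclZ (-1) (BclM (BF n) IH))).
      move: B1; congr Bcl; apply/funext => x.
      rewrite !bigcup_mkord big_ord_recr/= !indicE in_setU.
      by case: (x \in \big[_/_]_(_ < _) _); case: (x \in F n) => /=; ring.
    apply: (@Bcl_limit (fun n => \1_(\bigcup_(i < n) F i)) _ 1) => //.
      by move=> n x; rewrite indicE; case: (_ \in _); rewrite ?normr1 ?normr0.
    move=> x; apply: cvg_near_cst.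
    have [[i _ Fix]|nF] := pselect ((\bigcup_k F k) x).
      near=> n; rewrite !indicE !mem_set//; first by exists i.
      by exists i => //=; near: n; exact: nbhs_infty_gt.
    near=> n; rewrite !indicE !memNset// => -[i _ Fi]; apply: nF; by exists i.
move=> sB.
have sub : <<s [set A | exists x, A = `]x, +oo[%classic] >> `<=` [set A : set R | Bcl (\1_A : R -> R)].
  apply: smallest_sub => // _ [a ->] /=.
  have S := Bcl_sg a.
  have := BclD (BclZ 2^-1 S) (BclZ 2^-1 (BclM S S)); congr Bcl; apply/funext => x.
  rewrite indicE; have [x0|x0|x0] := ltrgtP (x - a) 0.
  - rewrite ltr0_sg// memNset ?/=; first by field.
    by rewrite in_itv/= andbT; apply/negP; rewrite -leNgt; lra.
  - rewrite gtr0_sg// mem_set ?/=; first by field.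
    by rewrite in_itv/= andbT; lra.
  - rewrite x0 sgr0 memNset ?/=; first by field.
    by rewrite in_itv/= andbT; apply/negP; rewrite -leNgt; lra.
have mA' : (@RGenOInfty.G R).-sigma.-measurable A by rewrite -(RGenOInfty.measurableE R).
exact: (sub A mA').
Unshelve. all: by end_near. Qed.

Lemma Bcl_sum (I : Type) (s : seq I) (F : I -> R -> R) :
  (forall i, Bcl (F i)) -> Bcl (fun x => \sum_(i <- s) F i x).
Proof.
move=> BF; elim: s => [|i s IH].
  by have := Bcl_cst 0; congr Bcl; apply/funext => x; rewrite big_nil.
by have := BclD (BF i) IH; congr Bcl; apply/funext => x; rewrite big_cons.
Qed.

Lemma Bcl_bounded (h : R -> R) M : measurable_fun [set: measurableTypeR R] h ->
  (forall x, `|h x| <= M) -> Bcl h.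
Proof.
have pos (g : R -> R) K : measurable_fun [set: measurableTypeR R] g ->
    (forall x, 0 <= g x <= K) -> Bcl g.
  move=> mg gK.
  have mge : measurable_fun [set: measurableTypeR R] (EFin \o g) by exact/measurable_EFinP.
  have g0 (x : measurableTypeR R) : [set: measurableTypeR R] x -> (0 <= (EFin \o g) x)%E.
    by move=> _; rewrite lee_fin; have /andP[] := gK x.
  have [f [fnd fc]] := approximation measurableT mge g0.
  have fc' x : (fun n => f n x) @ \oo --> g x.
    by have := fc x Logic.I => /fine_cvg.
  have K0 : 0 <= K by have /andP[a b] := gK 0; exact: le_trans b.
  apply: (@Bcl_limit (fun n => f n) _ K) => //.
  - move=> n.
    have -> : (f n : R -> R) = (fun x => \sum_(y <- finmap.enum_fset (fset_set (range (f n))))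
         (y * \1_(f n @^-1` [set y]) x)).
      by apply/funext => x; rewrite [LHS](fimfunE (f n)) fsbig_finite.
    by apply: Bcl_sum => i; apply: BclZ; apply: Bcl_indic; exact: measurable_sfunP.
  - move=> n x; rewrite ger0_norm//; have /andP[_] := gK x; apply: le_trans.
    rewrite -(cvg_lim _ (fc' x))//; apply: (nondecreasing_cvgn_le (u_ := fun n => f n x)).
      by move=> i j ij; have /lefP := fnd _ _ ij; apply.
    by apply/cvg_ex; exists (g x).
move=> mh hM.
have mpp : measurable_fun [set: measurableTypeR R] (@pospart R).
  by apply: continuous_measurable_fun; exact: cont_pospart.
have bnd y : `|y| <= M -> 0 <= pospart y <= M.
  move=> yM; rewrite pospart_ge0/=; have [y0|/ltW y0] := leP 0 y.
    by rewrite pospart_id// (le_trans (ler_norm _)).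
  by rewrite pospart_0// (le_trans _ yM).
have B1 : Bcl (fun x => pospart (h x)).
  by apply: (pos _ M) => [|x]; [exact: (measurableT_comp mpp mh)|exact: bnd].
have B2 : Bcl (fun x => pospart (- h x)).
  apply: (pos _ M) => [|x]; last by apply: bnd; rewrite normrN.
  by apply: (measurableT_comp mpp); exact: measurableT_comp.
have := BclD B1 (BclZ (-1) B2); congr Bcl; apply/funext => x.
by rewrite /pospart normrN; field.
Qed.

(** Truncating [y = f / gauss0] at height [n] gives bounded functions [h n] such that [h n * gauss0]
    tends to [f], with squared error dominated by [f^2]. *)
Lemma clT_real (f : R -> R) : measurable_fun [set: measurableTypeR R] f ->
  lebR.-integrable setT (EFin \o (fun x => f x ^+ 2)) -> clT (fun x => (f x)%:C).
Proof.
move=> mf fi; apply: clT_limit; first exact: mC_real.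
move=> eps e0; have mg := measurable_gauss0.
pose y x := f x / gauss0 x.
have my : measurable_fun [set: measurableTypeR R] y.
  apply: measurable_funM => //.
  pose g' x := Num.sqrt pi * expR (2^-1 * (x - 0) ^+ 2) : R.
  have -> : (fun x => (gauss0 x)^-1) = g'.
    by apply/funext => x; rewrite /gauss0 invfM invrK -expRN opprK.
  apply: continuous_measurable_fun; apply: contM; first exact: contC.
  apply: (cont_comp (@continuous_expR R)); apply: contM; first exact: contC.
  by apply: contX2; apply: contB; [move=> x; exact: cvg_id|exact: contC].
pose h (n : nat) x := Num.max (Num.min (y x) n%:R) (- n%:R).
have mh n : measurable_fun [set: measurableTypeR R] (h n).
  by apply: measurable_maxr => //; exact: measurable_minr.
have hn n x : `|h n x| <= n%:R.
  by rewrite ler_norml /h le_max lexx orbT/= ge_max ge_min lexx orbT/= ge0_cp ?ler0n.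
have hy n x : `|y x - h n x| <= `|y x|.
  rewrite /h; have n0 : (0 : R) <= n%:R by [].
  have [a|a] := leP (y x) n%:R.
    have [b|b] := leP (y x) (- n%:R); last by rewrite subrr normr0.
    by rewrite !ler0_norm; lra.
  have [b|b] := leP (n%:R : R) (- n%:R); by rewrite !ger0_norm; lra.
have hc x : (fun n => h n x) @ \oo --> y x.
  apply: cvg_near_cst; near=> n.
  have yn : `|y x| <= n%:R by near: n; exact: nbhs_infty_ger.
  by move: yn; rewrite ler_norml => /andP[a b]; rewrite /h (min_idPl b) (max_idPl a).
have fE x : f x = y x * gauss0 x by rewrite /y divfK// gt_eqF// gauss0_gt0.
have sq n x : cabs2 ((f x)%:C - (h n x * gauss0 x)%:C) = ((y x - h n x) * gauss0 x) ^+ 2.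
  by rewrite -rmorphB/= cabs2_real {1}fE -mulrBl.
have [||||||n Hn] := @dct_small R _ _ lebR (fun n x => ((y x - h n x) * gauss0 x) ^+ 2)
    (fun x => f x ^+ 2) eps.
- move=> n; apply: measurable_funX; apply: measurable_funM => //.
  exact: (measurable_funB my (mh n)).
- by move=> n x; exact: sqr_ge0.
- move=> x.
  have H : (fun n => (y x - h n x) * gauss0 x) @ \oo --> (0 : R).
    rewrite -(mul0r (gauss0 x)) -(subrr (y x)); apply: cvgM; last exact: cvg_cst.
    by apply: cvgB; [exact: cvg_cst|exact: hc].
  by rewrite -(mulr0 (0 : R)); under eq_fun do rewrite expr2; exact: cvgM.
- exact: fi.
- move=> n x; rewrite [in leRHS]fE [leLHS]exprMn [leRHS]exprMn ler_wpM2r ?sqr_ge0//.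
  rewrite -[(y x - _) ^+ 2]real_normK ?num_real// -[y x ^+ 2]real_normK ?num_real//.
  by rewrite lerXn2r ?nnegrE ?normr_ge0.
- exact: e0.
exists (fun x => (h n x * gauss0 x)%:C).
  by have [] := Bcl_bounded (mh n) (hn n).
by rewrite /dist2; under eq_integral do rewrite sq.
Unshelve. all: by end_near. Qed.

Lemma Vsum_dense (f : R -> R[i]) (eps : R) : L2line f -> 0 < eps ->
  exists u : Vlist, (sch_dist2 f (Vsum u) < eps%:E)%E.
Proof.
move=> [mr [mi fin]] e0.
have fi : lebR.-integrable setT (EFin \o (fun x => cabs2 (f x))).
  apply: ge0_integrable => //; last by move=> x; exact: cabs2_ge0.
  by apply: (measurable_cabs2 (F := f)); split.
have cr : clT (fun x => (reC (f x))%:C).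
  apply: clT_real => //; apply: (integrable_dominated _ fi); first exact: measurable_funX.
  by move=> x; rewrite ger0_norm ?sqr_ge0// lerDl sqr_ge0.
have ci : clT (fun x => (imC (f x))%:C).
  apply: clT_real => //; apply: (integrable_dominated _ fi); first exact: measurable_funX.
  by move=> x; rewrite ger0_norm ?sqr_ge0// lerDr sqr_ge0.
have [_ cf] := clTD cr (clTZ 'i ci).
have sp0 : 0 < Num.sqrt pi :> R by rewrite sqrtr_gt0 pi_gt0.
have [w fw] := cf _ (divr_gt0 e0 sp0).
exists [seq (k.1, (k.2, 0)) | k <- w]; rewrite /sch_dist2.
have -> : eps%:E = ((Num.sqrt pi)%:E * (eps / Num.sqrt pi)%:E)%E.
  by rewrite -EFinM; congr (_%:E); rewrite mulrCA divff ?mulr1// gt_eqF.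
rewrite lte_pmul2l//; move: fw; rewrite /dist2; congr (_ < _)%E.
apply: eq_integral => x _; congr (cabs2 (_ - _))%:E.
  by apply: ceqP; rewrite !reimE; ring.
by rewrite /Tsum /Vsum big_map.
Qed.

End LineDensity.

(** * A weighted Cauchy-Schwarz inequality *)

Section WeightedCauchySchwarz.
Context {R : realType} {d} {T : measurableType d} (mu : {measure set T -> \bar R}).

(** The pointwise half of the Schur test, for a kernel of modulus at most [k G]. It rests on
    [sqrt g <= (l g + 1 / l) / 2] for every [l > 0], with [l] chosen at the end. *)
Lemma weighted_cauchy_schwarz (r g G : T -> R) (k : R) : 0 < k ->
  mu.-integrable setT (EFin \o r) -> mu.-integrable setT (EFin \o G) ->
  mu.-integrable setT (EFin \o (fun x => g x * G x)) ->
  (forall x, 0 <= g x) -> (forall x, 0 <= G x) ->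
  (forall x, r x ^+ 2 <= g x * (k * G x) ^+ 2) ->
  (\int[mu]_x r x) ^+ 2 <= k ^+ 2 * (\int[mu]_x G x) * (\int[mu]_x (g x * G x)).
Proof.
move=> k0 ri Gi gGi g0 G0 rb.
set X := \int[mu]_x r x; set L := \int[mu]_x G x; set A := \int[mu]_x (g x * G x).
have A0 : 0 <= A by apply: Rintegral_ge0 => x _; exact: mulr_ge0.
have L0 : 0 <= L by apply: Rintegral_ge0.
have key l : 0 < l -> `|X| <= k / 2 * (l * A + l^-1 * L).
  move=> l0.
  have i1 : mu.-integrable setT (EFin \o (fun x => l * (g x * G x))).
    exact: (integrableZl measurableT l gGi).
  have i2 : mu.-integrable setT (EFin \o (fun x => l^-1 * G x)).
    exact: (integrableZl measurableT l^-1 Gi).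
  have i3 : mu.-integrable setT (EFin \o (fun x => l * (g x * G x) + l^-1 * G x)).
    exact: (integrableD measurableT i1 i2).
  apply: (le_trans (le_normr_Rintegral measurableT ri)).
  have -> : k / 2 * (l * A + l^-1 * L) = \int[mu]_x (k / 2 * (l * (g x * G x) + l^-1 * G x)).
    by rewrite RintegralZl// RintegralD//= !RintegralZl.
  apply: le_Rintegral => //; first exact: integrable_norm.
    exact: (integrableZl measurableT (k / 2) i3).
  move=> x _.
  have lG : 0 <= l * (g x * G x) + l^-1 * G x.
    by rewrite addr_ge0// ?mulr_ge0// ?invr_ge0 ltW.
  rewrite -(@ler_pXn2r _ 2)// ?nnegrE ?normr_ge0 ?mulr_ge0 ?invr_ge0 ?(ltW k0)//.
  rewrite real_normK ?num_real//; apply: (le_trans (rb x)).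
  have -> : g x * (k * G x) ^+ 2 = k ^+ 2 * G x ^+ 2 * ((l * g x) * l^-1).
    by field; rewrite gt_eqF.
  have -> : (k / 2 * (l * (g x * G x) + l^-1 * G x)) ^+ 2 =
     k ^+ 2 * G x ^+ 2 * (((l * g x) + l^-1) ^+ 2 / 4) by field; rewrite gt_eqF.
  apply: (ler_wpM2l (mulr_ge0 (sqr_ge0 _) (sqr_ge0 _))).
  move: (l * g x) (l^-1) => u v; have := sqr_ge0 (u - v); lra.
have [X0|X0] := eqVneq X 0.
  by rewrite [X ^+ 2](_ : _ = 0) ?X0 ?expr0n// !mulr_ge0 ?sqr_ge0// ltW.
have nX : 0 < `|X| by rewrite normr_gt0.
rewrite -[X ^+ 2]real_normK ?num_real//; set Y := `|X| in nX key *.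
apply/ler_addgt0Pr => e e0.
have kL0 : 0 < k ^+ 2 * L + 1 by rewrite ltr_wpDl// mulr_ge0// sqr_ge0.
(* [A] may vanish, so [l = Y / (k A')] is formed with a larger [A']; the surplus costs at most [e]
   in the final bound. *)
pose A' := A + e / (k ^+ 2 * L + 1).
have ee : 0 < e / (k ^+ 2 * L + 1) by rewrite divr_gt0.
have A'0 : 0 < A' by rewrite ltr_wpDl.
have := key (Y / (k * A')) (divr_gt0 nX (mulr_gt0 k0 A'0)).
have -> : k / 2 * (Y / (k * A') * A + (Y / (k * A'))^-1 * L) =
    (Y * (A / A') + k ^+ 2 * A' * L / Y) / 2.
  by field; rewrite !gt_eqF.
have AA : A / A' <= 1 by rewrite ler_pdivrMr// mul1r lerDl ltW.
have YA : Y * (A / A') <= Y by rewrite ler_piMr// ltW.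
move=> H; have H1 : Y <= k ^+ 2 * A' * L / Y by lra.
have H2 : Y ^+ 2 <= k ^+ 2 * A' * L by rewrite expr2 -ler_pdivlMr.
apply: (le_trans H2).
have -> : k ^+ 2 * A' * L = k ^+ 2 * L * A + e * (k ^+ 2 * L / (k ^+ 2 * L + 1)).
  by rewrite /A'; field; rewrite gt_eqF.
rewrite lerD2l ler_piMr ?(ltW e0)// ler_pdivrMr// mul1r lerDl//.
Qed.

End WeightedCauchySchwarz.

(** * Riemann sums on a square *)

Section RiemannSums.
Context {R : realType}.
Variable n : nat.

(* The square [-n, n[ ^ 2 is cut into [gsize N ^ 2] cells of side [1 / N.+1]. *)
Definition grid (N i : nat) : R := - n%:R + i%:R / N.+1%:R.
Definition cell (N i : nat) : set R := `[grid N i, grid N i + N.+1%:R^-1[.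
Definition gsize (N : nat) : nat := (2 * n * N.+1)%N.
Definition gfloor (N : nat) (y : R) : nat := Num.trunc ((y + n%:R) * N.+1%:R).
(** Half-open, so that the cells partition the square exactly. *)
Definition halfbox (Y : R * R) : R :=
  \1_(`[- n%:R, n%:R[ : set R) Y.1 * \1_(`[- n%:R, n%:R[ : set R) Y.2.
Definition rsum (N : nat) (H : R * R -> R) : R :=
  \sum_(i < gsize N) \sum_(j < gsize N) H (grid N i, grid N j) * (N.+1%:R^-1 ^+ 2).

Let N0 (N : nat) : (0 : R) < N.+1%:R. Proof. by rewrite ltr0n. Qed.

Lemma grid_bound N (i : 'I_(gsize N)) : - n%:R <= grid N i < n%:R.
Proof.
rewrite /grid lerDl divr_ge0//=.
have : (i%:R : R) < (gsize N)%:R by rewrite ltr_nat.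
rewrite /gsize !natrM => h.
have : i%:R / N.+1%:R < 2 * n%:R :> R by rewrite ltr_pdivrMr.
by move: (i%:R / _) => q; lra.
Qed.

Lemma mem_cell N i y : - n%:R <= y -> (y \in cell N i) = (gfloor N y == i).
Proof.
move=> ny; have y0 : 0 <= (y + n%:R) * N.+1%:R by rewrite mulr_ge0//; lra.
rewrite /gfloor truncn_eq//; apply/idP/idP.
- rewrite /cell inE /= in_itv/= /grid => /andP[a b]; apply/andP; split.
    by rewrite -ler_pdivrMr//; move: (i%:R / N.+1%:R) a => q a; lra.
  rewrite -ltr_pdivlMr// -[i.+1%:R]natr1 mulrDl mul1r; move: b.
  by move: (N.+1%:R^-1) (i%:R / N.+1%:R) => e q b; lra.
- rewrite -ler_pdivrMr// -ltr_pdivlMr// -[i.+1%:R]natr1 mulrDl mul1r => /andP[a b].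
  rewrite /cell inE /= in_itv/= /grid; move: a b.
  by move: (N.+1%:R^-1) (i%:R / N.+1%:R) => e q a b; apply/andP; split; lra.
Qed.

Lemma gfloor_lt N y : - n%:R <= y < n%:R -> (gfloor N y < gsize N)%N.
Proof.
move=> /andP[a b]; have y0 : 0 <= (y + n%:R) * N.+1%:R by rewrite mulr_ge0//; lra.
have /andP[h _] := truncn_itv y0.
rewrite -(ltr_nat R) (le_lt_trans h)// /gsize !natrM ltr_pM2r//; lra.
Qed.

Lemma gfloor_close N y : - n%:R <= y -> `|y - grid N (gfloor N y)| <= N.+1%:R^-1.
Proof.
move=> ny; have : y \in cell N (gfloor N y) by rewrite mem_cell.
rewrite /cell inE /= in_itv/=.
rewrite ler_norml; have e0 := invr_ge0 (N.+1%:R : R).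
move: e0 (grid _ _); rewrite ler0n; move: (N.+1%:R^-1) => e e0 g /andP[a b]; apply/andP; split; lra.
Qed.

Lemma cell_sum N (F : nat -> R) y : \sum_(i < gsize N) F i * \1_(cell N i) y =
  \1_(`[- n%:R, n%:R[ : set R) y * F (gfloor N y).
Proof.
rewrite [\1_(`[_, _[) y]indicE; have [yb|yb] := boolP (y \in (`[- n%:R, n%:R[ : set R)).
  move: yb; rewrite inE /= in_itv/= => yb; have /andP[ny yn] := yb.
  rewrite mul1r (bigD1 (Ordinal (gfloor_lt N yb)))//= indicE mem_cell// eqxx mulr1.
  rewrite big1 ?addr0// => i ne; rewrite indicE mem_cell//.
  suff -> : (gfloor N y == i) = false by rewrite mulr0.
  by apply: contraNF ne => /eqP e; apply/eqP/val_inj; rewrite /= e.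
rewrite mul0r big1// => i _; rewrite indicE memNset ?mulr0// /cell => /=; rewrite in_itv/= => /andP[a b].
have /andP[c e] := grid_bound i.
move: yb; rewrite notin_setE /= in_itv/=; apply; rewrite (le_trans c a)/=.
have l : (i.+1%:R : R) <= (gsize N)%:R by rewrite ler_nat.
apply: (lt_le_trans b); rewrite /grid -addrA.
have -> : i%:R / N.+1%:R + N.+1%:R^-1 = i.+1%:R / N.+1%:R :> R.
  by rewrite -[i.+1%:R]natr1 mulrDl mul1r.
have : i.+1%:R / N.+1%:R <= 2 * n%:R :> R by rewrite ler_pdivrMr// -!natrM.
by move: (i.+1%:R / _) => q; lra.
Qed.

(** The step function behind [rsum]: on each cell it takes the value of [H] at the lower corner. *)
Definition gstep N (H : R * R -> R) (Y : R * R) : R :=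
  \sum_(i < gsize N) \sum_(j < gsize N) H (grid N i, grid N j)
     * (\1_(cell N i) Y.1 * \1_(cell N j) Y.2).

Lemma gstepE N H Y : gstep N H Y =
  halfbox Y * H (grid N (gfloor N Y.1), grid N (gfloor N Y.2)).
Proof.
rewrite /gstep.
under eq_bigr => i _.
  under eq_bigr => j _ do rewrite mulrA [_ * \1_(cell N i) _]mulrC -mulrA.
  rewrite -mulr_sumr (cell_sum N (fun j => H (grid N i, grid N j))) mulrC.
  over.
rewrite (cell_sum N (fun i => \1_(`[- n%:R, n%:R[) Y.2 * H (grid N i, grid N (gfloor N Y.2)))).
by rewrite mulrA.
Qed.

Lemma cell_integral N i : (@leb R).-integrable setT (EFin \o \1_(cell N i)) /\
  \int[leb]_y \1_(cell N i) y = N.+1%:R^-1.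
Proof.
have i1 : (@leb R).-integrable setT (EFin \o \1_(cell N i)) by exact: integrable_indic_itv.
split=> //; rewrite /Rintegral integral_indic// ?setIT; last exact: measurable_itv.
have e : lebesgue_measure (cell N i) = (N.+1%:R^-1)%:E.
  rewrite /cell lebesgue_measure_itv/= lte_fin ltrDl invr_gt0 N0 -EFinB/=.
  by rewrite addrC addKr.
exact: (congr1 fine e).
Qed.

Lemma gstep_integral N H : (@leb2 R).-integrable setT (EFin \o gstep N H) /\
  \int[leb2]_Y gstep N H Y = rsum N H.
Proof.
have [i0 e0] : (@leb2 R).-integrable setT (EFin \o gstep N H) /\ \int[leb2]_Y gstep N H Y =
   \sum_(k <- [seq (i, j) | i <- index_enum 'I_(gsize N), j <- index_enum 'I_(gsize N)])
     H (grid N k.1, grid N k.2) * (N.+1%:R^-1 ^+ 2).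
  have -> : gstep N H = (fun Y => \sum_(k <- [seq (i, j) | i <- index_enum 'I_(gsize N),
      j <- index_enum 'I_(gsize N)])
     H (grid N k.1, grid N k.2) * (\1_(cell N k.1) Y.1 * \1_(cell N k.2) Y.2)).
    by apply/funext => Y; rewrite /gstep big_allpairs.
  elim: [seq _ | _ <- _, _ <- _] => [|k s [IH1 IH2]].
    have -> : (fun Y : R * R => \sum_(k <- ([::] : seq ('I_(gsize N) * 'I_(gsize N)))) H (grid N k.1, grid N k.2) *
       (\1_(cell N k.1) Y.1 * \1_(cell N k.2) Y.2)) = (fun=> 0).
      by apply/funext => Y; rewrite big_nil.
    by rewrite big_nil Rintegral0; split => //; exact: integrable0.
  have [i1 e1] := cell_integral N k.1; have [i2 e2] := cell_integral N k.2.
  have [i e] := prod_integrable i1 i2.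
  have ik : (@leb2 R).-integrable setT (EFin \o (fun Y => H (grid N k.1, grid N k.2) *
     (\1_(cell N k.1) Y.1 * \1_(cell N k.2) Y.2))).
    exact: (integrableZl measurableT _ i).
  have -> : (fun Y : R * R => \sum_(k <- k :: s) H (grid N k.1, grid N k.2) *
       (\1_(cell N k.1) Y.1 * \1_(cell N k.2) Y.2)) =
     (fun Y => H (grid N k.1, grid N k.2) * (\1_(cell N k.1) Y.1 * \1_(cell N k.2) Y.2) +
       \sum_(k <- s) H (grid N k.1, grid N k.2) * (\1_(cell N k.1) Y.1 * \1_(cell N k.2) Y.2)).
    by apply/funext => Y; rewrite big_cons.
  split; first exact: (integrableD measurableT ik IH1).
  by rewrite big_cons -IH2 RintegralD// RintegralZl// e e1 e2 expr2.
by split=> //; rewrite e0 /rsum big_allpairs.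
Qed.

Lemma halfbox_ge0 Y : 0 <= halfbox Y <= 1.
Proof.
by rewrite /halfbox !indicE; case: (_ \in _); case: (_ \in _);
  rewrite ?mul1r ?mul0r ?mulr0 ?lexx ?ler01.
Qed.

Lemma halfbox_box Y : (`|Y.1| <= n%:R /\ `|Y.2| <= n%:R) \/ halfbox Y = 0.
Proof.
rewrite /halfbox !indicE.
have [a|] := boolP (Y.1 \in _); last by right; rewrite mul0r.
have [b|] := boolP (Y.2 \in _); last by right; rewrite mulr0.
move: a b; rewrite !inE /= !in_itv/= => /andP[a1 a2] /andP[b1 b2].
by left; rewrite !ler_norml a1 b1 !ltW.
Qed.

Lemma measurable_halfbox :
  measurable_fun [set: measurableTypeR R * measurableTypeR R] halfbox.
Proof.
have m1 : measurable_fun [set: measurableTypeR R] (\1_(`[- n%:R, n%:R[ : set R) : R -> R).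
  exact: measurable_indic.
apply: measurable_funM.
  exact: (measurableT_comp m1 measurable_fst).
exact: (measurableT_comp m1 measurable_snd).
Qed.

Lemma gfloor_bound N y : - n%:R <= y < n%:R -> `|grid N (gfloor N y)| <= n%:R.
Proof.
move=> yb; have /andP[a b] := grid_bound (Ordinal (gfloor_lt N yb)).
by rewrite ler_norml a/= ltW.
Qed.

Lemma rsum_bound N H K : 0 <= K ->
  (forall Y, `|Y.1| <= n%:R -> `|Y.2| <= n%:R -> `|H Y| <= K) ->
  `|rsum N H| <= (2 * n%:R) ^+ 2 * K.
Proof.
move=> K0 HK.
have gi (i : 'I_(gsize N)) : `|grid N i| <= n%:R.
  by have /andP[a b] := grid_bound i; rewrite ler_norml a/= ltW.
apply: (@le_trans _ _ (\sum_(i < gsize N) \sum_(j < gsize N) K * (N.+1%:R^-1 ^+ 2))).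
  apply: (le_trans (ler_norm_sum _ _ _)); apply: ler_sum => i _.
  apply: (le_trans (ler_norm_sum _ _ _)); apply: ler_sum => j _.
  rewrite normrM [`|_ ^+ 2|]ger0_norm ?sqr_ge0// ler_wpM2r ?sqr_ge0//.
  by apply: HK => /=.
(* There are [(2 n (N + 1))^2] cells of area [(N + 1)^-2], so the bound does not depend on [N]. *)
have gs : (gsize N)%:R = 2 * n%:R * N.+1%:R :> R by rewrite /gsize !natrM.
rewrite !sumr_const !card_ord -mulrnA -[K * _ *+ _]mulr_natr natrM gs.
have : (N.+1%:R : R) != 0 by rewrite gt_eqF.
rewrite le_eqVlt; move: (N.+1%:R : R) (n%:R : R) => e m ene.
by apply/orP; left; apply/eqP; field.
Qed.

(** The sum is the integral of [gstep N H], which converges pointwise because the corner of the cell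
    of [Y] tends to [Y]; the bound of [H] on the square dominates. *)
Lemma rsum_cvg H : continuous H ->
  (fun N => rsum N H) @ \oo --> \int[leb2]_Y (halfbox Y * H Y).
Proof.
move=> cH; have [K K0 HK] := continuous_bounded_box n%:R cH.
have gd N Y : `|gstep N H Y| <= K * \1_[set z : R * R | `|z.1| <= n%:R /\ `|z.2| <= n%:R] Y.
  rewrite gstepE; have [[b1 b2]|->] := halfbox_box Y; last by rewrite mul0r normr0 mulr_ge0.
  rewrite indicE mem_set// mulr1.
  rewrite /halfbox !indicE.
  have [a|] := boolP (Y.1 \in _); last by rewrite !mul0r normr0.
  have [b|] := boolP (Y.2 \in _); last by rewrite mulr0 mul0r normr0.
  move: a b; rewrite !inE /= !in_itv/= => a b.
  by rewrite !mul1r; apply: HK; exact: gfloor_bound.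
have [] := @Rintegral_dct R _ _ (@leb2 R) (fun N => gstep N H) (fun Y => halfbox Y * H Y)
  (fun Y => K * \1_[set z : R * R | `|z.1| <= n%:R /\ `|z.2| <= n%:R] Y).
- by move=> N; exact: integrable_measurable (gstep_integral N H).1.
- move=> Y.
  have -> : (fun N => gstep N H Y) =
     (fun N => halfbox Y * H (grid N (gfloor N Y.1), grid N (gfloor N Y.2))).
    by apply/funext => N; rewrite gstepE.
  have [hb|hb] := eqVneq (halfbox Y) 0.
    rewrite hb mul0r; have -> : (fun N => 0 * H (grid N (gfloor N Y.1), grid N (gfloor N Y.2)))
       = (fun=> 0) by apply/funext => N; rewrite mul0r.
    exact: cvg_cst.
  have [[b1 b2]|h0] := halfbox_box Y; last by rewrite h0 eqxx in hb.
  apply: cvgM; first exact: cvg_cst.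
  have gc y : `|y| <= n%:R -> (fun N => grid N (gfloor N y)) @ \oo --> y.
    rewrite ler_norml => /andP[ny _]; apply/cvgrPdist_le => e e0.
    near=> N; apply: (le_trans (gfloor_close N ny)).
    apply: ltW; near: N; exact: (near_infty_natSinv_lt (PosNum e0)).
  rewrite [Y]surjective_pairing.
  apply: (cvg_comp _ H (cvg_pair (gc _ b1) (gc _ b2))); exact: cH.
- exact: integrable_box.
- exact: gd.
move=> _; have -> : (fun N => \int[leb2]_Y gstep N H Y) = (fun N => rsum N H).
  by apply/funext => N; rewrite (gstep_integral N H).2.
exact.
Unshelve. all: by end_near. Qed.

End RiemannSums.

(** * Tonelli's theorem for pairs of points of the plane *)

Section PlaneMeasure.
Context {R : realType}.

Lemma leb2_sigma_finite : sigma_finite setT (@leb2 R).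
Proof.
exists (fun n => [set z : R * R | `|z.1| <= n%:R /\ `|z.2| <= n%:R]).
  apply/esym/seteqP; split=> // z _.
  exists (Num.truncn (`|z.1| + `|z.2|)).+1 => //=.
  have h := ltW (truncnS_gt (`|z.1| + `|z.2|)).
  by split; apply: le_trans h; rewrite ?lerDl ?lerDr.
move=> n; split; first exact: measurable_box.
by rewrite leb2_box// ltry.
Qed.

(* The sigma-finiteness instance of [m1 \x m2] is shadowed by the one for subprobability
   measures, hence this alias with its own instance. *)
Definition plane_measure : set (measurableTypeR R * measurableTypeR R) -> \bar R := @leb2 R.
HB.instance Definition _ := Measure.copy plane_measure (@leb2 R).
HB.instance Definition _ := Measure_isSigmaFinite.Build _ _ _ plane_measure leb2_sigma_finite.

Lemma leb2_fubini_tonelli (f : (measurableTypeR R * measurableTypeR R) *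
    (measurableTypeR R * measurableTypeR R) -> \bar R) :
  measurable_fun setT f -> (forall w, 0 <= f w)%E ->
  (\int[leb2]_x \int[leb2]_y f (x, y) = \int[leb2]_y \int[leb2]_x f (x, y))%E.
Proof. exact: (@fubini_tonelli _ _ _ _ R plane_measure plane_measure f). Qed.

End PlaneMeasure.

(** * The kernel of the reproducing formula and its Schur bound *)

Section KernelDensity.
Context {R : realType}.
Variables (c d : R).
Hypotheses (c0 : 0 < c) (d0 : 0 < d).

Let a : R := d / (2 * (c + d)).
Let b : R := c / (2 * (c + d)).
Let cd0 : 0 < c + d. Proof. by rewrite addr_gt0. Qed.
Let a0 : 0 < a. Proof. by rewrite divr_gt0// mulr_gt0. Qed.
Let b0 : 0 < b. Proof. by rewrite divr_gt0// mulr_gt0. Qed.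
Let k : R := (Num.sqrt (pi * (c + d)))^-1.
Let k0 : 0 < k. Proof. by rewrite invr_gt0 sqrtr_gt0 mulr_gt0// pi_gt0. Qed.

(** Labels are ordered [Y = (Q, P)], so that labels and points are both pairs of position and
    momentum. *)
Definition sq_kernel (Y z : R * R) : R[i] := sq_state c d Y.2 Y.1 z.1 z.2.
Let S := sq_kernel.

(** The modulus of [sq_kernel], up to the constant [k]. *)
Definition gauss_kernel (z Y : R * R) : R :=
  expR (- (b * (z.1 - Y.1) ^+ 2 + a * (z.2 - Y.2) ^+ 2)).
Let G := gauss_kernel.

Lemma gauss_kernelC z Y : G z Y = G Y z.
Proof. by rewrite /G /gauss_kernel -[z.1 - _]opprB -[z.2 - _]opprB !sqrrN. Qed.

Lemma sq_kernel_abs2 Y z : cabs2 (S Y z) = (k * G z Y) ^+ 2.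
Proof.
rewrite /S /sq_kernel sq_state_abs2// exprMn -/a -/b; congr (_ * _).
  by rewrite /k exprVn sqr_sqrtr// mulr_ge0 ?pi_ge0// ltW.
by rewrite /G /gauss_kernel [RHS]expr2 -expRD; congr expR; ring.
Qed.

Lemma sq_kernel_elemf (z : R * R) : elemf (fun Q P => S (Q, P) z).
Proof.
have ex : elemf (fun Q _ => (z.1)%:C + (- 1)%:C * Q%:C).
  by apply: elemf_add; [exact: elemf_cst|apply: elemf_mul; [exact: elemf_cst|exact: elemf_x]].
have ep : elemf (fun _ P => (z.2)%:C + (- 1)%:C * P%:C).
  by apply: elemf_add; [exact: elemf_cst|apply: elemf_mul; [exact: elemf_cst|exact: elemf_p]].
have -> : (fun Q P => S (Q, P) z) = (fun Q P => k%:C * cexp (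
   (- a)%:C * (((z.2)%:C + (- 1)%:C * P%:C) * ((z.2)%:C + (- 1)%:C * P%:C))
  + (- b)%:C * (((z.1)%:C + (- 1)%:C * Q%:C) * ((z.1)%:C + (- 1)%:C * Q%:C))
  + (- 'i) * (P%:C * ((z.1)%:C + (- 1)%:C * Q%:C))
  + (- ((2 * a)%:C * 'i)) * (((z.1)%:C + (- 1)%:C * Q%:C) * ((z.2)%:C + (- 1)%:C * P%:C)))).
  apply/funext => Q; apply/funext => P; rewrite /S /sq_kernel /sq_state; congr (_ * cexp _).
  by apply: ceqP; rewrite !reimE /sq_exponent/= -/a -/b; ring.
apply: (elemf_mul (elemf_cst _)); apply: elemf_exp.
apply: elemf_add; last by apply: (elemf_mul (elemf_cst _)); exact: elemf_mul.
apply: elemf_add; last first.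
  by apply: (elemf_mul (elemf_cst _)); apply: elemf_mul => //; exact: elemf_p.
by apply: elemf_add; apply: (elemf_mul (elemf_cst _)); exact: elemf_mul.
Qed.

Lemma gauss_kernel_integral z : (@leb2 R).-integrable setT (EFin \o (fun Y => G z Y)) /\
  \int[leb2]_Y G z Y = pi / Num.sqrt (b * a).
Proof.
have := gauss_plane z.1 z.2 b0 a0.
have -> : (fun Y => G z Y) = (fun Y : R * R => expR (- (b * (Y.1 - z.1) ^+ 2 + a * (Y.2 - z.2) ^+ 2))).
  by apply/funext => Y; rewrite gauss_kernelC.
by [].
Qed.

Lemma gauss_kernel_measurable :
  measurable_fun [set: (measurableTypeR R * measurableTypeR R) * (measurableTypeR R * measurableTypeR R)]
    (fun w => G w.1 w.2).
Proof.
apply: (measurableT_comp (@measurable_expR R)).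
apply: measurable_funN; apply: measurable_funD; apply: measurable_funM => //;
  apply: measurable_funX; apply: measurable_funB.
- exact: (measurableT_comp measurable_fst measurable_fst).
- exact: (measurableT_comp measurable_fst measurable_snd).
- exact: (measurableT_comp measurable_snd measurable_fst).
- exact: (measurableT_comp measurable_snd measurable_snd).
Qed.

Lemma gauss_kernel_measurable_integral (g : R * R -> R) : (forall Y, 0 <= g Y) ->
  measurable_fun [set: measurableTypeR R * measurableTypeR R] g ->
  measurable_fun [set: measurableTypeR R * measurableTypeR R]
    (fun z => \int[leb2]_Y (g Y * G z Y)%:E)%E.
Proof.
move=> g0 mg.
have m : measurable_fun [set: (measurableTypeR R * measurableTypeR R) * (measurableTypeR R * measurableTypeR R)]
    (fun w => (g w.2 * G w.1 w.2)%:E).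
  apply/measurable_EFinP; apply: measurable_funM; last exact: gauss_kernel_measurable.
  exact: (measurableT_comp mg measurable_snd).
have p0 (w : (R * R) * (R * R)) : (0 <= (g w.2 * G w.1 w.2)%:E)%E.
  by rewrite lee_fin mulr_ge0// expR_ge0.
exact: (@measurable_fun_fubini_tonelli_F _ _ _ _ R plane_measure _ m p0).
Qed.

(** After the integrals are exchanged, the Gaussian integrates over [z] to the same constant for
    every [Y]. *)
Lemma gauss_kernel_schur (g : R * R -> R) : (forall Y, 0 <= g Y) ->
  (@leb2 R).-integrable setT (EFin \o g) ->
  (\int[leb2]_z \int[leb2]_Y (g Y * G z Y)%:E = (pi / Num.sqrt (b * a))%:E * \int[leb2]_Y (g Y)%:E)%E.
Proof.
move=> g0 gi; have mg := integrable_measurable gi.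
have m : measurable_fun [set: (measurableTypeR R * measurableTypeR R) * (measurableTypeR R * measurableTypeR R)]
    (fun w => (g w.2 * G w.1 w.2)%:E).
  apply/measurable_EFinP; apply: measurable_funM; last exact: gauss_kernel_measurable.
  exact: (measurableT_comp mg measurable_snd).
have p0 (w : (R * R) * (R * R)) : (0 <= (g w.2 * G w.1 w.2)%:E)%E.
  by rewrite lee_fin mulr_ge0// expR_ge0.
have -> : (\int[leb2]_z \int[leb2]_Y (g Y * G z Y)%:E = \int[leb2]_Y \int[leb2]_z (g Y * G z Y)%:E)%E.
  exact: (leb2_fubini_tonelli m p0).
have Li z : (@leb2 R).-integrable setT (EFin \o (fun Y => G Y z)).
  have [i _] := gauss_kernel_integral z.
  by have -> : (fun Y => G Y z) = (fun Y => G z Y) by apply/funext => Y; rewrite gauss_kernelC.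
have E Y : (\int[leb2]_z (g Y * G z Y)%:E = (pi / Num.sqrt (b * a))%:E * (g Y)%:E)%E.
  under eq_integral do rewrite EFinM.
  rewrite ge0_integralZl_EFin//; last 2 first.
  - by move=> z _; rewrite lee_fin expR_ge0.
  - by apply/measurable_EFinP; exact: integrable_measurable (Li Y).
  rewrite (EFin_Rintegral (Li Y)) muleC; congr (_%:E * _)%E.
  by rewrite -(gauss_kernel_integral Y).2; apply: eq_Rintegral => z _; rewrite gauss_kernelC.
under eq_integral do rewrite E.
rewrite ge0_integralZl_EFin//.
- by move=> Y _; rewrite lee_fin.
- exact/measurable_EFinP.
- by rewrite divr_ge0 ?pi_ge0// sqrtr_ge0.
Qed.

End KernelDensity.

(** * Approximation of a reproduced function by finite sums of kernels *)

Section ReproducingDensity.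
Context {R : realType}.
Variables (c d : R).
Hypotheses (c0 : 0 < c) (d0 : 0 < d).
Variables (psi : R -> R -> R[i]) (K0 : R).
Hypothesis psi_cont : continuous (fun z : R * R => reC (psi z.1 z.2)) /\
  continuous (fun z : R * R => imC (psi z.1 z.2)).
Hypothesis psi2 : (@leb2 R).-integrable setT (EFin \o (fun z => cabs2 (psi z.1 z.2))).
Let S := @sq_kernel R c d.
Hypothesis repr : forall z, cIable (@leb2 R) (fun Y => psi Y.1 Y.2 * S Y z) /\
  cInt (@leb2 R) (fun Y => psi Y.1 Y.2 * S Y z) = K0%:C * psi z.1 z.2.

Let a : R := d / (2 * (c + d)).
Let b : R := c / (2 * (c + d)).
Let cd0 : 0 < c + d. Proof. by rewrite addr_gt0. Qed.
Let a0 : 0 < a. Proof. by rewrite divr_gt0// mulr_gt0. Qed.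
Let b0 : 0 < b. Proof. by rewrite divr_gt0// mulr_gt0. Qed.
Let k : R := (Num.sqrt (pi * (c + d)))^-1.
Let k0 : 0 < k. Proof. by rewrite invr_gt0 sqrtr_gt0 mulr_gt0// pi_gt0. Qed.
Let G := @gauss_kernel R c d.
Let G0 z Y : 0 < G z Y. Proof. exact: expR_gt0. Qed.
Let L : R := pi / Num.sqrt (b * a).
Let L0 : 0 < L. Proof. by rewrite divr_gt0 ?pi_gt0// sqrtr_gt0 mulr_gt0. Qed.

(** Lets each estimate be proved once for the real and the imaginary part. *)
Definition cpart (f : R[i] -> R) := f = @reC R \/ f = @imC R.

Lemma cpartD f z w : cpart f -> f (z + w) = f z + f w.
Proof. by case=> ->; [exact: reCD|exact: imCD]. Qed.

Lemma cpartZ f x z : cpart f -> f (x%:C * z) = x * f z.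
Proof. by case=> ->; rewrite !reimE; ring. Qed.

Lemma cpart_le f z : cpart f -> `|f z| ^+ 2 <= cabs2 z.
Proof. by case=> ->; [exact: normr_reC_le|exact: normr_imC_le]. Qed.

Lemma cpart_sum f (I : Type) (s : seq I) (F : I -> R[i]) : cpart f ->
  f (\sum_(i <- s) F i) = \sum_(i <- s) f (F i).
Proof.
move=> cf; elim: s => [|i s IH]; last by rewrite !big_cons cpartD// IH.
by rewrite !big_nil; case: cf => ->.
Qed.

Lemma cpart_cInt f F : cpart f -> f (cInt (@leb2 R) F) = \int[leb2]_Y f (F Y).
Proof. by case=> ->. Qed.

Lemma cpart_cIable f F : cpart f -> cIable (@leb2 R) F ->
  (@leb2 R).-integrable setT (EFin \o (fun Y => f (F Y))).
Proof. by case=> -> []. Qed.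

Let T2 := (measurableTypeR R * measurableTypeR R)%type.

Lemma integrand_cont f z : cpart f -> continuous (fun Y : R * R => f (psi Y.1 Y.2 * S Y z)).
Proof.
have [cr ci] := psi_cont; have [sr si] := elemf_continuous (sq_kernel_elemf c d z).
case=> ->.
  under eq_fun do rewrite reCM; apply: contB; apply: contM => //.
under eq_fun do rewrite imCM; apply: contD; apply: contM => //.
Qed.

Definition cutoff n (z : R * R) : R[i] :=
  cInt (@leb2 R) (fun Y => (halfbox n Y)%:C * (psi Y.1 Y.2 * S Y z)).

Definition csum n N (z : R * R) : R[i] :=
  \sum_(i < gsize n N) \sum_(j < gsize n N)
    (N.+1%:R^-1 ^+ 2)%:C * (psi (grid n N i) (grid n N j) * S (grid n N i, grid n N j) z).

Lemma csum_part f n N z : cpart f ->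
  f (csum n N z) = rsum n N (fun Y => f (psi Y.1 Y.2 * S Y z)).
Proof.
move=> cf; rewrite /csum cpart_sum//; apply: eq_bigr => i _.
by rewrite cpart_sum//; apply: eq_bigr => j _; rewrite cpartZ// mulrC.
Qed.

Lemma cutoff_part f n z : cpart f ->
  f (cutoff n z) = \int[leb2]_Y (halfbox n Y * f (psi Y.1 Y.2 * S Y z)).
Proof. by move=> cf; rewrite cpart_cInt//; apply: eq_Rintegral => Y _; rewrite cpartZ. Qed.

Lemma csum_cvg f n z : cpart f -> (fun N => f (csum n N z)) @ \oo --> f (cutoff n z).
Proof.
move=> cf; rewrite cutoff_part//; under eq_fun do rewrite csum_part//.
by apply: rsum_cvg; exact: integrand_cont.
Qed.

Lemma mC_kernel Y : @mC R _ T2 (S Y).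
Proof.
have [sr si] := elemf_continuous (sq_state_elemf c d Y.2 Y.1).
by split; apply: continuous2_measurable.
Qed.

Lemma mC_csum n N : @mC R _ T2 (csum n N).
Proof.
apply: mC_sum => i; apply: mC_sum => j; apply: mCM; first exact: mC_cst.
by apply: mCM; [exact: mC_cst|exact: mC_kernel].
Qed.

(** Measurability in the parameter [z] comes from the Riemann sums, of which the integral is the
    pointwise limit. *)
Lemma mC_cutoff n : @mC R _ T2 (cutoff n).
Proof.
split.
  apply: (measurable_fun_cvg (fun N => (mC_csum n N).1)) => z _.
  by apply: csum_cvg; left.
apply: (measurable_fun_cvg (fun N => (mC_csum n N).2)) => z _.
by apply: csum_cvg; right.
Qed.

Lemma mC_psi : @mC R _ T2 (fun z => psi z.1 z.2).
Proof. by have [cr ci] := psi_cont; split; apply: continuous2_measurable. Qed.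

Let h (z : R * R) := expR (- (2^-1 * (b * z.1 ^+ 2 + a * z.2 ^+ 2))).

(** For [|y| <= n] one has [(w - y)^2 >= w^2 / 2 - n^2], because [(w - 2 y)^2 >= 0]. So a single
    wider Gaussian [h] dominates the kernel for all labels in the square. *)
Lemma integrand_bound n : exists2 C, 0 <= C & forall f z Y, cpart f ->
  `|Y.1| <= n%:R -> `|Y.2| <= n%:R -> `|f (psi Y.1 Y.2 * S Y z)| <= C * h z.
Proof.
have [cr ci] := psi_cont.
have c2 : continuous (fun z : R * R => cabs2 (psi z.1 z.2)) by apply: contD; exact: contX2.
have [M M0 HM] := continuous_bounded_box n%:R c2.
(* [M] bounds [|psi|^2] on the square, so [M + 1] bounds [|psi|], as [M <= (M + 1)^2]. *)
exists ((M + 1) * (k * expR ((a + b) * n%:R ^+ 2))).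
  by rewrite !mulr_ge0 ?expR_ge0 ?addr_ge0// ltW.
move=> f z Y cf Y1 Y2.
have kG : 0 <= k * G z Y by rewrite mulr_ge0// ltW.
have l1 : `|f (psi Y.1 Y.2 * S Y z)| <= (M + 1) * (k * G z Y).
  rewrite -(@ler_pXn2r _ 2)// ?nnegrE ?mulr_ge0 ?addr_ge0// ?(ltW k0) ?(ltW (G0 _ _))//.
  apply: (le_trans (cpart_le _ cf)); rewrite cabs2M sq_kernel_abs2// [leRHS]exprMn.
  apply: ler_wpM2r; first exact: sqr_ge0.
  apply: (le_trans (ler_norm _)); apply: (le_trans (HM _ _ Y1 Y2)).
  by rewrite expr2; nra.
apply: (le_trans l1); rewrite -!mulrA; apply: ler_wpM2l; first exact: addr_ge0.
apply: ler_wpM2l; first exact: ltW.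
rewrite /h -expRD ler_expR.
have sq (y w : R) : `|y| <= n%:R -> w ^+ 2 / 2 - n%:R ^+ 2 <= (w - y) ^+ 2.
  move=> yn; have y2 : y ^+ 2 <= n%:R ^+ 2.
    by rewrite -real_normK ?num_real// lerXn2r ?nnegrE.
  by have := sqr_ge0 (w - 2 * y); move: (n%:R ^+ 2) y2 => m *; nra.
have := ler_wpM2l (ltW b0) (sq _ z.1 Y1); have := ler_wpM2l (ltW a0) (sq _ z.2 Y2).
rewrite -/a -/b; move: (n%:R ^+ 2) a b (z.1 ^+ 2) (z.2 ^+ 2) => m a' b' u v.
by move: ((_ - _) ^+ 2) ((_ - _) ^+ 2) => r s; lra.
Qed.

Lemma cutoff_riemann n eps : 0 < eps ->
  exists N, (dist2 (@leb2 R) (cutoff n) (csum n N) < eps%:E)%E.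
Proof.
move=> e0; have [C C0 HC] := integrand_bound n.
pose D := (2 * n%:R) ^+ 2 * C.
have h0 z : 0 <= h z by exact: expR_ge0.
have bs f N z : cpart f -> `|f (csum n N z)| <= D * h z.
  move=> cf; rewrite csum_part// /D -mulrA; apply: rsum_bound; first exact: mulr_ge0.
  by move=> Y Y1 Y2; exact: HC.
have bc f z : cpart f -> `|f (cutoff n z)| <= D * h z.
  move=> cf; have H : (fun N => `|f (csum n N z)|) @ \oo --> `|f (cutoff n z)|.
    by apply: cvg_norm; exact: csum_cvg.
  rewrite -(cvg_lim _ H)//; apply: limr_le; last by apply: nearW => N; exact: bs.
  by apply/cvg_ex; exists `|f (cutoff n z)|.
(* Each part of the difference is at most [2 D h] in absolute value, so its squared modulus is at
   most [8 D^2 h^2]; the Gaussian written here is [h^2]. *)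
apply: (@dct_small R _ T2 (@leb2 R) (fun N z => cabs2 (cutoff n z - csum n N z))
   (fun z => 8 * D ^+ 2 * expR (- (b * (z.1 - 0) ^+ 2 + a * (z.2 - 0) ^+ 2)))) => //.
- by move=> N; apply: measurable_cabs2; apply: mCB; [exact: mC_cutoff|exact: mC_csum].
- by move=> N z; exact: cabs2_ge0.
- move=> z.
  have H f : cpart f -> (fun N => f (cutoff n z - csum n N z) ^+ 2) @ \oo --> (0 : R).
    move=> cf; have H1 : (fun N => f (cutoff n z) - f (csum n N z)) @ \oo --> (0 : R).
      by rewrite -(subrr (f (cutoff n z))); apply: cvgB; [exact: cvg_cst|exact: csum_cvg].
    have -> : (fun N => f (cutoff n z - csum n N z) ^+ 2) =
       (fun N => (f (cutoff n z) - f (csum n N z)) * (f (cutoff n z) - f (csum n N z))).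
      apply/funext => N; rewrite expr2 cpartD//.
      by rewrite (_ : f (- csum n N z) = - f (csum n N z)); last by case: cf => ->; rewrite !reimE.
    by rewrite -(mulr0 (0 : R)); exact: cvgM.
  by rewrite -(addr0 (0 : R)); apply: cvgD; apply: H; [left|right].
- have [i _] := gauss_plane 0 0 b0 a0.
  exact: (integrableZl measurableT _ i).
- move=> N z.
  have hh : h z ^+ 2 = expR (- (b * (z.1 - 0) ^+ 2 + a * (z.2 - 0) ^+ 2)).
    by rewrite /h [LHS]expr2 -expRD; congr expR; field.
  rewrite -hh.
  have l f : cpart f -> f (cutoff n z - csum n N z) ^+ 2 <= (2 * (D * h z)) ^+ 2.
    move=> cf; rewrite -real_normK ?num_real// lerXn2r ?nnegrE// ?mulr_ge0// ?sqr_ge0//.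
    rewrite cpartD// (le_trans (ler_normD _ _))//.
    rewrite (_ : f (- csum n N z) = - f (csum n N z)); last by case: cf => ->; rewrite !reimE.
    by rewrite normrN mulr_natl mulr2n lerD ?bc ?bs.
  have := l _ (or_introl erefl : cpart (@reC R)); have := l _ (or_intror erefl : cpart (@imC R)).
  by rewrite /cabs2; move: (reC _ ^+ 2) (imC _ ^+ 2) => u v; rewrite !exprMn; lra.
Qed.

(** The error at [z] is the integral over the labels outside the square. Weighted Cauchy-Schwarz
    bounds the square of each part by [k^2 L] times the Gaussian average of the tail of [|psi|^2];
    the factor 2 adds the two parts, and the Schur bound contributes the second [L]. *)
Lemma cutoff_tail n :
  (dist2 (@leb2 R) (fun z => K0%:C * psi z.1 z.2)%R (cutoff n) <=
   (2 * (k ^+ 2 * L) * L)%R%:E * \int[leb2]_Y ((1 - halfbox n Y) * cabs2 (psi Y.1 Y.2))%:E)%E.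
Proof.
pose g (Y : R * R) : R := (1 - halfbox n Y) * cabs2 (psi Y.1 Y.2).
rewrite -[X in (_ <= _ * X)%E]/(\int[leb2]_Y (g Y)%:E)%E.
have hb (Y : R * R) := halfbox_ge0 n Y.
have g0 Y : 0 <= g Y by rewrite mulr_ge0 ?cabs2_ge0// subr_ge0; case/andP: (hb Y).
have mhb := @measurable_halfbox R n.
have m2 := integrable_measurable psi2.
have mq : measurable_fun [set: T2] (fun Y => 1 - halfbox n Y) by apply: measurable_funB.
have mg : measurable_fun [set: T2] g by apply: measurable_funM.
have gi : (@leb2 R).-integrable setT (EFin \o g).
  apply: (integrable_dominated mg psi2) => Y; rewrite ger0_norm// ler_piMl ?cabs2_ge0//.
  by rewrite gerBl; case/andP: (hb Y).
have [Gi GL] : (forall z, (@leb2 R).-integrable setT (EFin \o (fun Y => G z Y))) /\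
    (forall z, \int[leb2]_Y G z Y = L).
  by split=> z; have [] := gauss_kernel_integral c0 d0 z.
have gGi z : (@leb2 R).-integrable setT (EFin \o (fun Y => g Y * G z Y)).
  apply: (integrable_dominated _ gi) => [|Y].
    by apply: measurable_funM => //; exact: integrable_measurable (Gi z).
  rewrite ger0_norm; last by rewrite mulr_ge0// ltW.
  apply: ler_piMr => //.
  rewrite /G /gauss_kernel -[leRHS]expR0 ler_expR oppr_le0.
  by rewrite addr_ge0// mulr_ge0 ?sqr_ge0// ltW.
have key f z : cpart f ->
    f (K0%:C * psi z.1 z.2 - cutoff n z) ^+ 2 <= k ^+ 2 * L * \int[leb2]_Y (g Y * G z Y).
  move=> cf; have [fi fe] := repr z; have i1 := cpart_cIable cf fi.
  have i2 : (@leb2 R).-integrable setT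
      (EFin \o (fun Y => halfbox n Y * f (psi Y.1 Y.2 * S Y z))).
    apply: (integrable_dominated _ (integrable_norm i1)) => [|Y].
      by apply: measurable_funM => //; exact: integrable_measurable i1.
    rewrite normrM ler_piMl// ger0_norm; by case/andP: (hb Y).
  have ri : (@leb2 R).-integrable setT
      (EFin \o (fun Y => (1 - halfbox n Y) * f (psi Y.1 Y.2 * S Y z))).
    have -> : (fun Y => (1 - halfbox n Y) * f (psi Y.1 Y.2 * S Y z)) =
       (fun Y => f (psi Y.1 Y.2 * S Y z) - halfbox n Y * f (psi Y.1 Y.2 * S Y z)).
      by apply/funext => Y; rewrite mulrBl mul1r.
    exact: (integrableB measurableT i1 i2).
  have -> : f (K0%:C * psi z.1 z.2 - cutoff n z) =
      \int[leb2]_Y ((1 - halfbox n Y) * f (psi Y.1 Y.2 * S Y z)).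
    rewrite -fe cpartD// (_ : f (- cutoff n z) = - f (cutoff n z)); last first.
      by case: cf => ->; rewrite !reimE.
    rewrite cpart_cInt// cutoff_part// -RintegralB//.
    by apply: eq_Rintegral => Y _; rewrite mulrBl mul1r.
  rewrite -(GL z); apply: weighted_cauchy_schwarz => //; first by move=> Y; exact: ltW.
  move=> Y; have -> : g Y * (k * G z Y) ^+ 2 = (1 - halfbox n Y) * cabs2 (psi Y.1 Y.2 * S Y z).
    by rewrite cabs2M sq_kernel_abs2// [RHS]mulrA.
  (* With [q = 1 - halfbox n Y] in [[0, 1]], the square [q^2] is at most [q]. *)
  rewrite exprMn.
  have /andP[q0 q1] : 0 <= 1 - halfbox n Y <= 1.
    by have /andP[u v] := hb Y; rewrite subr_ge0 v gerBl u.
  apply: ler_pM; rewrite ?sqr_ge0//; first by rewrite expr2 ler_piMl.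
  by have := cpart_le (psi Y.1 Y.2 * S Y z) cf; rewrite real_normK ?num_real.
have kL0 : 0 <= 2 * (k ^+ 2 * L).
  exact: (ltW (mulr_gt0 (ltr0n R 2) (mulr_gt0 (exprn_gt0 2 k0) L0))).
have kE z : ((cabs2 (K0%:C * psi z.1 z.2 - cutoff n z)%R)%:E
    <= (2 * (k ^+ 2 * L))%R%:E * \int[leb2]_Y (g Y * G z Y)%:E)%E.
  rewrite (EFin_Rintegral (gGi z)) -EFinM lee_fin.
  have := key _ z (or_introl erefl : cpart (@reC R)).
  have := key _ z (or_intror erefl : cpart (@imC R)).
  rewrite /cabs2 -(mulrA 2); move: (reC _ ^+ 2) (imC _ ^+ 2) => u v; lra.
have mI := @gauss_kernel_measurable_integral R c d g g0 mg.
apply: (@le_trans _ _ (\int[leb2]_z ((2 * (k ^+ 2 * L))%R%:E * \int[leb2]_Y (g Y * G z Y)%:E)))%E.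
  apply: ge0_le_integral => //.
  - by move=> z _; rewrite lee_fin cabs2_ge0.
  - apply/measurable_EFinP; apply: measurable_cabs2; apply: mCB; last exact: mC_cutoff.
    by apply: mCM; [exact: mC_cst|exact: mC_psi].
  - exact: measurable_funeM.
rewrite ge0_integralZl_EFin//; last first.
  by move=> z _; apply: integral_ge0 => Y _; rewrite lee_fin mulr_ge0// ltW.
by rewrite gauss_kernel_schur// -/a -/b -/L muleA EFinM.
Qed.

Lemma cutoff_cvg eps : 0 < eps ->
  exists n, (dist2 (@leb2 R) (fun z => K0%:C * psi z.1 z.2)%R (cutoff n) < eps%:E)%E.
Proof.
move=> e0; set A := 2 * (k ^+ 2 * L) * L.
have A0 : 0 < A by exact: (mulr_gt0 (mulr_gt0 (ltr0n R 2) (mulr_gt0 (exprn_gt0 2 k0) L0)) L0).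
have [||||||n Hn] := @dct_small R _ T2 (@leb2 R)
    (fun n Y => (1 - halfbox n Y) * cabs2 (psi Y.1 Y.2)) (fun Y => cabs2 (psi Y.1 Y.2)) (eps / A).
- move=> n; apply: measurable_funM; last exact: integrable_measurable psi2.
  by apply: measurable_funB => //; exact: measurable_halfbox.
- move=> n Y; rewrite mulr_ge0 ?cabs2_ge0// subr_ge0.
  by case/andP: (halfbox_ge0 n Y).
- move=> Y; apply/cvgrPdist_lt => e e00.
  exists (Num.truncn (`|Y.1| + `|Y.2|)).+1 => // n /= Mn.
  have h1 : `|Y.1| + `|Y.2| < n%:R.
    by apply: (lt_le_trans (truncnS_gt _)); rewrite ler_nat.
  have in1 y : `|y| < n%:R -> (\1_(`[- n%:R, n%:R[ : set R) y : R) = 1.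
    by rewrite ltr_norml => /andP[l u]; rewrite indicE mem_set//= in_itv/= u ltW.
  rewrite /halfbox !in1 ?mulr1 ?subrr ?mul0r ?subrr ?normr0//;
    by apply: le_lt_trans h1; rewrite ?lerDl ?lerDr.
- exact: psi2.
- move=> n Y; rewrite ler_piMl ?cabs2_ge0// gerBl.
  by case/andP: (halfbox_ge0 n Y).
- exact: divr_gt0.
exists n; apply: (le_lt_trans (cutoff_tail n)); rewrite -/A.
have -> : eps%:E = (A%:E * (eps / A)%:E)%E by rewrite -EFinM; congr (_%:E); field; rewrite gt_eqF.
by rewrite lte_pmul2l.
Qed.

Lemma kernel_sums_dense eps : 0 < eps -> exists u : seq (R[i] * (R * R)),
  (dist2 (@leb2 R) (fun z => K0%:C * psi z.1 z.2)%R
    (fun z => \sum_(l <- u) l.1 * sq_state c d l.2.1 l.2.2 z.1 z.2)%R < eps%:E)%E.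
Proof.
move=> e0; have e4 : 0 < eps / 4 by rewrite divr_gt0.
have [n Hn] := cutoff_cvg e4; have [N HN] := cutoff_riemann n e4.
(* Labels in a [Vlist] are pairs [(P, Q)], hence the order [j], [i] of the grid points. *)
exists [seq ((N.+1%:R^-1 ^+ 2)%:C * psi (grid n N i) (grid n N j), (grid n N j, grid n N i))
   | i : 'I_(gsize n N) <- index_enum 'I_(gsize n N), j : 'I_(gsize n N) <- index_enum 'I_(gsize n N)].
set F := (fun z => \sum_(l <- _) _).
have FE : F = csum n N.
  apply/funext => z; rewrite /F big_allpairs_dep /csum; apply: eq_bigr => i _.
  by apply: eq_bigr => j _; rewrite -mulrA.
rewrite FE.
have mp : @mC R _ T2 (fun z => K0%:C * psi z.1 z.2)%R by apply: mCM; [exact: mC_cst|exact: mC_psi].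
apply: (le_lt_trans (dist2_add (@leb2 R) mp (mC_csum n N) mp (mC_cutoff n) (mC_cutoff n) (mC_csum n N) _)).
  by move=> x; rewrite addrA subrK.
have -> : eps%:E = (2%:E * (eps / 4)%:E + 2%:E * (eps / 4)%:E)%E.
  by rewrite -!EFinM -EFinD; congr (_%:E); field.
by apply: lteD; rewrite lte_pmul2l.
Qed.

End ReproducingDensity.

(** * Density of the image of the transform *)

Section PlaneDensity.
Context {R : realType}.
Variables (alpha t theta : R).
Hypotheses (alpha_gt0 : 0 < alpha) (t_gt0 : 0 < t) (t_lt : t < pi / (2%:R * alpha))
  (theta_gt0 : 0 < theta) (theta_lt : theta < pi / 2%:R) (tan_theta : tan theta = alpha).

Let c := cos (alpha * t).
Let d := sin (alpha * t) / alpha.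
Let c0 : 0 < c. Proof. exact: (cos_at_gt0 alpha_gt0 t_gt0 t_lt). Qed.
Let d0 : 0 < d. Proof. by rewrite divr_gt0//; exact: (sin_at_gt0 alpha_gt0 t_gt0 t_lt). Qed.

Lemma KSH_dense psi : in_HP alpha t psi -> forall eps : R, 0 < eps ->
  exists u : Vlist, (HP_dist2 alpha t psi (KSH alpha t u) < eps%:E)%E.
Proof.
(* The constant of the reproducing formula. The kernel sums approximate [K * psi], so their
   coefficients are divided by [K], and the tolerance absorbs [K^-2] and the half-form weight. *)
move=> H eps e0; pose K := 2 * pi / Num.sqrt (pi * (c + d)).
have K0 : 0 < K.
  by rewrite divr_gt0 ?mulr_gt0 ?pi_gt0// sqrtr_gt0 mulr_gt0 ?pi_gt0// addr_gt0.
pose W := hf_weight alpha t.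
have W0 : 0 < W by rewrite /W hf_weightE// sqrtr_gt0 mulr_gt0.
have KW0 : 0 < K^-1 ^+ 2 * W by rewrite mulr_gt0// exprn_gt0// invr_gt0.
have rep (z : R * R) := KSH_reproducing alpha_gt0 t_gt0 t_lt z.1 z.2 H.
have [u Hu] := kernel_sums_dense c0 d0 (H.1 0%N)
  (in_HP_abs2_integrable alpha_gt0 t_gt0 t_lt H) rep (divr_gt0 e0 KW0).
exists (Vscale (K^-1)%:C u).
have E (z : R * R) : cabs2 (psi z.1 z.2 - KSH alpha t (Vscale (K^-1)%:C u) z.1 z.2) * W =
   K^-1 ^+ 2 * W * cabs2 (K%:C * psi z.1 z.2 -
     \sum_(l <- u) l.1 * sq_state c d l.2.1 l.2.2 z.1 z.2).
  rewrite KSH_scale (KSHE alpha_gt0 t_gt0 t_lt theta_gt0 theta_lt tan_theta).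
  rewrite -/c -/d mulrAC -cabs2_real -cabs2M mulrBr mulrA -rmorphM/= mulVf ?mul1r//.
  by rewrite gt_eqF.
rewrite /HP_dist2; under eq_integral do rewrite -/W E EFinM.
rewrite ge0_integralZl_EFin//.
- have -> : eps%:E = ((K^-1 ^+ 2 * W)%:E * (eps / (K^-1 ^+ 2 * W))%:E)%E.
    by rewrite -EFinM mulrC divfK// gt_eqF.
  by rewrite lte_pmul2l.
- by move=> z _; rewrite lee_fin cabs2_ge0.
- apply/measurable_EFinP; apply: measurable_cabs2; apply: mCB.
    apply: mCM; first exact: mC_cst.
    exact: mC_psi (H.1 0%N).
  apply: mC_sum => l; apply: mCM; first exact: mC_cst.
  exact: (mC_kernel c d (l.2.2, l.2.1)).
- exact: ltW.
Qed.

End PlaneDensity.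

(** In (a) the existence clause expresses that [V] is stable, and quantifying over every list of the
    transformed function makes the transform depend on the function alone. In (b) isometry and the
    two densities, in L^2 and in the space whose completion is [H_{P_tau}], amount to a unitary
    extension by continuity. In (c) the existence of a Gaussian solution ensures that [heat_coef] is
    not a default value. *)
Theorem theorem4p1 (R : realType) (alpha t theta : R) :
  0 < alpha -> 0 < t -> t < pi / (2%:R * alpha) ->
  0 < theta -> theta < pi / 2%:R -> tan theta = alpha ->
  (* (a) intertwining of the Heisenberg representations, on V *)
  ((forall (P0 : R) (u : Vlist),
      (exists v : Vlist, Vsum v = V0 P0 (Vsum u)) /\
      (forall v : Vlist, Vsum v = V0 P0 (Vsum u) ->
         KSH alpha t v = Vtau P0 (KSH alpha t u))) /\
   (forall (Q0 : R) (u : Vlist),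
      (exists v : Vlist, Vsum v = W0 Q0 (Vsum u)) /\
      (forall v : Vlist, Vsum v = W0 Q0 (Vsum u) ->
         KSH alpha t v = Wtau Q0 (KSH alpha t u)))) /\
  (* (b) U_tau extends to a unitary isomorphism L^2(R) -> H_{P_tau} *)
  ((forall u : Vlist, in_HP alpha t (KSH alpha t u)) /\
   (forall u v : Vlist,
      HP_inner alpha t (KSH alpha t u) (KSH alpha t v) = sch_inner (Vsum u) (Vsum v)) /\
   (forall f : R -> R[i], L2line f ->
      forall eps : R, 0 < eps -> exists u : Vlist, (sch_dist2 f (Vsum u) < eps%:E)%E) /\
   (forall psi : R -> R -> R[i], in_HP alpha t psi ->
      forall eps : R, 0 < eps ->
        exists u : Vlist, (HP_dist2 alpha t psi (KSH alpha t u) < eps%:E)%E)) /\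
  (* (c) explicit formula for U_tau psi_Y *)
  (forall P Q : R,
     (exists abc, heat_gauss alpha t P Q abc) /\
     (forall x p : R,
        KSH_coh alpha t P Q x p = formula1 alpha t theta P Q x p /\
        KSH_coh alpha t P Q x p = formula2 alpha t theta P Q x p)).
Proof.
move=> al0 t0 tl th0 thl ta.
split; first by split=> [P0|Q0] u; [exact: (KSH_V al0 t0 tl th0 thl ta)|exact: (KSH_W al0 t0 tl th0 thl ta)].
split.
  split; first exact: (KSH_in_HP al0 t0 tl th0 thl ta).
  split; first exact: (KSH_isometry al0 t0 tl th0 thl ta).
  split; first by move=> f fL eps e0; exact: Vsum_dense.
  by move=> psi; exact: (KSH_dense al0 t0 tl th0 thl ta).
move=> P Q; split; first exact: (KSH_heat_exists al0 t0 tl th0 thl ta).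
by move=> x p; rewrite -(formula1E2 al0 t0 tl th0 thl ta)
  (KSH_coh_formula1 al0 t0 tl th0 thl ta).
Qed.
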